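(* Let $\alpha>1$ and $\mu=E\{X_1\}$. For fixed $s\in\mathbb N=\{0,1,2,\ldots\}$, as $t\to\infty$, $$\left(\frac{\Lambda_s(t)}{U(t)},\frac{X^*_{N(t)-s}}{U(t)},\frac{\Sigma_s(t)}{t}\right)\overset{D}{\to}(\Lambda_s,\Xi_s,\Sigma_s),$$ where the limit has the joint Laplace transform $$E\left\{\exp(-u\Lambda_s-v\Xi_s-w\Sigma_s)\right\}=\frac1{s!}\int_0^\infty\left(\frac z\gamma\int_1^\infty\frac{e^{-uz^{-\gamma}\eta}}{\eta^{1+1/\gamma}}d\eta\right)^{s}e^{-vz^{-\gamma}}\,q_{s+1}(z+w\mu)\,dz.$$ If $\Theta=1$ a.s., $$E\left\{\exp(-u\Lambda_s-v\Xi_s-w\Sigma_s)\right\}=e^{-w\mu}\,\frac1{s!}\int_0^\infty\left(\frac z\gamma\int_1^\infty\frac{e^{-uz^{-\gamma}\eta}}{\eta^{1+1/\gamma}}d\eta\right)^{s}e^{-vz^{-\gamma}-z}\,dz.$$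
   Context: Let $X_1,X_2,\ldots$ be independent positive random variables (claims) with common distribution function $F$ satisfying $1-F(x)=x^{-\alpha}\ell(x)$, $x>0$, with $\alpha>0$ and $\ell$ slowly varying at infinity. Put $\gamma=1/\alpha$ and $U(y)=F^{\leftarrow}(1-1/y)$, where $F^{\leftarrow}$ is the generalized inverse of $F$. Let $N(t)$ be the number of claims up to time $t$, where $(N(t))_{t\ge0}$ is independent of $(X_i)_{i\ge1}$ and is near mixed Poisson: $N(t)/t\overset{D}{\to}\Theta$ as $t\to\infty$ for some random variable $\Theta$. For integers $r\ge0$ let $q_r(w)=E\{e^{-w\Theta}\Theta^r\}$. For given $N(t)=n$, $X_1^*\le\cdots\le X_n^*$ are the order statistics of $X_1,\ldots,X_n$, and $X_r^*=0$ for $r\le 0$. Set $$\Sigma_s(t)=\sum_{j=1}^{N(t)-s-1}X_j^*,\qquad \Lambda_s(t)=\sum_{j=N(t)-s+1}^{N(t)}X_j^*,$$ where empty sums are $0$. $\overset{D}{\to}$ is convergence in distribution.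
   Formalization: The hypothesis Θ>0 almost surely is added: without it the formula fails, since at u=v=w=0 its right side equals P(Θ>0) while the left side is 1 (for example N(t)=0 for all t, Θ=0). *)

(* Defs.v *)
From HB Require Import structures.
From mathcomp Require Import all_boot all_order all_algebra.
From mathcomp Require Import all_classical all_reals all_analysis.

Set Implicit Arguments.
Unset Strict Implicit.
Unset Printing Implicit Defensive.

Import Order.TTheory GRing.Theory Num.Theory.
Import numFieldNormedType.Exports.

Local Open Scope classical_set_scope.
Local Open Scope ring_scope.

Section Independence.
Context (d : measure_display) (T : measurableType d) (R : realType)
  (P : probability T R).

Definition mutually_independent (X : nat -> {RV P >-> R}) : Prop :=
  forall (J : seq nat) (B : nat -> set R), uniq J ->
    (forall i, measurable (B i)) ->
    P (\bigcap_(i in [set` J]) (X i @^-1` B i)) =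
    (\prod_(i <- J) P (X i @^-1` B i))%E.

Definition sigma_of (I : Type) (D : set I) (d' : measure_display)
    (T' : measurableType d') (X : I -> {RV P >-> T'}) : set (set T) :=
  <<s \bigcup_(i in D) preimage_set_system setT (X i) measurable >>.

Definition independent_sigma (G H : set (set T)) : Prop :=
  forall A B, G A -> H B -> P (A `&` B) = (P A * P B)%E.

End Independence.

(* Weak convergence of the laws of Z t, as t -> +oo, to the law of Z0; the
   Z t and Z0 may be defined on different probability spaces. *)
Definition cvg_in_distribution (R : realType)
    (d1 : measure_display) (T1 : measurableType d1) (P1 : probability T1 R)
    (d2 : measure_display) (T2 : measurableType d2) (P2 : probability T2 R)
    (E : topologicalType) (Z : R -> T1 -> E) (Z0 : T2 -> E) : Prop :=
  forall f : E -> R, continuous f -> (exists M, forall e, `|f e| <= M) ->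
    ('E_P1[f \o Z t])%E @[t --> +oo%R] --> ('E_P2[f \o Z0])%E.

Definition slowly_varying (R : realType) (l : R -> R) : Prop :=
  [/\ measurable_fun (`]0, +oo[ : set R) l,
      \forall x \near +oo%R, 0 < l x &
      forall c, 0 < c -> l (c * x) / l x @[x --> +oo%R] --> (1 : R)].

(* Meaningful for 0 < p < 1, where the set is nonempty and bounded below
   whenever F is a distribution function. *)
Definition generalized_inverse (R : realType) (F : R -> R) (p : R) : R :=
  inf [set x | p <= F x].

Definition tail_quantile (R : realType) (F : R -> R) (y : R) : R :=
  generalized_inverse F (1 - y^-1).

Section LargeClaims.
Context (R : realType) (T : Type).
Variables (X : nat -> T -> R) (N : R -> T -> nat).

(* The r-th smallest (r = 1, ..., n) of the first n claims, which are
   X 0, ..., X n.-1; it is 0 for r = 0. *)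
Definition order_stat (n r : nat) (x : T) : R :=
  if r is r'.+1 then nth 0 (sort <=%R [seq X i x | i <- iota 0 n]) r' else 0.

(* Below, differences of naturals are truncated at 0: an index N(t) - s <= 0
   becomes 0, where order_stat is 0, and the sum over j starts at 1 at the
   earliest, only dropping terms of nonpositive index, which are 0. *)
Definition threshold_claim (s : nat) (t : R) (x : T) : R :=
  order_stat (N t x) (N t x - s) x.

Definition small_claims (s : nat) (t : R) (x : T) : R :=
  \sum_(1 <= j < N t x - s) order_stat (N t x) j x.

Definition large_claims (s : nat) (t : R) (x : T) : R :=
  \sum_((N t x - s).+1 <= j < (N t x).+1) order_stat (N t x) j x.

End LargeClaims.

Definition mixing_transform (R : realType) (d : measure_display)
    (T : measurableType d) (Q : probability T R) (Theta : {RV Q >-> R})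
    (r : nat) (w : R) : R :=
  fine ('E_Q[(fun x => expR (- w * Theta x) * Theta x ^+ r)%R])%E.

Definition pareto_factor (R : realType) (gamma u z : R) : R :=
  z / gamma * \int[lebesgue_measure]_(eta in `[1, +oo[)
                (expR (- u * z `^ (- gamma) * eta) / eta `^ (1 + gamma^-1)).

Definition joint_laplace (R : realType) (d : measure_display)
    (T : measurableType d) (P : probability T R) (Lambda Xi Sigma : {RV P >-> R})
    (u v w : R) : \bar R :=
  ('E_P[(fun x => expR (- u * Lambda x - v * Xi x - w * Sigma x))%R])%E.

(* Main.v *)
(* Everything is done with Laplace transforms, first for a fixed number n of
   claims. Summing over the choices of a threshold claim and of s larger ones,
   independence gives the joint transform of the three statistics as
     n C(n-1, s) E[e^(-v X / U) a(X)^s c(X)^(n-1-s)],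
   where a and c are the transforms of a claim restricted to values above and
   below the threshold. The law of X is t^-1 times the image of the Lebesgue
   measure on ]0, t[ under z |-> U(t / z), and U(t / z) / U(t) -> z^-gamma, so
   dominated convergence gives the limit
     theta^(s+1) / s! int_0^oo pareto_factor^s e^(-v z^-gamma - theta (z + w mu)) dz
   when n / t -> theta and t -> +oo. This convergence is uniform for theta in
   compact subsets of ]0, +oo[, so one can average over N(t) / t. Convergence
   of Laplace transforms implies convergence in distribution by approximating
   continuous functions of (e^-x, e^-y, e^-z) with Bernstein polynomials, and
   the limit law is realized as (z^-gamma (Y_1 + ... + Y_s), z^-gamma, mu Theta),
   with Y_i independent Pareto variables and z of Gamma(s+1, Theta) law. *)

Require Import Defs.
From HB Require Import structures.
From mathcomp Require Import all_boot all_order all_algebra zify ring lra.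
From mathcomp Require Import all_classical all_reals all_analysis.
From mathcomp Require Import measurable_realfun random_variable.

Set Implicit Arguments.
Unset Strict Implicit.
Unset Printing Implicit Defensive.

Import Order.TTheory GRing.Theory Num.Theory.
Import numFieldNormedType.Exports.

Local Open Scope classical_set_scope.
Local Open Scope ring_scope.

(** * Order statistics *)

(** [F] may have atoms, and this shapes the fixed-[n] part. With ties, several choices of threshold
    and large claims describe the same order statistics, so the product formula computes the
    transform weighted by the number [top_count] of choices, not the transform itself. The weight is
    at least 1, hence the error is at most the total weighted mass minus 1. That mass is the same
    formula at [u = v = w = 0], and its limit is the integral of a Gamma density, that is 1; ties
    thus vanish in the limit without an estimate of their own. Atoms also prevent inverting [F]:
    what is known of [U] comes from the equivalence of [x < U t] with [t^-1 < 1 - F x]. The exponent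
    [z + w mean] arises from one claim: [t] times the defect of its lower transform splits into
    exceedances of the threshold, which give [z], and the discount on smaller claims, which gives
    [w mean] because [alpha > 1] makes the claims integrable. For fixed [n] the limits are taken
    along arbitrary sequences; an argument by contradiction and compactness makes them uniform in
    [n / t]. Claims are positive only almost surely, so the work is done for their positive
    parts. *)

Section order_statistics.
Context (R : realType) (T : Type) (X : nat -> T -> R) (s : nat).
Implicit Types (n : nat) (x : T).

(** A list has only one sorted permutation, and the right-hand side is sorted because [X j x]
    separates the values of [B] from those of [A]. *)
Lemma sort_claims_split n x (A B : seq nat) j :
  perm_eq (iota 0 n) (B ++ j :: A) ->
  {in A, forall i, X j x <= X i x} -> {in B, forall i, X i x <= X j x} ->
  sort <=%R [seq X i x | i <- iota 0 n] =
  sort <=%R [seq X i x | i <- B] ++ X j x :: sort <=%R [seq X i x | i <- A].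
Proof.
move=> pAB hA hB.
apply: (@sorted_eq _ <=%R) => //.
- exact: le_trans.
- exact: le_anti.
- exact/sort_sorted/le_total.
- rewrite (sorted_pairwise (@le_trans _ R)) pairwise_cat.
  rewrite -!(sorted_pairwise (@le_trans _ R)) (sort_sorted (@le_total _ R))/=.
  rewrite path_min_sorted ?(sort_sorted (@le_total _ R)) ?andbT.
    apply/allrelP => y z; rewrite mem_sort => /mapP[i iB ->].
    rewrite in_cons mem_sort => /orP[/eqP->|/mapP[k kA ->]]; first exact: hB.
    exact: le_trans (hB _ iB) (hA _ kA).
  by apply/allP => y; rewrite mem_sort => /mapP[i iA ->]; exact: hA.
- rewrite perm_sort; apply: (perm_trans (perm_map (X ^~ x) pAB)).
  rewrite map_cat /= perm_sym; apply: perm_cat; first by rewrite perm_sort.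
  by rewrite perm_cons perm_sort.
Qed.

(** Since [size B = n - s - 1], the claim [j] sits at rank [n - s], counted from 1. The sums below
    and above it run over sorted copies of [B] and [A], and a sum ignores the order. *)
Lemma order_stat_split n x (A B : seq nat) j :
  perm_eq (iota 0 n) (B ++ j :: A) -> size A = s ->
  {in A, forall i, X j x <= X i x} -> {in B, forall i, X i x <= X j x} ->
  [/\ order_stat X n (n - s) x = X j x,
      \sum_(1 <= k < n - s) order_stat X n k x = \sum_(i <- B) X i x &
      \sum_((n - s).+1 <= k < n.+1) order_stat X n k x = \sum_(i <- A) X i x].
Proof.
move=> pAB sA hA hB; have srt := sort_claims_split pAB hA hB.
have szn : n = (size B + s.+1)%N.
  by rewrite -(size_iota 0 n) (perm_size pAB) size_cat/= sA.
have nsE : (n - s)%N = (size B).+1 by rewrite szn addnS subSn ?leq_addl// addnK.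
have oE k : order_stat X n k.+1 x =
    nth 0 (sort <=%R [seq X i x | i <- B] ++
           X j x :: sort <=%R [seq X i x | i <- A]) k by rewrite /order_stat srt.
have sumE (l : seq nat) : \sum_(0 <= k < size l)
    nth 0 (sort <=%R [seq X i x | i <- l]) k = \sum_(i <- l) X i x.
  rewrite -[in RHS](big_map (X ^~ x) xpredT idfun)/=.
  rewrite -(perm_big _ (permEl (perm_sort <=%R [seq X i x | i <- l])))/=.
  by rewrite [RHS](big_nth 0) size_sort size_map.
split.
- by rewrite nsE oE nth_cat size_sort size_map ltnn subnn.
- rewrite nsE big_add1 -sumE; apply: eq_big_nat => k /andP[_ kB].
  by rewrite oE nth_cat size_sort size_map kB.
- rewrite nsE big_add1 -[X in \sum_(X <= _ < _) _]add0n big_addn.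
  have -> : (n.+1.-1 - (size B).+1)%N = size A.
    by rewrite szn sA /= addnS subSS addKn.
  rewrite -sumE; apply: eq_big_nat => k /andP[_ kA].
  rewrite oE nth_cat size_sort size_map.
  by rewrite ltnNge ltnW/= ?ltnS ?leq_addl// -addnBA// subSnn addn1.
Qed.

(* With ties, several pairs [(j, A)] qualify, but they all yield the same order
   statistics. *)
Definition top_split n x (j : 'I_n) (A : {set 'I_n}) : bool :=
  [forall i : 'I_n, (i != j) ==>
     (if i \in A then X j x <= X i x else X i x <= X j x)].

(** Product form on which independence acts: once claim [j] is frozen, each factor depends on a
    single other claim. *)
Lemma natr_top_split n x (j : 'I_n) (A : {set 'I_n}) :
  (top_split x j A)%:R = \prod_(i < n | i != j)
    (if i \in A then (X j x <= X i x)%R%:R else (X i x <= X j x)%R%:R) :> R.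
Proof.
rewrite /top_split -big_andE.
rewrite (big_morph (fun b : bool => b%:R) (id1 := 1) (op1 := *%R))//.
  by apply: eq_bigr => i _; case: ifP.
by move=> [] []; rewrite /= ?mulr1 ?mulr0.
Qed.

Lemma top_split_stats n x (j : 'I_n) (A : {set 'I_n}) :
  #|A| = s -> j \notin A -> top_split x j A ->
  [/\ order_stat X n (n - s) x = X j x,
      \sum_(1 <= k < n - s) order_stat X n k x =
        \sum_(i | (i != j) && (i \notin A)) X i x &
      \sum_((n - s).+1 <= k < n.+1) order_stat X n k x = \sum_(i in A) X i x].
Proof.
move=> cA jA /forallP sp.
pose sA := [seq val i | i <- enum A].
pose sB := [seq val i | i <- enum [pred i | (i != j) && (i \notin A)]].
have [//||||-> -> ->] := @order_stat_split n x sA sB j.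
- apply: uniq_perm; first exact: iota_uniq.
  + rewrite cat_uniq/= !map_inj_uniq ?enum_uniq//; try exact: val_inj.
    rewrite andbT/= negb_or !mem_map; try exact: val_inj.
    rewrite !mem_enum/= !inE eqxx/= jA andbT.
    apply/hasPn => _ /mapP[i iA ->]; rewrite mem_map; last exact: val_inj.
    by move: iA; rewrite !mem_enum !inE => ->; rewrite andbF.
  + move=> k; rewrite mem_iota add0n/= mem_cat in_cons.
    apply/idP/idP => [kn|].
      have [kj|kj] := eqVneq k j; first by rewrite orbT.
      have [kA|kA] := boolP (Ordinal kn \in A).
        by rewrite (_ : k \in sA) ?orbT// (@mem_map _ _ val val_inj _ (Ordinal kn)) mem_enum.
      rewrite (@mem_map _ _ val val_inj _ (Ordinal kn)) mem_enum inE.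
      by rewrite kA andbT -val_eqE/= kj.
    by case/or3P => [/mapP[i _ ->]|/eqP->|/mapP[i _ ->]]; exact: ltn_ord.
- by rewrite size_map -cardE.
- move=> ? /mapP[i + ->]; rewrite mem_enum => iA.
  have := sp i; rewrite iA => /implyP; apply.
  by apply: contraNneq jA => <-.
- move=> ? /mapP[i + ->]; rewrite mem_enum inE => /andP[ij iA].
  by have := sp i; rewrite ij/= (negbTE iA).
- by split=> //; rewrite big_map big_enum.
Qed.

(** The indices are sorted by the values of their claims. The threshold is the index at position
    [n - s.+1], counted from 0, and [A] consists of the [s] indices after it; ties are broken by the
    sort. *)
Lemma top_split_exists n x : (s < n)%N ->
  exists (j : 'I_n) (A : {set 'I_n}), [/\ #|A| = s, j \notin A & top_split x j A].
Proof.
move=> sn; pose r (i k : 'I_n) := X i x <= X k x.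
have rT : total r by move=> i k; exact: le_total.
have rtr : transitive r by move=> i k l; exact: le_trans.
pose t := sort r (enum 'I_n).
have st : size t = n by rewrite size_sort size_enum_ord.
have ut : uniq t by rewrite sort_uniq enum_uniq.
have m : 'I_n by exact: Ordinal sn.
pose k := (n - s.+1)%N.
have kn : (k < size t)%N by rewrite st /k; lia.
pose j := nth m t k.
have := sort_sorted rT (enum 'I_n); rewrite -/t (sorted_pairwise rtr).
rewrite -{1}(cat_take_drop k t) (drop_nth m kn) pairwise_cat -/j /= allrel_consr.
case/andP => /andP[/allP lej _] /and3P[_ /allP jle _].
have := ut; rewrite -{1}(cat_take_drop k t) (drop_nth m kn) -/j cat_uniq/=.
case/and3P => _ _ /andP[jd ud].
exists j, [set i in drop k.+1 t]; split.
- by rewrite cardsE (card_uniqP ud) size_drop st /k; lia.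
- by rewrite inE.
- apply/forallP => i; apply/implyP => ij; rewrite inE.
  case: ifPn => [/jle//|id]; apply: lej.
  have : i \in t by rewrite mem_sort mem_enum.
  rewrite -{1}(cat_take_drop k t) (drop_nth m kn) -/j mem_cat in_cons.
  by case/or3P => [//|/eqP e|e]; [rewrite e eqxx in ij|rewrite e in id].
Qed.

Definition top_count n x : R :=
  \sum_(j < n) \sum_(A : {set 'I_n} | (#|A| == s) && (j \notin A))
    (top_split x j A)%:R.

Lemma top_count_ge1 n x : (s < n)%N -> 1 <= top_count n x.
Proof.
move=> sn; have [j [A [cA jA sp]]] := top_split_exists x sn.
rewrite /top_count (bigD1 j)//= (bigD1 A)/=; last by rewrite cA eqxx jA.
rewrite sp -addrA lerDl addr_ge0//; first by apply: sumr_ge0.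
by apply: sumr_ge0 => i _; apply: sumr_ge0.
Qed.

Lemma top_count_ge0 n x : 0 <= top_count n x.
Proof. by apply: sumr_ge0 => j _; exact: sumr_ge0. Qed.

(** All the pairs that qualify yield the same three statistics, so [g] factors out of the sum and
    only their number remains. *)
Lemma sum_top_split n x (g : R -> R -> R -> R) :
  \sum_(j < n) \sum_(A : {set 'I_n} | (#|A| == s) && (j \notin A))
    (top_split x j A)%:R *
    g (\sum_(i in A) X i x) (X j x) (\sum_(i | (i != j) && (i \notin A)) X i x) =
  top_count n x * g (\sum_((n - s).+1 <= k < n.+1) order_stat X n k x)
    (order_stat X n (n - s) x) (\sum_(1 <= k < n - s) order_stat X n k x).
Proof.
rewrite /top_count mulr_suml; apply: eq_bigr => j _.
rewrite mulr_suml; apply: eq_bigr => A /andP[/eqP cA jA].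
have [sp|] := boolP (top_split x j A); last by rewrite !mul0r.
by have [-> -> ->] := top_split_stats cA jA sp.
Qed.

Lemma order_stat_few n x : (n <= s)%N ->
  [/\ order_stat X n (n - s) x = 0,
      \sum_(1 <= k < n - s) order_stat X n k x = 0 &
      \sum_((n - s).+1 <= k < n.+1) order_stat X n k x = \sum_(i < n) X i x].
Proof.
move=> ns; have -> : (n - s)%N = 0%N by lia.
split=> //; first by rewrite big_geq.
rewrite big_add1/= -[RHS](big_mkord xpredT (X ^~ x)) /index_iota subn0.
rewrite -[RHS](big_map (X ^~ x) xpredT idfun)/=.
rewrite -(perm_big _ (permEl (perm_sort <=%R [seq X i x | i <- iota 0 n])))/=.
by rewrite [RHS](big_nth 0) size_sort size_map size_iota /index_iota subn0.
Qed.

End order_statistics.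

(** * Measurability of the order statistics *)

Lemma measurable_natr_bool d (T : measurableType d) (R : realType) (b : T -> bool) :
  measurable_fun setT b -> measurable_fun setT (fun x => (b x)%:R : R).
Proof.
move=> mb; rewrite (_ : (fun _ => _) = (fun x => if b x then 1 else 0 : R)).
  exact: measurable_fun_ifT.
by apply/funext => x; case: (b x).
Qed.

Section measurable_order_statistics.
Context (R : realType) d (T : measurableType d) (X : nat -> T -> R) (s : nat).
Hypothesis mX : forall i, measurable_fun setT (X i).

Lemma measurable_natr_top_split n (j : 'I_n) A :
  measurable_fun setT (fun x => (top_split X x j A)%:R : R).
Proof.
under eq_fun do rewrite natr_top_split big_mkcond.
apply: (@measurable_prod _ _ _ setT _ (index_enum 'I_n)) => i _.
case: (i != j) => //.
by case: (i \in A); apply: measurable_natr_bool; exact: measurable_fun_ler.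
Qed.

Lemma measurable_top_count n : measurable_fun setT (@top_count R T X s n).
Proof.
apply: measurable_sum => j.
under eq_fun do rewrite big_mkcond.
apply: measurable_sum => A; case: (_ && _) => //; exact: measurable_natr_top_split.
Qed.

Lemma measurable_sum_claims n (D : pred 'I_n) :
  measurable_fun setT (fun x => \sum_(i < n | D i) X i x).
Proof.
under eq_fun do rewrite big_mkcond.
by apply: measurable_sum => i; case: (D i).
Qed.

(** No measurability of sorting is required: by [sum_top_split] the functional is a finite sum of
    visibly measurable terms divided by [top_count]. *)
Lemma measurable_order_stat_functional n (g : R -> R -> R -> R) :
  (forall f1 f2 f3 : T -> R, measurable_fun setT f1 -> measurable_fun setT f2 ->
     measurable_fun setT f3 -> measurable_fun setT (fun x => g (f1 x) (f2 x) (f3 x))) ->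
  measurable_fun setT
    (fun x => g (\sum_((n - s).+1 <= k < n.+1) order_stat X n k x)
       (order_stat X n (n - s) x) (\sum_(1 <= k < n - s) order_stat X n k x)).
Proof.
(* For [n <= s] there is no admissible choice, [top_count] is 0 and the division is impossible; the
   statistics are then explicit. *)
move=> mg; have [ns|sn] := leqP n s.
  rewrite (_ : (fun x => _) = (fun x => g (\sum_(i < n) X i x) 0 0)).
    by apply: mg => //; exact: measurable_sum_claims.
  by apply/funext => x; have [-> -> ->] := order_stat_few X x ns.
rewrite (_ : (fun x => _) = (fun x => (top_count X s n x)^-1 *
    \sum_(j < n) \sum_(A : {set 'I_n} | (#|A| == s) && (j \notin A))
    (top_split X x j A)%:R *
    g (\sum_(i in A) X i x) (X j x) (\sum_(i | (i != j) && (i \notin A)) X i x))).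
  apply: measurable_funM.
    under eq_fun do rewrite -powR_inv1 ?top_count_ge0//.
    by apply: measurableT_comp (measurable_powR _) _; exact: measurable_top_count.
  apply: measurable_sum => j; under eq_fun do rewrite big_mkcond.
  apply: measurable_sum => A; case: (_ && _) => //; apply: measurable_funM.
    exact: measurable_natr_top_split.
  by apply: mg => //; exact: measurable_sum_claims.
apply/funext => x; rewrite sum_top_split mulKf//.
by rewrite gt_eqF// (lt_le_trans ltr01)// top_count_ge1.
Qed.

End measurable_order_statistics.

(** * Independence *)

Section independent_pair.
Local Open Scope ereal_scope.
Context (R : realType) d (T : measurableType d) (P : probability T R)
  d' (S : measurableType d') (Y : {mfun T >-> S}) (G : set (set T)).
Hypotheses (mG : G `<=` measurable) (GI : setI_closed G) (GT : G setT).
Hypothesis YG : forall A B, measurable A -> G B ->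
  P (Y @^-1` A `&` B) = P (Y @^-1` A) * P B.

Let sGm : <<s G >> `<=` @measurable _ T.
Proof. exact: smallest_sub (@sigma_algebra_measurable _ T) mG. Qed.

(** For fixed [A] both sides are finite measures in [B] that agree on the pi-system [G], hence on
    the sigma-algebra that it generates. *)
Let YsG A B : measurable A -> <<s G >> B ->
  P (Y @^-1` A `&` B) = P (Y @^-1` A) * P B.
Proof.
move=> mA sB.
have mYA : measurable (Y @^-1` A) by rewrite -[_ @^-1` _]setTI; exact: measurable_funP.
pose m1 := mrestr P mYA.
pose m2 := mscale (NngNum (fine_ge0 (measure_ge0 P (Y @^-1` A)))) P.
have uniq12 := @g_sigma_algebra_measure_unique _ _ _ G mG (fun=> setT) (fun=> GT)
  (bigcup_const _ (ex_intro _ 0%N I)) m1 m2 GI.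
have m2E C : m2 C = P (Y @^-1` A) * P C.
  by rewrite /m2/= /mscale/= fineK ?fin_num_measure.
rewrite setIC -m2E; apply: uniq12 => // [C GC|k].
- by rewrite [RHS]m2E -YG// setIC.
- rewrite /m1 /= /mrestr setTI.
  by apply: le_lt_trans (probability_le1 P mYA) _; rewrite ltry.
Qed.

Let idG : T -> g_sigma_algebraType G := idfun.

Let midG : measurable_fun setT idG.
Proof. by move=> _ B sB; rewrite setTI; exact: sGm. Qed.

(** The second variable is the sample point itself, seen through the identity [idG] into [T]
    equipped with the sigma-algebra generated by [G]. Thus [f] may depend on everything that [G]
    knows, such as all the other claims at once. The law of the pair is a product measure, and
    Tonelli's theorem concludes. *)
Lemma integral_independent_pair (f : S * g_sigma_algebraType G -> \bar R) :
  measurable_fun setT f -> (forall z, 0 <= f z) ->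
  \int[P]_x f (Y x, x) = \int[P]_x \int[P]_y f (Y x, y).
Proof.
move=> mf f0.
pose iG : {mfun T >-> g_sigma_algebraType G} :=
  HB.pack idG (isMeasurableFun.Build _ _ _ _ _ midG).
pose h x : S * g_sigma_algebraType G := (Y x, idG x).
have mh : measurable_fun setT h by apply: measurable_fun_pair.
pose hh : {mfun T >-> (S * g_sigma_algebraType G)%type} :=
  HB.pack h (isMeasurableFun.Build _ _ _ _ _ mh).
transitivity (\int[distribution P hh]_z f z).
  by rewrite ge0_integral_distribution.
transitivity (\int[distribution P Y \x distribution P iG]_z f z).
  apply: eq_measure_integral => A mA _; apply/esym.
  apply: (@product_measure_unique _ _ _ _ _ (distribution P Y) (distribution P iG)
    (distribution P hh)) => // B C mB mC; exact: YsG.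
rewrite fubini_tonelli1// /fubini_F.
rewrite ge0_integral_distribution//=; last 2 first.
- exact: (measurable_fun_fubini_tonelli_F (m2 := distribution P iG)).
- by move=> y; exact: integral_ge0.
apply: eq_integral => x _ /=; rewrite ge0_integral_distribution//.
exact: measurable_fun_pair2.
Qed.

End independent_pair.

Lemma measurable_fun_comp2 (R : realType) d (T : measurableType d)
    (h : R -> R -> R) (f g : T -> R) :
  measurable_fun setT (fun z : R * R => h z.1 z.2) ->
  measurable_fun setT f -> measurable_fun setT g ->
  measurable_fun setT (fun x => h (f x) (g x)).
Proof.
move=> mh mf mg.
exact: (measurableT_comp (f := fun z => h z.1 z.2) mh (measurable_fun_pair mf mg)).
Qed.

Section mutual_independence.
Local Open Scope ereal_scope.
Context (R : realType) d (T : measurableType d) (P : probability T R)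
  (X : nat -> {RV P >-> R}).
Hypothesis X_indep : mutually_independent X.

(** A pi-system of cylinders; the sigma-algebra that it generates makes the claims of index in [J]
    measurable. *)
Let boxes (J : seq nat) : set (set T) :=
  [set \bigcap_(i in [set` J]) (X i @^-1` B i) |
     B in [set B : nat -> set R | forall i, measurable (B i)]].

Let mX i (B : set R) : measurable B -> measurable (X i @^-1` B).
Proof. by move=> mB; rewrite -[_ @^-1` _]setTI; exact: measurable_funP. Qed.

Let measurable_boxes J : boxes J `<=` measurable.
Proof.
move=> _ [B mB <-]; apply: fin_bigcap_measurable; first exact: finite_seq.
by move=> i _; apply: mX; exact: mB.
Qed.

Let boxesI J : setI_closed (boxes J).
Proof.
move=> _ _ [B mB <-] [C mC <-]; exists (fun i => B i `&` C i).
  by move=> i; exact: measurableI.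
by rewrite -bigcapI.
Qed.

Let boxesT J : boxes J setT.
Proof. by exists (fun=> setT) => //; apply/seteqP; split. Qed.

Let indep_boxes j J : uniq (j :: J) -> forall A B, measurable A -> boxes J B ->
  P (X j @^-1` A `&` B) = P (X j @^-1` A) * P B.
Proof.
move=> /= /andP[jJ uJ] A _ mA [B mB <-].
have := X_indep (J := j :: J) (B := fun i => if i == j then A else B i).
rewrite /= jJ uJ big_cons eqxx => /(_ isT) H.
have -> : P (\bigcap_(i in [set` J]) X i @^-1` B i) =
    \prod_(i <- J) P (X i @^-1` (if i == j then A else B i)).
  rewrite X_indep//; apply: eq_big_seq => i iJ.
  by case: eqP => // ij; rewrite -ij iJ in jJ.
rewrite -H; last by move=> i; case: ifP.
congr (P _); apply/seteqP; split => x.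
  move=> [Ax Bx] i /=; rewrite in_cons => /orP[/eqP->|iJ]; first by rewrite eqxx.
  by case: eqP => [->//|_]; exact: Bx.
move=> ABx; split; first by have := ABx j; rewrite /= eqxx inE eqxx; exact.
move=> i iJ; have := ABx i; rewrite /= in_cons iJ orbT => /(_ isT).
by case: eqP => // ij; rewrite -ij iJ in jJ.
Qed.

Let mX_boxes J i : i \in J ->
  measurable_fun (setT : set (g_sigma_algebraType (boxes J))) (X i).
Proof.
move=> iJ _ B mB; rewrite setTI; apply: sub_sigma_algebra.
exists (fun k => if k == i then B else setT); first by move=> k; case: ifP.
apply/seteqP; split => x; first by move/(_ i iJ); rewrite eqxx.
by move=> Bx k _; case: eqP => [->|].
Qed.

Lemma integral_prod_indep (J : seq nat) (psi : nat -> R -> R) : uniq J ->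
  (forall i, measurable_fun setT (psi i)) -> (forall i y, (0 <= psi i y)%R) ->
  \int[P]_x (\prod_(i <- J) psi i (X i x))%:E =
  \prod_(i <- J) \int[P]_x (psi i (X i x))%:E.
Proof.
move=> + mpsi psi0; elim: J => [_|j J IH /[dup] uJ /andP[_ uJ']].
  rewrite big_nil; under eq_integral do rewrite big_nil.
  by rewrite (integral_cst P measurableT 1) mul1e; exact: probability_setT.
rewrite big_cons -IH//.
transitivity (\int[P]_x (psi j (X j x) * \prod_(i <- J) psi i (X i x))%:E).
  by apply: eq_integral => x _; rewrite big_cons.
rewrite (integral_independent_pair (@measurable_boxes J) (@boxesI J) (boxesT J)
  (indep_boxes uJ) (f := fun z => (psi j z.1 * \prod_(i <- J) psi i (X i z.2))%:E)) /=; last 2 first.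
- apply/measurable_EFinP/measurable_funM; first exact: measurableT_comp.
  apply: measurable_prod => i iJ; apply: measurableT_comp => //.
  by apply: measurableT_comp => //; exact: mX_boxes.
- by move=> z; rewrite lee_fin mulr_ge0// prodr_ge0.
under eq_integral => x _.
  under eq_integral do rewrite EFinM.
  rewrite ge0_integralZl//; last 3 first.
  - apply/measurable_EFinP; apply: measurable_prod => i iJ.
    exact: measurableT_comp.
  - by move=> y _; rewrite lee_fin prodr_ge0.
  - by rewrite lee_fin.
  over.
rewrite ge0_integralZr//.
- by apply/measurable_EFinP; exact: measurableT_comp.
- by move=> y _; rewrite lee_fin.
- by apply: integral_ge0 => y _; rewrite lee_fin prodr_ge0.
Qed.

(** Conditioning on claim [j]: its value enters the other factors only as a parameter, and given it
    these factors are independent. Claim [j] will be the threshold. *)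
Lemma integral_indep_prod (j : nat) (J : seq nat) (phi : R -> R)
    (psi : nat -> R -> R -> R) : uniq (j :: J) ->
  measurable_fun setT phi -> (forall y, (0 <= phi y)%R) ->
  (forall i, measurable_fun setT (fun z : R * R => psi i z.1 z.2)) ->
  (forall i y z, (0 <= psi i y z)%R) ->
  \int[P]_x (phi (X j x) * \prod_(i <- J) psi i (X j x) (X i x))%:E =
  \int[P]_x ((phi (X j x))%:E *
    \prod_(i <- J) \int[P]_y (psi i (X j x) (X i y))%:E).
Proof.
move=> uJ mphi phi0 mpsi psi0.
rewrite (integral_independent_pair (@measurable_boxes J) (@boxesI J) (boxesT J)
  (indep_boxes uJ)
  (f := fun z => (phi z.1 * \prod_(i <- J) psi i z.1 (X i z.2))%:E)) /=; last 2 first.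
- apply/measurable_EFinP/measurable_funM; first exact: measurableT_comp.
  apply: measurable_prod => i iJ.
  apply: (measurable_fun_comp2 (mpsi i)); first exact: measurable_fst.
  by apply: measurableT_comp => //; exact: mX_boxes.
- by move=> z; rewrite lee_fin mulr_ge0// prodr_ge0.
have mpsi2 i y : measurable_fun setT (psi i y).
  exact: (measurable_fun_comp2 (mpsi i)).
apply: eq_integral => x _.
under eq_integral do rewrite EFinM.
rewrite ge0_integralZl//; last 3 first.
- apply/measurable_EFinP; apply: measurable_prod => i iJ.
  exact: measurableT_comp.
- by move=> y _; rewrite lee_fin prodr_ge0.
- by rewrite lee_fin.
congr (_ * _); rewrite (integral_prod_indep (psi := fun i => psi i (X j x)))//.
by case/andP: uJ.
Qed.

End mutual_independence.

(** * Transform of the statistics of a fixed number of claims *)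

(** The open upper rays form a pi-system that generates the Borel sets, and countably many of them,
    of finite mass, cover the line. The laws met below are all identified through their tails. *)
Lemma rays_measure_unique (R : realType) (m1 m2 : {measure set R -> \bar R}) :
  (forall y : R, m1 `]y, +oo[%classic = m2 `]y, +oo[%classic) ->
  (forall y : R, (m1 `]y, +oo[%classic < +oo)%E) ->
  forall A, measurable A -> m1 A = m2 A.
Proof.
move=> m12 m1y; apply: (measure_unique (@RGenOInfty.G R)
    (fun k => `](- k%:R), +oo[%classic)).
- exact: RGenOInfty.measurableE.
- move=> _ _ [y ->] [z ->]; exists (Num.max y z).
  apply/seteqP; split => x /=; rewrite !in_itv/= !andbT gt_max.
    by move=> [-> ->].
  by move/andP.
- by move=> k; exists (- k%:R).
- apply/seteqP; split => // x _; exists (Num.bound `|x|) => //=.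
  rewrite in_itv/= andbT ltrNl.
  by rewrite (le_lt_trans (ler_norm _))// normrN archi_boundP.
- by move=> _ [y ->].
- by move=> k.
Qed.

Section top_count_expectation.
Local Open Scope ring_scope.
Context (R : realType) d (T : measurableType d) (P : probability T R)
  (X : nat -> {RV P >-> R}) (F : R -> R).
Hypothesis X_indep : mutually_independent X.
Hypothesis X_ge0 : forall i x, 0 <= X i x.
Hypothesis X_cdf : forall i (y : R), cdf (X i) y = (F y)%:E.

Lemma ccdf_claim i y : P (X i @^-1` `]y, +oo[) = (1 - F y)%:E.
Proof. by have := ccdf_1_cdf (X i) y; rewrite X_cdf EFinB. Qed.

Lemma integral_claim_id i (f : R -> \bar R) :
  measurable_fun setT f -> (forall y, (0 <= f y)%E) ->
  (\int[P]_x f (X i x) = \int[P]_x f (X 0%N x))%E.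
Proof.
move=> mf f0.
rewrite -[LHS](ge0_integral_distribution (X i))//.
rewrite -[RHS](ge0_integral_distribution (X 0%N))//.
apply: eq_measure_integral => A mA _.
apply: rays_measure_unique => // y.
  by transitivity ((1 - F y)%:E); [exact: ccdf_claim|exact/esym/ccdf_claim].
by rewrite [X in (X < _)%E](ccdf_claim i y) ltry.
Qed.

(** Here and in [lower_laplace] the comparison is not strict, as in [top_split]: an atom at [y]
    contributes to both, which is how ties come to be counted several times. *)
Definition upper_laplace a y : R :=
  \int[P]_x (expR (- a * X 0%N x) * (y <= X 0%N x)%R%:R).

Definition lower_laplace c y : R :=
  \int[P]_x (expR (- c * X 0%N x) * (X 0%N x <= y)%R%:R).

Lemma measurable_upper_kernel a :
  measurable_fun setT (fun z : R * R => expR (- a * z.2) * (z.1 <= z.2)%R%:R).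
Proof.
apply: measurable_funM.
  apply: (measurableT_comp (@measurable_expR R)).
  by apply: measurable_funM => //; exact: measurable_snd.
by apply: measurable_natr_bool; exact: measurable_fun_ler.
Qed.

Lemma measurable_lower_kernel c :
  measurable_fun setT (fun z : R * R => expR (- c * z.2) * (z.2 <= z.1)%R%:R).
Proof.
apply: measurable_funM.
  apply: (measurableT_comp (@measurable_expR R)).
  by apply: measurable_funM => //; exact: measurable_snd.
by apply: measurable_natr_bool; exact: measurable_fun_ler.
Qed.

Lemma mul_natr_bool_le1 (z : R) (b : bool) : 0 <= z <= 1 -> 0 <= z * b%:R <= 1.
Proof. by case: b; rewrite ?mulr1// mulr0 lexx ler01. Qed.

Lemma expR_claim_bounds a x : 0 <= a -> 0 <= expR (- a * X 0%N x) <= 1.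
Proof. by move=> a0; rewrite expR_ge0/= expR_le1 mulNr oppr_le0 mulr_ge0. Qed.

Lemma bounded_integral (g : T -> R) : measurable_fun setT g ->
  (forall x, 0 <= g x <= 1) ->
  [/\ (\int[P]_x (g x)%:E)%E = (\int[P]_x g x)%:E & 0 <= \int[P]_x g x <= 1].
Proof.
move=> mg g01.
have g0 x : (0 <= (g x)%:E)%E by rewrite lee_fin; case/andP: (g01 x).
have I0 : (0 <= \int[P]_x (g x)%:E)%E by exact: integral_ge0.
have I1 : (\int[P]_x (g x)%:E <= 1)%E.
  apply: (@le_trans _ _ (\int[P]_x (cst 1%E x))%E).
    apply: ge0_le_integral => //; first exact/measurable_EFinP.
    by move=> x _; rewrite lee_fin; case/andP: (g01 x).
  by rewrite (integral_cst P measurableT 1%E) mul1e probability_le1.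
have fI : (\int[P]_x (g x)%:E)%E \is a fin_num.
  by rewrite ge0_fin_numE// (le_lt_trans I1)// ltry.
split; first by rewrite /Rintegral fineK.
by rewrite /Rintegral -!lee_fin fineK// I0 I1.
Qed.

Lemma upper_laplaceE a y : 0 <= a ->
  (\int[P]_x (expR (- a * X 0%N x) * (y <= X 0%N x)%R%:R)%:E)%E =
    (upper_laplace a y)%:E.
Proof.
move=> a0; apply: (bounded_integral _ _).1.
  exact: (measurable_fun_comp2 (f := fun=> y)
    (h := fun p q => expR (- a * q) * (p <= q)%R%:R) (measurable_upper_kernel a)).
by move=> x; apply: mul_natr_bool_le1; exact: expR_claim_bounds.
Qed.

Lemma upper_laplace_bounds a y : 0 <= a -> 0 <= upper_laplace a y <= 1.
Proof.
move=> a0; apply: (bounded_integral _ _).2.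
  exact: (measurable_fun_comp2 (f := fun=> y)
    (h := fun p q => expR (- a * q) * (p <= q)%R%:R) (measurable_upper_kernel a)).
by move=> x; apply: mul_natr_bool_le1; exact: expR_claim_bounds.
Qed.

Lemma lower_laplaceE c y : 0 <= c ->
  (\int[P]_x (expR (- c * X 0%N x) * (X 0%N x <= y)%R%:R)%:E)%E =
    (lower_laplace c y)%:E.
Proof.
move=> c0; apply: (bounded_integral _ _).1.
  exact: (measurable_fun_comp2 (f := fun=> y)
    (h := fun p q => expR (- c * q) * (q <= p)%R%:R) (measurable_lower_kernel c)).
by move=> x; apply: mul_natr_bool_le1; exact: expR_claim_bounds.
Qed.

Lemma lower_laplace_bounds c y : 0 <= c -> 0 <= lower_laplace c y <= 1.
Proof.
move=> c0; apply: (bounded_integral _ _).2.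
  exact: (measurable_fun_comp2 (f := fun=> y)
    (h := fun p q => expR (- c * q) * (q <= p)%R%:R) (measurable_lower_kernel c)).
by move=> x; apply: mul_natr_bool_le1; exact: expR_claim_bounds.
Qed.

Lemma measurable_upper_laplace a : 0 <= a -> measurable_fun setT (upper_laplace a).
Proof.
move=> a0; apply/measurable_EFinP.
rewrite (_ : _ \o _ = fubini_F (distribution P (X 0%N))
  (fun z : R * R => (expR (- a * z.2) * (z.1 <= z.2)%R%:R)%:E)).
  apply: measurable_fun_fubini_tonelli_F => /=.
    by apply/measurable_EFinP; exact: measurable_upper_kernel.
  by move=> z; rewrite lee_fin mulr_ge0 ?expR_ge0.
apply/funext => y /=; rewrite -upper_laplaceE// /fubini_F.
rewrite ge0_integral_distribution//=.
apply/measurable_EFinP.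
exact: (measurable_fun_comp2 (f := fun=> y)
    (h := fun p q => expR (- a * q) * (p <= q)%R%:R) (measurable_upper_kernel a)).
Qed.

Lemma measurable_lower_laplace c : 0 <= c -> measurable_fun setT (lower_laplace c).
Proof.
move=> c0; apply/measurable_EFinP.
rewrite (_ : _ \o _ = fubini_F (distribution P (X 0%N))
  (fun z : R * R => (expR (- c * z.2) * (z.2 <= z.1)%R%:R)%:E)).
  apply: measurable_fun_fubini_tonelli_F => /=.
    by apply/measurable_EFinP; exact: measurable_lower_kernel.
  by move=> z; rewrite lee_fin mulr_ge0 ?expR_ge0.
apply/funext => y /=; rewrite -lower_laplaceE// /fubini_F.
rewrite ge0_integral_distribution//=.
apply/measurable_EFinP.
exact: (measurable_fun_comp2 (f := fun=> y)
    (h := fun p q => expR (- c * q) * (q <= p)%R%:R) (measurable_lower_kernel c)).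
Qed.

Section fixed_size.
Variables (s n : nat) (a b c : R).
Hypotheses (a_ge0 : 0 <= a) (b_ge0 : 0 <= b) (c_ge0 : 0 <= c).

Let psi (A : {set 'I_n}) (k : nat) (y z : R) : R :=
  if k \in [seq val i | i <- enum A] then expR (- a * z) * (y <= z)%R%:R
  else expR (- c * z) * (z <= y)%R%:R.

Let psi_ord A (i : 'I_n) y z : psi A i y z =
  if i \in A then expR (- a * z) * (y <= z)%R%:R
  else expR (- c * z) * (z <= y)%R%:R.
Proof. by rewrite /psi (mem_map val_inj) mem_enum. Qed.

Let measurable_psi A k : measurable_fun setT (fun z : R * R => psi A k z.1 z.2).
Proof.
rewrite /psi; case: (k \in _); first exact: measurable_upper_kernel.
exact: measurable_lower_kernel.
Qed.

(** Both the indicator and the exponential of the three sums factor claim by claim, so each claim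
    other than [j] brings one factor that involves only itself and the threshold. *)
Let top_split_term (j : 'I_n) (A : {set 'I_n}) x : j \notin A ->
  (top_split X x j A)%:R * expR (- a * (\sum_(i in A) X i x) - b * X j x -
     c * \sum_(i | (i != j) && (i \notin A)) X i x) =
  expR (- b * X j x) *
  \prod_(k <- [seq val i | i <- enum (predC1 j)]) psi A k (X j x) (X k x).
Proof.
move=> jA; rewrite big_map big_enum/= natr_top_split.
have -> : - a * (\sum_(i in A) X i x) - b * X j x -
     c * \sum_(i | (i != j) && (i \notin A)) X i x =
  - b * X j x + \sum_(i | i != j) (if i \in A then - a * X i x else - c * X i x).
  rewrite [X in _ = _ + X](bigID (mem A))/= [X in _ + (X + _)](_ : _ = - a * \sum_(i in A) X i x).
    rewrite [X in _ + (_ + X)](_ : _ = - c * \sum_(i | (i != j) && (i \notin A)) X i x).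
      by rewrite !mulNr; lra.
    by rewrite mulr_sumr; apply: eq_bigr => i /andP[_ /negbTE ->].
  rewrite mulr_sumr; apply: eq_big => i.
    by case: eqP => // ->; rewrite (negbTE jA).
  by case/andP => _ ->.
rewrite expRD mulrCA; congr (_ * _).
rewrite expR_sum -big_split/=; apply: eq_big => [i|i _]; first by rewrite inE.
by rewrite psi_ord; case: ifP => _; rewrite mulrC.
Qed.

(** Given the threshold, the [s] claims in [A] give equal upper transforms and the [n.-1 - s] others
    equal lower ones. The result depends on neither [j] nor [A]. *)
Lemma integral_top_split (j : 'I_n) (A : {set 'I_n}) : j \notin A -> #|A| = s ->
  (\int[P]_x ((top_split X x j A)%:R *
     expR (- a * (\sum_(i in A) X i x) - b * X j x -
           c * \sum_(i | (i != j) && (i \notin A)) X i x))%:E =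
  \int[P]_x (expR (- b * X 0%N x) * upper_laplace a (X 0%N x) ^+ s *
     lower_laplace c (X 0%N x) ^+ (n.-1 - s))%:E)%E.
Proof.
move=> jA cA.
under eq_integral do rewrite top_split_term//.
rewrite (integral_indep_prod X_indep (phi := fun y => expR (- b * y))); last 5 first.
- rewrite /= map_inj_uniq ?enum_uniq ?andbT; last exact: val_inj.
  by rewrite (mem_map val_inj) mem_enum inE eqxx.
- by apply: (measurableT_comp (@measurable_expR R)); exact: measurable_funM.
- by move=> y; exact: expR_ge0.
- exact: measurable_psi.
- by move=> i y z; rewrite /psi; case: ifP => _; rewrite mulr_ge0 ?expR_ge0.
have psi_int (i : 'I_n) y : (\int[P]_x (psi A i y (X i x))%:E =
    (if i \in A then upper_laplace a y else lower_laplace c y)%:E)%E.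
  rewrite (integral_claim_id i (f := fun z => (psi A i y z)%:E)); last 2 first.
  - apply/measurable_EFinP; exact: (measurable_fun_comp2 (f := fun=> y) (h := psi A i)
      (measurable_psi A i)).
  - by move=> z; rewrite lee_fin psi_ord; case: ifP => _; rewrite mulr_ge0 ?expR_ge0.
  under eq_integral do rewrite psi_ord.
  by case: (i \in A); [exact: upper_laplaceE|exact: lower_laplaceE].
transitivity (\int[P]_x (expR (- b * X j x) * upper_laplace a (X j x) ^+ s *
     lower_laplace c (X j x) ^+ (n.-1 - s))%:E)%E.
  apply: eq_integral => x _; rewrite big_map big_enum/=.
  under eq_bigr do rewrite psi_int.
  rewrite prodEFin -EFinM -mulrA; congr (_ * _)%:E.
  rewrite (bigID (mem A))/=; congr (_ * _).
    transitivity (\prod_(i in A) upper_laplace a (X j x)).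
      apply: eq_big => i; last by case/andP => _ ->.
      by rewrite inE; case: eqP => // ->; rewrite (negbTE jA).
    by rewrite prodr_const cA.
  transitivity (\prod_(i in ~: (j |: A)) lower_laplace c (X j x)).
    apply: eq_big => i; last by case/andP => _ /negbTE ->.
    by rewrite !inE negb_or.
  rewrite prodr_const; congr (_ ^+ _).
  have := cardsC (j |: A); rewrite cardsU1 jA cA card_ord; lia.
apply: (integral_claim_id j (f := fun y => (expR (- b * y) * upper_laplace a y ^+ s *
     lower_laplace c y ^+ (n.-1 - s))%:E)).
- apply/measurable_EFinP; apply: measurable_funM; first apply: measurable_funM.
  + by apply: (measurableT_comp (@measurable_expR R)); exact: measurable_funM.
  + by apply: measurable_funX; exact: measurable_upper_laplace.
  + by apply: measurable_funX; exact: measurable_lower_laplace.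
- move=> y; have /andP[? _] := upper_laplace_bounds y a_ge0.
  have /andP[? _] := lower_laplace_bounds y c_ge0.
  by rewrite lee_fin !mulr_ge0 ?expR_ge0 ?exprn_ge0.
Qed.

(** Every admissible pair contributes the same integral. There are [n] thresholds and, for each,
    ['C(n.-1, s)] sets, the subsets of size [s] of the complement of [j]. *)
Lemma integral_top_count :
  (\int[P]_x (top_count X s n x *
     expR (- a * (\sum_((n - s).+1 <= k < n.+1) order_stat X n k x) -
           b * order_stat X n (n - s) x -
           c * \sum_(1 <= k < n - s) order_stat X n k x))%:E =
  (n * 'C(n.-1, s))%:R%:E *
  \int[P]_x (expR (- b * X 0%N x) * upper_laplace a (X 0%N x) ^+ s *
     lower_laplace c (X 0%N x) ^+ (n.-1 - s))%:E)%E.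
Proof.
pose g u v w : R := expR (- a * u - b * v - c * w).
have mg (f1 f2 f3 : T -> R) : measurable_fun setT f1 -> measurable_fun setT f2 ->
    measurable_fun setT f3 -> measurable_fun setT (fun x => g (f1 x) (f2 x) (f3 x)).
  move=> m1 m2 m3; apply: (measurableT_comp (@measurable_expR R)).
  by apply: measurable_funB; first apply: measurable_funB; exact: measurable_funM.
have mt (j : 'I_n) A : measurable_fun setT (fun x => ((top_split X x j A)%:R *
    g (\sum_(i in A) X i x) (X j x) (\sum_(i | (i != j) && (i \notin A)) X i x))).
  apply: measurable_funM; first exact: measurable_natr_top_split.
  apply: (mg (fun x => \sum_(i in A) X i x) (X j)
    (fun x => \sum_(i | (i != j) && (i \notin A)) X i x)) => //.
    by apply: (measurable_sum_claims (X := X)).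
  by apply: (measurable_sum_claims (X := X)).
under eq_integral => x _.
  rewrite -[X in (_ * X)%:E]/(g _ _ _) -sum_top_split -sumEFin.
  under eq_bigr do rewrite -sumEFin.
  over.
rewrite ge0_integral_sum//; last 2 first.
- move=> j; under eq_fun do rewrite big_mkcond/=.
  apply: emeasurable_sum => A; case: (_ && _) => //.
  exact/measurable_EFinP/mt.
- by move=> j x _; apply: sume_ge0 => A _; rewrite lee_fin mulr_ge0 ?expR_ge0.
under eq_bigr => j _.
  under eq_integral do rewrite big_mkcond/=.
  rewrite ge0_integral_sum//; last 2 first.
  - by move=> A; case: (_ && _) => //; exact/measurable_EFinP/mt.
  - by move=> A x _; case: (_ && _) => //; rewrite lee_fin mulr_ge0 ?expR_ge0.
  rewrite (_ : \sum_(A <- _) _ = \sum_(A : {set 'I_n} | (#|A| == s) && (j \notin A))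
    \int[P]_x (expR (- b * X 0%N x) * upper_laplace a (X 0%N x) ^+ s *
     lower_laplace c (X 0%N x) ^+ (n.-1 - s))%:E)%E; last first.
    rewrite [RHS]big_mkcond; apply: eq_bigr => A _.
    case: ifP => [/andP[/eqP cA jA]|_]; last exact: integral0.
    exact: integral_top_split.
  over.
have cC (j : 'I_n) : #|[pred A : {set 'I_n} | (#|A| == s) && (j \notin A)]| = 'C(n.-1, s).
  rewrite -[n.-1](_ : #|~: [set j]| = _); last first.
    by have := cardsC [set j]%SET; rewrite cards1 card_ord; lia.
  rewrite -cards_draws cardsE; apply: eq_card => A.
  have jAE : (A \subset ~: [set j]%SET) = (j \notin A).
    by rewrite finset.subsetC finset.sub1set finset.in_setC.
  by rewrite [LHS]inE -jAE andbC.
under eq_bigr do rewrite sumr_const cC.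
by rewrite sumr_const card_ord -mulrnA mulnC mule_natl.
Qed.

End fixed_size.

End top_count_expectation.

(** * Regular variation *)

Lemma powR_lt_inv (R : realType) (alpha c z : R) : 0 < alpha -> 0 < c -> 0 < z ->
  (c < z `^ (- alpha^-1)) = (z < c `^ (- alpha)).
Proof.
move=> a0 c0 z0.
have zE : z^-1 = (z `^ (- alpha^-1)) `^ alpha.
  by rewrite -powRrM mulNr mulVf ?lt0r_neq0// powR_inv1// ltW.
have -> : (c < z `^ (- alpha^-1)) = (c `^ alpha < z^-1).
  rewrite zE; apply/idP/idP => h.
    by apply: gt0_ltr_powR; rewrite // nnegrE ?powR_ge0// ltW.
  rewrite ltNge; apply/negP => /(ge0_ler_powR (ltW a0)).
  rewrite !nnegrE powR_ge0 ltW// => /(_ isT isT).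
  by rewrite leNgt h.
by rewrite powRN -[LHS]ltf_pV2 ?invrK// posrE ?invr_gt0// powR_gt0.
Qed.

Section regularly_varying_tail.
Context (R : realType) d (T : measurableType d) (P : probability T R)
  (Y : {RV P >-> R}) (F : R -> R) (alpha : R) (l : R -> R).
Hypothesis Y_ge0 : forall x, 0 <= Y x.
Hypothesis Y_cdf : forall y : R, cdf Y y = (F y)%:E.
Hypothesis F_tail : forall y : R, 0 < y -> 1 - F y = y `^ (- alpha) * l y.
Hypothesis l_slow : slowly_varying l.
Hypothesis alpha_gt0 : 0 < alpha.

Local Notation U := (tail_quantile F).
Lemma claim_gtE y : P (Y @^-1` `]y, +oo[) = (1 - F y)%:E.
Proof. by have := ccdf_1_cdf Y y; rewrite Y_cdf EFinB. Qed.

Lemma tail_ge0 y : 0 <= 1 - F y.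
Proof. by rewrite -lee_fin -claim_gtE. Qed.

Lemma tail_le1 y : 1 - F y <= 1.
Proof. by rewrite -lee_fin -claim_gtE; apply: probability_le1; exact: measurable_funPTI. Qed.

Lemma tail_anti y z : y <= z -> 1 - F z <= 1 - F y.
Proof. by move=> yz; rewrite lerB// -lee_fin -!Y_cdf cdf_nondecreasing. Qed.

Lemma tail_lt0 y : y < 0 -> 1 - F y = 1.
Proof.
move=> y0; apply/eqP; rewrite -eqe -claim_gtE; apply/eqP.
rewrite (_ : _ @^-1` _ = setT) ?probability_setT//.
apply/seteqP; split=> // x _; rewrite /= in_itv/= andbT.
exact: lt_le_trans y0 (Y_ge0 x).
Qed.

Lemma tail_cvg0 : (1 - F y) @[y --> +oo] --> (0 : R).
Proof.
rewrite (_ : (fun y => 1 - F y) = fine \o ccdf Y); last first.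
  by apply/funext => y /=; rewrite [ccdf Y y]claim_gtE.
exact/fine_cvg/cvg_ccdfy0.
Qed.

(** [l] is known to be positive only far out; monotonicity of the tail carries positivity back to
    every [y]. *)
Lemma tail_gt0 y : 0 < 1 - F y.
Proof.
have [_ l0 _] := l_slow.
near (pinfty_nbhs R) => z.
apply: (@lt_le_trans _ _ (1 - F z)); last first.
  by apply: tail_anti; near: z; exact/nbhs_pinfty_ge/num_real.
have z0 : 0 < z by near: z; exact/nbhs_pinfty_gt/num_real.
rewrite F_tail// mulr_gt0 ?powR_gt0//.
by near: z.
Unshelve. all: by end_near. Qed.

Lemma tail_ratio c : 0 < c ->
  (1 - F (c * x)) / (1 - F x) @[x --> +oo] --> c `^ (- alpha).
Proof.
move=> c0; have [_ l0 /(_ c c0) lc] := l_slow.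
rewrite -[X in _ --> X]mulr1.
apply: cvg_trans (cvgM (cvg_cst (c `^ (- alpha))) lc).
apply: near_eq_cvg; near=> x.
have x0 : 0 < x by near: x; exact/nbhs_pinfty_gt/num_real.
rewrite /= !F_tail ?mulr_gt0// powRM ?ltW//.
have xa := lt0r_neq0 (powR_gt0 (- alpha) x0).
have lx : l x != 0 by rewrite gt_eqF//; near: x.
by field; rewrite lx xa.
Unshelve. all: by end_near. Qed.

(** The Galois connection between quantile and tail, valid for discontinuous [F]. The condition
    [1 < t] makes 0 a lower bound of [S], since the tail is 1 at negative arguments. *)
Lemma lt_tail_quantile (t x : R) : 1 < t -> (x < U t) = (t^-1 < 1 - F x).
Proof.
move=> t1; have t0 : 0 < t by exact: lt_trans ltr01 t1.
have ti1 : t^-1 < 1 by rewrite invf_lt1.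
set S := [set x | 1 - t^-1 <= F x].
have SE y : S y <-> 1 - F y <= t^-1 by rewrite /S/=; split => ?; lra.
have S0 : S !=set0.
  near (pinfty_nbhs R) => z; exists z; apply/SE; apply/ltW; near: z.
  by apply: (cvgr_lt _ tail_cvg0); rewrite invr_gt0.
have lbS : has_lbound S.
  exists 0 => y /SE; apply: contraTle => /tail_lt0 ->.
  by rewrite -ltNge.
have SU y : U t < y -> 1 - F y <= t^-1.
  move=> /(inf_lt S0)[z /SE Sz zy].
  exact: le_trans (tail_anti (ltW zy)) Sz.
rewrite [RHS]ltNge; apply/idP/idP => [xU|].
  apply/negP => /SE /(ge_inf lbS).
  by rewrite leNgt xU.
(* Every [y > x] lies beyond the infimum, hence in [S]; right-continuity of the distribution
   function passes this on to [x]. *)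
apply: contraR; rewrite -leNgt => Ux; apply/SE.
rewrite /S/= -lee_fin -Y_cdf.
have rc : cdf Y z @[z --> x^'+] --> cdf Y x by exact: cdf_right_continuous.
apply: (cvge_to_ge rc); near=> y.
rewrite Y_cdf lee_fin; apply/SE/SU; apply: le_lt_trans Ux _.
by near: y; exact: nbhs_right_gt.
Unshelve. all: by end_near. Qed.

Lemma tail_quantile_cvgy : U t @[t --> +oo] --> +oo.
Proof.
apply/cvgryPgt => A; near=> t.
have t1 : 1 < t by near: t; exact/nbhs_pinfty_gt/num_real.
rewrite lt_tail_quantile// invf_plt ?posrE ?tail_gt0 ?(lt_trans ltr01 t1)//.
by near: t; exact/nbhs_pinfty_gt/num_real.
Unshelve. all: by end_near. Qed.

Lemma tail_tail_quantile_le t : 1 < t -> t * (1 - F (U t)) <= 1.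
Proof.
move=> t1; have t0 : 0 < t by exact: lt_trans ltr01 t1.
have : ~~ (U t < U t) by rewrite ltxx.
by rewrite lt_tail_quantile// -leNgt mulrC -ler_pdivlMr// mul1r.
Qed.

(** The product can stay below 1 when [F] jumps at [U t]. But just below the quantile, at
    [lam * U t] with [lam < 1], the tail exceeds [t^-1], and regular variation bounds the ratio of
    the two tails by nearly [lam ^ (- alpha)], which is close to 1. *)
Lemma cvg_tail_tail_quantile : t * (1 - F (U t)) @[t --> +oo] --> (1 : R).
Proof.
apply/cvgrPdist_lt => e e0.
set m := Num.min (e / 2) (1 / 2).
have m0 : 0 < m by rewrite lt_min !divr_gt0.
have m12 : m <= 1 / 2 by rewrite ge_min lexx orbT.
have me : m <= e / 2 by rewrite ge_min lexx.
(* Chosen so that the limiting ratio of tails, [lam] to the power [- alpha], is [(1 - m)^-1]. *)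
pose lam := (1 - m) `^ (alpha^-1).
have lam0 : 0 < lam by rewrite powR_gt0; lra.
have lam1 : lam < 1.
  have : lam < 1 `^ alpha^-1.
    by apply: gt0_ltr_powR; rewrite ?nnegrE ?invr_gt0//; lra.
  by rewrite powR1.
have lamE : lam `^ (- alpha) = (1 - m)^-1.
  by rewrite powRN /lam -powRrM mulVf ?lt0r_neq0// powRr1//; lra.
near=> t.
have t1 : 1 < t by near: t; exact/nbhs_pinfty_gt/num_real.
have t0 : 0 < t by exact: lt_trans ltr01 t1.
have := tail_tail_quantile_le t1.
have U0 : 0 < U t.
  by near: t; exact: (cvgry_gt tail_quantile_cvgy).
have lamU : lam * U t < U t by rewrite gtr_pMl.
have tl : 1 < t * (1 - F (lam * U t)).
  by move: lamU; rewrite lt_tail_quantile// -div1r ltr_pdivrMr// mulrC.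
have r0 : (1 - F (lam * U t)) / (1 - F (U t)) < (1 - m)^-1 + m.
  near: t.
  have := tail_ratio lam0; rewrite lamE => h.
  have hU : (1 - F (lam * U t)) / (1 - F (U t)) @[t --> +oo] --> (1 - m)^-1.
    exact: cvg_comp tail_quantile_cvgy h.
  by apply: (cvgr_lt _ hU); rewrite ltrDl.
move=> tU1; rewrite ger0_norm ?subr_ge0//.
have tU : t * (1 - F (lam * U t)) < ((1 - m)^-1 + m) * (t * (1 - F (U t))).
  rewrite mulrCA ltr_pM2l//.
  by move: r0; rewrite ltr_pdivrMr// tail_gt0.
set a := t * (1 - F (U t)) in tU1 tU *.
have : 1 < ((1 - m)^-1 + m) * a by exact: lt_trans tl tU.
set i := (1 - m)^-1.
have ii : i * (1 - m) = 1 by rewrite mulVf// lt0r_neq0//; lra.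
have i0 : 0 < i by rewrite invr_gt0; lra.
have a0 : 0 <= a by rewrite mulr_ge0 ?tail_ge0 ?ltW.
have m1 : 0 < 1 - m by lra.
(* Multiplying by [1 - m] gives [1 - m < a + (1 - m) m a <= a + m], so [a > 1 - 2 m >= 1 - e]. *)
rewrite -(ltr_pM2l m1) mulr1 mulrA mulrDr [_ * i]mulrC ii mulrDl mul1r => am.
have : (1 - m) * m * a <= m.
  have : (1 - m) * a <= 1 by rewrite mulr_ile1 ?(ltW m1)//; lra.
  by move=> h; rewrite [(1 - m) * m]mulrC -mulrA ler_piMr// ltW.
by move=> ?; lra.
Unshelve. all: by end_near. Qed.

Lemma cvg_tail_scaled_quantile c : 0 < c ->
  t * (1 - F (c * U t)) @[t --> +oo] --> c `^ (- alpha).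
Proof.
move=> c0.
have h : (1 - F (c * U t)) / (1 - F (U t)) @[t --> +oo] --> c `^ (- alpha).
  exact: cvg_comp tail_quantile_cvgy (tail_ratio c0).
rewrite -[X in _ --> X]mulr1.
apply: cvg_trans (cvgM h cvg_tail_tail_quantile).
apply: near_eq_cvg; near=> t => /=.
have := tail_gt0 (U t) => /lt0r_neq0 ?.
by rewrite mulrCA divfK.
Unshelve. all: by end_near. Qed.

(** By the Galois connection, [c < U (t / z) / U t] means [z < t * (1 - F (c * U t))], whose right
    side tends to [c ^ (- alpha)]. The ratio is thus caught between any [c1] and [c2] around the
    power of [z]. *)
Lemma cvg_quantile_ratio z : 0 < z ->
  U (t / z) / U t @[t --> +oo] --> z `^ (- alpha^-1).
Proof.
move=> z0; apply/cvgrPdist_lt => e e0.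
pose g := z `^ (- alpha^-1).
have g0 : 0 < g by exact: powR_gt0.
(* The maximum keeps [c1] positive, as regular variation requires, while it stays below [g]. *)
pose c1 := Num.max (g - e / 2) (g / 2).
pose c2 := g + e / 2.
have c10 : 0 < c1 by rewrite lt_max orbC divr_gt0.
have c20 : 0 < c2 by rewrite addr_gt0// divr_gt0.
have c1g : c1 < g by rewrite gt_max; apply/andP; split; lra.
have gc2 : g < c2 by rewrite /c2; lra.
have zc1 : z < c1 `^ (- alpha) by rewrite -powR_lt_inv.
have zc2 : c2 `^ (- alpha) < z.
  rewrite ltNge le_eqVlt -powR_lt_inv// -/g; apply/negP => /orP[/eqP zE|]; last lra.
  have : g = c2.
    by rewrite /g zE -powRrM mulrNN divff ?powRr1 ?lt0r_neq0// ltW.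
  by move=> gE; rewrite gE ltxx in gc2.
near=> t.
have t0 : 0 < t by near: t; exact/nbhs_pinfty_gt/num_real.
have tz1 : 1 < t / z.
  by rewrite ltr_pdivlMr// mul1r; near: t; exact/nbhs_pinfty_gt/num_real.
have U0 : 0 < U t by near: t; exact: (cvgry_gt tail_quantile_cvgy).
have cmp c : (c < U (t / z) / U t) = (z < t * (1 - F (c * U t))).
  by rewrite ltr_pdivlMr// lt_tail_quantile// invf_div ltr_pdivrMr// mulrC.
have h1 : c1 < U (t / z) / U t.
  rewrite cmp; near: t; exact: (cvgr_gt _ (cvg_tail_scaled_quantile c10)).
have h2 : U (t / z) / U t <= c2.
  rewrite leNgt cmp -leNgt; apply/ltW; near: t.
  exact: (cvgr_lt _ (cvg_tail_scaled_quantile c20)).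
rewrite -/g ltr_norml; apply/andP; split; first by rewrite /c2 in h2; lra.
have : g - e / 2 <= c1 by rewrite le_max lexx.
lra.
Unshelve. all: by end_near. Qed.

End regularly_varying_tail.

(** * Image measures and quantiles *)

Section density.
Local Open Scope ereal_scope.
Context d (T : measurableType d) (R : realType) (m : {measure set T -> \bar R})
  (f : T -> R).
Hypotheses (mf : measurable_fun setT f) (f0 : forall x, (0 <= f x)%R).

Let nu (A : set T) : \bar R := \int[m]_(x in A) (f x)%:E.

Let nu0 : nu set0 = 0. Proof. exact: integral_set0. Qed.

Let nu_ge0 A : 0 <= nu A.
Proof. by apply: integral_ge0 => x _; rewrite lee_fin. Qed.

Let mfE D : measurable_fun D (fun x => (f x)%:E).
Proof. by apply/measurable_EFinP; exact: measurable_funTS. Qed.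

Let nu_sigma_additive : semi_sigma_additive nu.
Proof.
move=> F mF tF mUF; rewrite /nu; apply: cvg_toP.
  apply: ereal_nondecreasing_is_cvgn => p q pq.
  by apply: lee_sum_nneg_natr => // k _ _; exact: nu_ge0.
rewrite ge0_integral_bigcup//.
by move=> x _; rewrite lee_fin.
Qed.

Let nu_measure : {measure set T -> \bar R} :=
  HB.pack nu (isMeasure.Build _ _ _ nu nu0 nu_ge0 nu_sigma_additive).

Import HBNNSimple.

(** The integral formula is checked on indicators, extended to simple functions and then to all
    nonnegative functions by monotone convergence. Densities serve both for restrictions of the
    Lebesgue measure and for the limit law. *)
Lemma density_measure : exists2 mu : {measure set T -> \bar R},
  (forall A, mu A = \int[m]_(x in A) (f x)%:E) &
  forall g, measurable_fun setT g -> (forall x, 0 <= g x) ->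
    \int[mu]_x g x = \int[m]_x ((f x)%:E * g x).
Proof.
exists nu_measure => // g mg g0.
pose h := nnsfun_approx measurableT mg.
have hg x : (h n x)%:E @[n --> \oo] --> g x by exact: cvg_nnsfun_approx.
transitivity (lim (\int[nu_measure]_x (h n x)%:E @[n --> \oo])).
  rewrite -monotone_convergence//.
  - by apply: eq_integral => x _; apply/esym/cvg_lim.
  - by move=> n; exact/measurable_EFinP.
  - by move=> n x _; rewrite lee_fin.
  - by move=> x _ a b ab; rewrite lee_fin; exact/lefP/nd_nnsfun_approx.
transitivity (lim (\int[m]_x ((f x)%:E * (h n x)%:E) @[n --> \oo])); last first.
  rewrite -monotone_convergence//.
  - by apply: eq_integral => x _; apply/cvg_lim => //; exact: cvgeZl.
  - by move=> n; apply: emeasurable_funM => //; exact/measurable_EFinP.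
  - by move=> n x _; rewrite -EFinM lee_fin mulr_ge0.
  - move=> x _ a b ab; rewrite lee_wpmul2l ?lee_fin//.
    exact/lefP/nd_nnsfun_approx.
congr (lim (_ @ \oo)); apply/funext => n.
transitivity (\int[nu_measure]_x
   (\sum_(y \in range (h n)) (y * \1_(h n @^-1` [set y]) x)%:E)).
  by apply: eq_integral => x _; rewrite fimfunE -fsumEFin.
have indich r : measurable_fun setT (fun x => (r * \1_(h n @^-1` [set r]) x)%:E).
  by apply/measurable_EFinP; exact: measurable_funM.
rewrite ge0_integral_fsum//; last by move=> y x _; exact: nnfun_muleindic_ge0.
transitivity (\int[m]_x
   (\sum_(y \in range (h n)) (f x)%:E * (y * \1_(h n @^-1` [set y]) x)%:E)); last first.
  apply: eq_integral => x _; rewrite [in RHS]fimfunE -fsumEFin// ge0_mule_fsumr//.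
  by move=> y; exact: nnfun_muleindic_ge0.
rewrite ge0_integral_fsum//; last 2 first.
- by move=> y; apply: emeasurable_funM.
- move=> y x _; apply: mule_ge0; first by rewrite lee_fin.
  by rewrite EFinM; exact: nnfun_muleindic_ge0.
apply: eq_fsbigr => y; rewrite inE => -[x0 _ yE].
have y0 : (0 <= y)%R by rewrite -yE.
under eq_integral do rewrite EFinM.
rewrite ge0_integralZl//; last exact/measurable_EFinP.
rewrite integral_indic//= setIT /nu.
under [RHS]eq_integral do rewrite EFinM muleCA.
rewrite [RHS]ge0_integralZl//; last 2 first.
- by apply: emeasurable_funM => //; apply/measurable_EFinP.
- by move=> x _; rewrite -EFinM lee_fin mulr_ge0.
congr (_ * _); rewrite integral_mkcond; apply: eq_integral => x _.
rewrite patchE indicE; case: ifPn => xh; first by rewrite mule1.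
by rewrite mule0.
Qed.
End density.

Section quantile_transform.
Context (R : realType) d (T : measurableType d) (P : probability T R)
  (Y : {RV P >-> R}) (F : R -> R) (alpha : R) (l : R -> R).
Hypothesis Y_ge0 : forall x, 0 <= Y x.
Hypothesis Y_cdf : forall y : R, cdf Y y = (F y)%:E.
Hypothesis F_tail : forall y : R, 0 < y -> 1 - F y = y `^ (- alpha) * l y.
Hypothesis l_slow : slowly_varying l.
Hypothesis alpha_gt0 : 0 < alpha.

Local Notation U := (tail_quantile F).
Let ltU := lt_tail_quantile Y_ge0 Y_cdf.
Let Fle1 := tail_le1 Y_cdf.
Let Fge0 := tail_ge0 Y_cdf.

Lemma tail_quantile_ge0 t : 1 < t -> 0 <= U t.
Proof.
move=> t1; rewrite leNgt; apply/negP => U0.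
have : ~~ (U t < U t) by rewrite ltxx.
rewrite ltU// (tail_lt0 Y_ge0 Y_cdf)// -leNgt.
by rewrite invf_ge1 ?leNgt ?t1// (lt_trans ltr01).
Qed.

Section fixed_time.
Variable t : R.
Hypothesis t_gt0 : 0 < t.

Let div_gt1 z : 0 < z < t -> 1 < t / z.
Proof. by case/andP => z0 zt; rewrite ltr_pdivlMr// mul1r. Qed.

Lemma lt_quantile_div y z : 0 < z < t -> (y < U (t / z)) = (z < t * (1 - F y)).
Proof.
move=> /[dup] /andP[z0 zt] /div_gt1 tz; rewrite ltU// invf_div.
by rewrite ltr_pdivrMr// mulrC.
Qed.

Let phi z := if 0 < z < t then U (t / z) else 0.

Let phi_gt y : 0 <= y -> phi @^-1` `]y, +oo[ = `]0, t * (1 - F y)[%classic.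
Proof.
move=> y0; apply/seteqP; split => z /=; rewrite !in_itv/= andbT /phi.
  case: ifPn => [zt|_]; last by rewrite ltNge y0.
  by rewrite lt_quantile_div// => ->; case/andP: zt => ->.
move=> /andP[z0 ztF].
have zt : 0 < z < t.
  by rewrite z0/= (lt_le_trans ztF)// ler_piMr ?Fle1// ltW.
by rewrite zt lt_quantile_div.
Qed.

Let phi_gt_neg y : y < 0 -> phi @^-1` `]y, +oo[ = setT.
Proof.
move=> y0; apply/seteqP; split => // z _ /=; rewrite in_itv/= andbT /phi.
by case: ifP => // zt; apply: (lt_le_trans y0); rewrite tail_quantile_ge0// div_gt1.
Qed.

Let measurable_phi : measurable_fun setT phi.
Proof.
apply: (measurability _ (RGenOInfty.measurableE R)) => _ [_ [y ->] <-].
rewrite setTI; have [y0|y0] := leP 0 y; first by rewrite phi_gt.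
by rewrite phi_gt_neg.
Qed.

Lemma measurable_quantile_div (D : set R) : measurable D -> D `<=` `]0, t[ ->
  measurable_fun D (fun z => U (t / z)).
Proof.
move=> mD Dt; apply: (eq_measurable_fun phi).
  by move=> z; rewrite inE => /Dt /=; rewrite in_itv/= /phi => ->.
exact: measurable_funTS.
Qed.

(** The two measures agree on rays: for [y >= 0], [U (t / z) > y] with [0 < z < t] cuts out exactly
    the interval from 0 to [t * (1 - F y)], and for [y < 0] both sides have mass [t]. *)
Lemma integral_quantile_div (g : R -> \bar R) :
  measurable_fun setT g -> (forall y, 0 <= g y)%E ->
  (\int[lebesgue_measure]_(z in `]0%R, t[) g (U (t / z)) =
   t%:E * \int[P]_x g (Y x))%E.
Proof.
move=> mg g0.
have m1 : measurable_fun setT (\1_(`]0, t[%classic : set R) : R -> R) by [].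
have p1 z : 0 <= (\1_(`]0, t[%classic : set R) : R -> R) z by [].
have [mu muE mu_int] := density_measure lebesgue_measure m1 p1.
have mphi : measurable_fun (setT : set (measurableTypeR R)) phi := measurable_phi.
transitivity (\int[mu]_z g (phi z))%E.
  rewrite mu_int//; last by exact: measurableT_comp.
  rewrite [LHS]integral_mkcond; apply: eq_integral => z _.
  rewrite patchE indicE; case: ifPn => zt; rewrite ?mul1e ?mul0e//.
  by move: zt; rewrite inE/= in_itv/= /phi => ->.
transitivity (\int[pushforward mu phi]_y g y)%E.
  by rewrite (ge0_integral_pushforward mphi).
pose t' := NngNum (ltW t_gt0).
rewrite -(ge0_integral_distribution Y)//.
rewrite -(ge0_integral_mscale _ _ t')//.
apply: eq_measure_integral => A mA _.
have lebE (A' : set R) : measurable A' ->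
    mu A' = lebesgue_measure (`]0, t[%classic `&` A').
  by move=> mA'; rewrite muE integral_indic.
have m2E y : mscale t' (distribution P Y) `]y, +oo[%classic = (t * (1 - F y))%:E.
  by rewrite EFinM -(claim_gtE Y_cdf).
have m1E y : pushforward mu phi `]y, +oo[%classic = (t * (1 - F y))%:E.
  rewrite /pushforward; have [y0|y0] := leP 0 y.
    rewrite phi_gt// lebE// setIidr; last first.
      by apply: subset_itvl; rewrite bnd_simp ler_piMr ?Fle1// ltW.
    rewrite lebesgue_measure_itv/= lte_fin; case: ltP => tF.
      by rewrite -EFinB subr0.
    by congr _%:E; apply/le_anti; rewrite tF mulr_ge0 ?Fge0// ltW.
  rewrite phi_gt_neg// lebE// setIT lebesgue_measure_itv/= lte_fin t_gt0.
  by rewrite (tail_lt0 Y_ge0 Y_cdf)// mulr1 -EFinB subr0.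
apply: rays_measure_unique => // y.
  by rewrite [LHS]m1E [RHS]m2E.
by rewrite [X in (X < _)%E]m1E ltry.
Qed.

End fixed_time.
Lemma claim_ge_le y z : z < y -> (P (Y @^-1` `[y, +oo[) <= (1 - F z)%:E)%E.
Proof.
move=> zy; rewrite -(claim_gtE Y_cdf); apply: le_measure.
- by rewrite inE; exact: measurable_funPTI.
- by rewrite inE; exact: measurable_funPTI.
- move=> x /=; rewrite !in_itv/= !andbT; exact: lt_le_trans.
Qed.

Lemma tail_quantile_mono t t' : 1 < t -> t <= t' -> U t <= U t'.
Proof.
move=> t1 tt'; rewrite leNgt; apply/negP; rewrite ltU// => h.
have : ~~ (U t' < U t') by rewrite ltxx.
rewrite ltU ?(lt_le_trans t1 tt')//; apply/negP; rewrite negbK.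
by apply: le_lt_trans h; rewrite lef_pV2// posrE (lt_trans ltr01)// (lt_le_trans t1).
Qed.

(** Source of the dominating function, hence uniform over all [t > 1]. The lower bound yields
    exponential decay. The upper one concerns the closed ray, which includes a possible atom at
    [U t]; it is compared with the tail at [U t / 2]. Below a large [T0] monotonicity and trivial
    bounds suffice. *)
Lemma quantile_tail_bounds : exists2 c0 : R, 0 < c0 & exists2 C0 : R, 0 < C0 &
  forall t, 1 < t ->
    c0 <= t * (1 - F (U t)) /\ (t%:E * P (Y @^-1` `[U t, +oo[) <= C0%:E)%E.
Proof.
have tq := tail_quantile_cvgy Y_ge0 Y_cdf F_tail l_slow.
have t1 := cvg_tail_tail_quantile Y_ge0 Y_cdf F_tail l_slow alpha_gt0.
have h2 : 0 < 2^-1 :> R by [].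
have t2 := cvg_tail_scaled_quantile Y_ge0 Y_cdf F_tail l_slow alpha_gt0 h2.
set K := 2^-1 `^ (- alpha) in t2.
have [T0 [T01 T0P]] : exists T0, 1 < T0 /\ forall t, T0 <= t ->
    [/\ 2^-1 <= t * (1 - F (U t)), t * (1 - F (2^-1 * U t)) <= K + 1 & 0 < U t].
  have : \forall t \near +oo, [/\ 2^-1 <= t * (1 - F (U t)),
      t * (1 - F (2^-1 * U t)) <= K + 1 & 0 < U t].
    near=> t; split; near: t.
    - by apply: (cvgr_ge _ t1); rewrite invf_lt1// ltr1n.
    - by apply: (cvgr_le _ t2); rewrite ltrDl.
    - exact: (cvgry_gt tq).
  move=> [M [_ MP]]; exists (Num.max M 1 + 1); split.
    by rewrite ltrDr lt_max ltr01 orbT.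
  move=> t Mt; apply: MP; apply: lt_le_trans Mt.
  by rewrite ltr_pwDr// le_max lexx.
exists (Num.min 2^-1 (1 - F (U T0))).
  by rewrite lt_min h2 (tail_gt0 Y_cdf F_tail l_slow).
exists (Num.max (K + 1) T0); first by rewrite lt_max (lt_trans ltr01 T01) orbT.
move=> t t_1; have t0 : 0 < t by exact: lt_trans ltr01 t_1.
have [/T0P[h1 h3 U0]|tT] := leP T0 t; split.
- by rewrite ge_min h1.
- apply: (@le_trans _ _ (t%:E * (1 - F (2^-1 * U t))%:E)%E).
    by rewrite lee_pmul2l// claim_ge_le// gtr_pMl// invf_lt1// ltr1n.
  by rewrite -EFinM lee_fin le_max h3.
- rewrite ge_min; apply/orP; right.
  apply: (@le_trans _ _ (1 - F (U t))).
    by apply: (tail_anti Y_cdf); apply: tail_quantile_mono => //; exact: ltW.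
  by rewrite ler_peMl ?Fge0// ltW.
- apply: (@le_trans _ _ (t%:E * 1)%E).
    by rewrite lee_pmul2l// probability_le1//; exact: measurable_funPTI.
  by rewrite mule1 lee_fin le_max (ltW tT) orbT.
Unshelve. all: by end_near. Qed.

(** Doubling the argument multiplies [x * (1 - F x)] by about [r = 2 ^ (1 - alpha)], which is below
    1. The rate [rho] is midway between [r] and 1, so [rho / 2] exceeds the limit of the tail
    ratio. *)
Lemma tail_geometric : 1 < alpha -> exists2 x0 : R, 0 < x0 &
  exists2 rho : R, 0 <= rho < 1 & forall k, 2 ^+ k * (1 - F (2 ^+ k * x0)) <= rho ^+ k.
Proof.
move=> a1; pose r : R := 2 `^ (1 - alpha).
have r1 : r < 1.
  rewrite /r /powR pnatr_eq0/= expR_lt1 pmulr_llt0 ?ln_gt0 ?ltr1n//; lra.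
have r0 : 0 < r by exact: powR_gt0.
pose rho := (r + 1) / 2.
have h := tail_ratio F_tail l_slow (ltr0n R 2 : 0 < 2).
have [x0 [x00 x0P]] : exists x0, 0 < x0 /\ forall x, x0 <= x ->
    (1 - F (2 * x)) / (1 - F x) <= rho / 2.
  have : \forall x \near +oo, (1 - F (2 * x)) / (1 - F x) <= rho / 2.
    apply: (cvgr_le _ h).
    rewrite ltr_pdivlMr// -{2}(powRr1 (ler0n R 2)) -powRD; last by rewrite pnatr_eq0 implybT.
    by rewrite addrC -/r /rho; lra.
  move=> [M [_ MP]]; exists (Num.max M 0 + 1); split.
    by rewrite ltr_wpDl// le_max lexx orbT.
  move=> x Mx; apply: MP; apply: lt_le_trans Mx.
  by rewrite ltr_pwDr// le_max lexx.
exists x0 => //; exists rho; first by rewrite /rho; lra.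
elim=> [|k IH]; first by rewrite !expr0 !mul1r Fle1.
have := x0P (2 ^+ k * x0).
rewrite ler_peMl ?(ltW x00) ?exprn_ege1 ?ler1n// => /(_ isT).
rewrite ler_pdivrMr ?(tail_gt0 Y_cdf F_tail l_slow)// mulrA -exprS => h1.
rewrite exprS [rho ^+ _]exprS -mulrA.
apply: (@le_trans _ _ (2 * (2 ^+ k * (rho / 2 * (1 - F (2 ^+ k * x0)))))).
  by rewrite ler_pM2l// ler_pM2l ?exprn_gt0// -exprS.
rewrite (_ : 2 * _ = rho * (2 ^+ k * (1 - F (2 ^+ k * x0)))); last by lra.
by rewrite ler_pM2l// /rho; lra.
Qed.

(** Dyadic bound: since [2 ^ m * x0] is [x0] plus the sum of the lower levels [2 ^ k * x0], [Y] is
    at most [x0] plus the sum of the levels that it exceeds. The expectations of the summands are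
    dominated by a geometric series. *)
Lemma claim_mean_lty : 1 < alpha -> (\int[P]_x (Y x)%:E < +oo)%E.
Proof.
move=> a1; have [x0 x00 [rho /andP[rho0 rho1] tg]] := tail_geometric a1.
pose u k x : R := 2 ^+ k * x0 * (2 ^+ k * x0 < Y x)%R%:R.
have u0 k x : 0 <= u k x by rewrite !mulr_ge0// ltW.
have mu k : measurable_fun setT (u k).
  apply: measurable_funM => //; apply: measurable_natr_bool.
  exact: measurable_fun_ltr.
have Yu m x : Y x <= 2 ^+ m * x0 -> Y x <= x0 + \sum_(k < m) u k x.
  elim: m => [|m IH]; first by rewrite expr0 mul1r big_ord0 addr0.
  have [/IH Ym _|mY YSm] := leP (Y x) (2 ^+ m * x0).
    by rewrite big_ord_recr/= addrA ler_wpDr.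
  apply: (le_trans YSm); rewrite le_eqVlt; apply/orP; left; apply/eqP.
  transitivity (x0 + \sum_(k < m.+1) 2 ^+ k * x0).
    rewrite -mulr_suml; have := subrX1 (2 : R) m.+1.
    rewrite (_ : 2 - 1 = 1 :> R) ?mul1r; last by lra.
    by move=> <-; lra.
  congr (_ + _); apply: eq_bigr => k _; rewrite /u.
  suff -> : 2 ^+ k * x0 < Y x by rewrite mulr1.
  apply: le_lt_trans mY; rewrite ler_pM2r// ler_weXn2l ?ler1n//.
  by rewrite -ltnS ltn_ord.
apply: (@le_lt_trans _ _ (\int[P]_x (x0%:E + \sum_(k <oo) (u k x)%:E))%E).
  apply: ge0_le_integral => //.
  - by move=> x _; rewrite lee_fin.
  - exact/measurable_EFinP.
  - apply: emeasurable_funD => //; apply: ge0_emeasurable_sum.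
      by move=> k x _ _; rewrite lee_fin.
    by move=> k _; exact/measurable_EFinP.
  - move=> x _; have [m Ym] : exists m, Y x <= 2 ^+ m * x0.
      exists (Num.bound (Y x / x0)).
      rewrite -ler_pdivrMr//; apply: ltW.
      apply: (lt_le_trans (archi_boundP (divr_ge0 (Y_ge0 x) (ltW x00)))).
      by rewrite -natrX ler_nat ltnW// ltn_expl.
    apply: (@le_trans _ _ (x0%:E + \sum_(k < m) (u k x)%:E)%E).
      by rewrite sumEFin -EFinD lee_fin Yu.
    rewrite leeD2l//; rewrite -(big_mkord xpredT (fun k => (u k x)%:E)).
    by apply: nneseries_lim_ge => k _ _; rewrite lee_fin.
rewrite ge0_integralD//; last 3 first.
- by move=> x _; rewrite lee_fin ltW.
- by move=> x _; apply: nneseries_ge0 => k _ _; rewrite lee_fin.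
- apply: ge0_emeasurable_sum => [k x _ _|k _]; first by rewrite lee_fin.
  exact/measurable_EFinP.
have -> : (\int[P]_x x0%:E = x0%:E)%E.
  by rewrite (integral_cst P measurableT x0%:E) [X in (_ * X)%E]probability_setT mule1.
rewrite integral_nneseries//; last 2 first.
- by move=> k; exact/measurable_EFinP.
- by move=> k x _; rewrite lee_fin.
apply: (@le_lt_trans _ _ (x0%:E + (x0 / (1 - rho))%:E)%E); last by rewrite -EFinD ltry.
rewrite leeD2l//; apply: lime_le.
  by apply: is_cvg_nneseries => k _ _; apply: integral_ge0 => x _; rewrite lee_fin.
apply: nearW => m.
apply: (@le_trans _ _ (\sum_(0 <= k < m) (x0 * rho ^+ k)%:E)%E).
  apply: lee_sum => k _.
  have -> : (\int[P]_x (u k x)%:E = (2 ^+ k * x0 * (1 - F (2 ^+ k * x0)))%:E)%E.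
    rewrite EFinM -(claim_gtE Y_cdf).
    under eq_integral do rewrite EFinM.
    rewrite ge0_integralZl//; last 2 first.
    - by apply/measurable_EFinP; apply: measurable_natr_bool; exact: measurable_fun_ltr.
    - by rewrite lee_fin mulr_ge0// ltW.
    congr (_ * _)%E; rewrite -[in RHS](setIT (Y @^-1` _)) -integral_indic//; last exact: measurable_funPTI.
    apply: eq_integral => x _; rewrite indicE; congr ((_ : bool)%:R)%:E.
    by apply/idP/idP; rewrite inE/= in_itv/= andbT.
  by rewrite lee_fin mulrAC mulrC ler_pM2l.
rewrite sumEFin lee_fin -mulr_sumr ler_pM2l// -[leRHS]mul1r ler_pdivlMr; last by lra.
rewrite big_mkord mulrC -opprB mulNr -subrX1 opprB.
by rewrite gerBl exprn_ge0.
Qed.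

End quantile_transform.

(** * The limit law *)

Lemma ge0_integral_derive_itvcy (R : realType) (f G : R -> R) (a l : R) :
  (forall x, a <= x -> 0 <= f x) -> {in `[a, +oo[, continuous f} ->
  (forall x, a <= x -> is_derive x 1 G (f x)) -> G x @[x --> +oo] --> l ->
  (\int[lebesgue_measure]_(x in `[a, +oo[) (f x)%:E = (l - G a)%:E)%E.
Proof.
move=> f0 cf dG Gl; rewrite EFinB; apply: ge0_continuous_FTC2y => //.
- by apply: continuous_in_subspaceT => x xa; apply: cf; rewrite inE in xa.
- by move=> x /ltW /dG[].
- apply: cvg_at_right_filter; apply: differentiable_continuous.
  by apply/derivable1_diffP; case: (dG a (lexx _)).
- by move=> x; rewrite in_itv/= andbT derive1E => /ltW /dG[_ ->].
Qed.

Section gamma_integral.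
Context (R : realType) (theta : R).
Hypothesis theta_gt0 : 0 < theta.

(** Antiderivative of the density of the Gamma law of shape [n + 1] and rate [theta]: minus the
    probability that a Poisson variable of mean [theta * x] is at most [n]. Its derivative
    telescopes. *)
Let G (n : nat) (x : R) : R :=
  - (expR (- (theta * x)) * \sum_(k < n.+1) (theta * x) ^+ k / k`!%:R).

Let is_derive_expN (x : R) :
  is_derive x 1 (fun x => expR (- (theta * x))) (- theta * expR (- (theta * x))).
Proof.
have : is_derive x 1 (expR \o (fun x => - (theta * x)))
    (expR (- (theta * x)) * (- theta)).
  apply: is_derive1_comp.
  rewrite [X in is_derive _ _ _ X](_ : _ = - (theta *: 1)); last by rewrite /GRing.scale/= mulr1.
  exact: is_deriveN.
by rewrite mulrC.
Qed.

Let is_derive_pow (n : nat) (x : R) :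
  is_derive x 1 (fun x => (theta * x) ^+ n.+1 / n.+1`!%:R)
    (theta * ((theta * x) ^+ n / n`!%:R)).
Proof.
rewrite (_ : (fun x => _) = (theta ^+ n.+1 / n.+1`!%:R) \*: ((@id R) ^+ n.+1)); last first.
  by apply/funext => y; rewrite /= /GRing.scale/= exprMn mulrAC exprfctE.
apply: (is_derive_eq (is_deriveZ _ (is_deriveX n.+1 (is_derive_id x (1 : R))))).
rewrite /GRing.scale/= mulr1 factS natrM invfM exprMn exprS.
have n0 : n.+1%:R != 0 :> R by rewrite pnatr_eq0.
have f0 : n`!%:R != 0 :> R by rewrite pnatr_eq0 -lt0n fact_gt0.
move: (n.+1%:R : R) (n`!%:R : R) n0 f0 => p q p0 q0.
by field; rewrite p0 q0.
Qed.

Let is_derive_G (n : nat) (x : R) : is_derive x 1 (G n)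
  (theta * expR (- (theta * x)) * (theta * x) ^+ n / n`!%:R).
Proof.
elim: n => [|n IH].
  rewrite (_ : G 0 = - (fun x => expR (- (theta * x)))); last first.
    by apply/funext => y; rewrite /G big_ord1 expr0 fact0 divr1 mulr1.
  apply: (is_derive_eq (is_deriveN (is_derive_expN x))).
  by rewrite expr0 fact0 divr1 mulr1 mulNr opprK.
rewrite (_ : G n.+1 = G n - (fun x => expR (- (theta * x))) *
    (fun x => (theta * x) ^+ n.+1 / n.+1`!%:R)); last first.
  by apply/funext => y; rewrite /G big_ord_recr/= mulrDr opprD.
apply: (is_derive_eq (is_deriveB IH (is_deriveM (is_derive_expN x) (is_derive_pow n x)))).
rewrite /GRing.scale/=; set e := expR _.
move: ((theta * x) ^+ n.+1) (n.+1`!%:R^-1 : R) ((theta * x) ^+ n) (n`!%:R^-1 : R).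
by move=> p1 q1 p q; ring.
Qed.

Let cvg_expN_pow k : expR (- y) * (y ^+ k / k`!%:R) @[y --> +oo] --> (0 : R).
Proof.
(* From the bound of [expR y] below by [y ^ (k + 1) / (k + 1)!]. *)
apply: (@squeeze_cvgr _ _ _ _ (fun=> 0) (fun y => k.+1%:R * y^-1)).
- near=> y; have y0 : 0 < y by near: y; exact/nbhs_pinfty_gt/num_real.
  have f0 m : 0 < m`!%:R :> R by rewrite ltr0n fact_gt0.
  rewrite mulr_ge0 ?expR_ge0 ?divr_ge0 ?exprn_ge0 ?(ltW y0) ?(ltW (f0 _))//=.
  rewrite expRN mulrC ler_pdivrMr ?expR_gt0//.
  apply: (@le_trans _ _ (k.+1%:R * y^-1 * (y ^+ k.+1 / k.+1`!%:R))).
    rewrite factS natrM exprS le_eqVlt; apply/orP; left; apply/eqP.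
    have n0 : k.+1%:R != 0 :> R by rewrite pnatr_eq0.
    move: (k.+1%:R : R) (k`!%:R : R) n0 (lt0r_neq0 (f0 k)) (lt0r_neq0 y0) => p q p0 q0 yn0.
    by field; rewrite p0 q0 yn0.
  rewrite ler_pM2l ?mulr_gt0 ?invr_gt0//.
  by apply: le_trans (expR_ge1Dxn k (ltW y0)); rewrite lerDr.
- exact: cvg_cst.
- rewrite -[X in _ --> X](mulr0 (k.+1%:R)); apply: cvgM; first exact: cvg_cst.
  have /gtr0_cvgV0[_ h] : \forall y \near +oo, 0 < (@id R) y.
    exact/nbhs_pinfty_gt/num_real.
  exact/h/cvg_id.
Unshelve. all: by end_near. Qed.

Let cvg_G n : G n x @[x --> +oo] --> (0 : R).
Proof.
have th : theta * x @[x --> +oo] --> +oo by exact: gt0_cvgMry.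
have ep k : expR (- (theta * x)) * ((theta * x) ^+ k / k`!%:R) @[x --> +oo] --> (0 : R).
  exact: (cvg_comp _ _ th (cvg_expN_pow k)).
rewrite -[X in _ --> X]oppr0; apply: cvgN.
elim: n => [|n IH].
  have := ep 0%N; apply: cvg_trans; apply: near_eq_cvg.
  by apply: nearW => x; rewrite /= big_ord1.
rewrite (_ : (fun x => _) = (fun x => expR (- (theta * x)) *
    (\sum_(k < n.+1) (theta * x) ^+ k / k`!%:R) +
    expR (- (theta * x)) * ((theta * x) ^+ n.+1 / n.+1`!%:R))); last first.
  by apply/funext => x; rewrite big_ord_recr mulrDr.
rewrite -[X in _ --> X]addr0; apply: cvgD; [exact: IH|exact: ep].
Qed.

Let continuous_gamma n :
  continuous (fun x => theta * expR (- (theta * x)) * (theta * x) ^+ n / n`!%:R).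
Proof.
move=> x; have cth : {for x, continuous (fun x => theta * x)}.
  exact: mulrl_continuous.
apply: cvgM; last exact: cvg_cst.
apply: cvgM.
  apply: cvgM; first exact: cvg_cst.
  apply: continuous_comp; last exact: continuous_expR.
  exact: cvgN.
have : {for x, continuous ((fun y : R => y ^+ n) \o (fun x => theta * x))}.
  by apply: continuous_comp; [exact: cth|exact: exprn_continuous].
exact.
Qed.

Lemma integral_gamma (n : nat) :
  (\int[lebesgue_measure]_(x in `]0%R, +oo[)
    (theta * expR (- (theta * x)) * (theta * x) ^+ n / n`!%:R)%:E = 1)%E.
Proof.
rewrite integral_itv_obnd_cbnd; last first.
  apply/measurable_EFinP/measurable_funTS.
  by apply: continuous_measurable_fun; exact: continuous_gamma.
transitivity (0 - G n 0)%:E; last first.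
  rewrite /G mulr0 oppr0 expR0 mul1r big_ord_recl/= expr0 fact0 divr1.
  rewrite big1 ?addr0 ?sub0r ?opprK// => i _.
  by rewrite expr0n/= mul0r.
apply: ge0_integral_derive_itvcy.
- move=> x x0; rewrite !mulr_ge0 ?expR_ge0 ?exprn_ge0 ?invr_ge0 ?(ltW theta_gt0)//.
  by rewrite mulr_ge0// ltW.
- by move=> x _; exact: continuous_gamma.
- by move=> x _; exact: is_derive_G.
- exact: cvg_G.
Qed.

End gamma_integral.

(** Normalizing a measure of mass 1 changes nothing but equips it with the structure of a
    [probability]. *)
Lemma measure_probability d (T : measurableType d) (R : realType)
    (mu : {measure set T -> \bar R}) : mu setT = 1%E ->
  exists P : probability T R, forall f : T -> \bar R,
    (\int[P]_x f x = \int[mu]_x f x)%E.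
Proof.
move=> mu1; exists (mnormalize mu (dirac point)) => f.
apply: eq_measure_integral => A mA _; rewrite -[LHS]/(mnormalize mu (dirac point) A).
by rewrite /mnormalize mu1 onee_eq0/= invr1 mule1.
Qed.

Section pareto_law.
Context (R : realType) (alpha : R).
Hypothesis alpha_gt0 : 0 < alpha.

Let pdf (x : R) : R := if 1 <= x then alpha * x `^ (- (1 + alpha)) else 0.

Let pdf_ge0 x : 0 <= pdf x.
Proof. by rewrite /pdf; case: ifP => // _; rewrite mulr_ge0 ?powR_ge0 ?ltW. Qed.

Let measurable_pdf : measurable_fun setT pdf.
Proof.
apply: measurable_fun_ifT => //; first exact: measurable_fun_ler.
by apply: measurable_funM => //; exact: measurable_powR.
Qed.

Let integral_pdf_itv y : 1 <= y ->
  (\int[lebesgue_measure]_(x in `]y, +oo[) (pdf x)%:E = (y `^ (- alpha))%:E)%E.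
Proof.
move=> y1; have y0 : 0 < y by exact: lt_le_trans ltr01 y1.
rewrite integral_itv_obnd_cbnd; last exact/measurable_EFinP/measurable_funTS.
transitivity (\int[lebesgue_measure]_(x in `[y, +oo[) (alpha * x `^ (- (1 + alpha)))%:E)%E.
  apply: eq_integral => x; rewrite inE/= in_itv/= andbT => yx.
  by rewrite /pdf (le_trans y1 yx).
have dG (x : R) : y <= x -> is_derive x 1 (fun x => - (x `^ (- alpha)))
    (alpha * x `^ (- (1 + alpha))).
  move=> yx; have x0 : 0 < x by exact: lt_le_trans y0 yx.
  apply: (is_derive_eq (is_deriveN (is_derive1_powR (- alpha) x0))).
  by rewrite mulNr opprK opprD addrC.
transitivity (0 - (- (y `^ (- alpha))))%:E; last by rewrite sub0r opprK.
apply: (@ge0_integral_derive_itvcy R _ (fun x => - (x `^ (- alpha)))) => //.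
- by move=> x yx; rewrite mulr_ge0 ?powR_ge0 ?ltW.
- move=> x; rewrite in_itv/= andbT => yx.
  have x0 : 0 < x by exact: lt_le_trans y0 yx.
  apply: differentiable_continuous; apply/derivable1_diffP.
  apply: derivableM => //.
  by have [] := is_derive1_powR (- (1 + alpha)) x0.
- rewrite -[X in _ --> X]oppr0; apply: cvgN.
  have aN0 : alpha != 0 by rewrite lt0r_neq0.
  apply/cvgrPdist_lt => e e0; near=> x.
  have x0 : 0 < x by near: x; exact/nbhs_pinfty_gt/num_real.
  rewrite sub0r normrN ger0_norm ?powR_ge0//.
  rewrite ltNge le_eqVlt; apply/negP => /orP[/eqP eE|].
    have xE : x = e `^ (- alpha^-1) by rewrite eE -powRrM mulrNN divff ?powRr1 ?ltW.
    have : e `^ (- alpha^-1) < x by near: x; exact/nbhs_pinfty_gt/num_real.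
    by rewrite -xE ltxx.
  rewrite -powR_lt_inv//; apply/negP; rewrite -leNgt; apply/ltW.
  by near: x; exact/nbhs_pinfty_gt/num_real.
Unshelve. all: by end_near. Qed.

Lemma integral_pdfE (g : R -> \bar R) :
  (\int[lebesgue_measure]_x ((pdf x)%:E * g x) =
   \int[lebesgue_measure]_(x in `[1%R, +oo[) ((alpha * x `^ (- (1 + alpha)))%:E * g x))%E.
Proof.
rewrite [RHS]integral_mkcond; apply: eq_integral => x _.
rewrite patchE mem_setE in_itv/= andbT /pdf.
by case: ifP => // _; rewrite mul0e.
Qed.

(** The second property says that if [x] is uniform on the interval from 0 to [z], then [x / z]
    raised to [- alpha^-1] is Pareto. It links the Pareto integral in [pareto_factor] to the
    Lebesgue integral that the quantile change of variable produces. *)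
Lemma pareto_law : exists rho : probability (measurableTypeR R) R,
  (forall g : R -> \bar R, measurable_fun setT g -> (forall x, 0 <= g x)%E ->
    \int[rho]_x g x =
    \int[lebesgue_measure]_(x in `[1%R, +oo[) ((alpha * x `^ (- (1 + alpha)))%:E * g x))%E /\
  (forall (z : R) (g : R -> \bar R), (0 < z)%R -> measurable_fun setT g -> (forall x, 0 <= g x)%E ->
    \int[lebesgue_measure]_(x in `]0%R, z[) g ((x / z) `^ (- alpha^-1))%R =
    z%:E * \int[rho]_x g x)%E.
Proof.
have [mu muE mu_int] := density_measure lebesgue_measure measurable_pdf pdf_ge0.
have mu_ray y : mu `]y, +oo[%classic = (if 1 <= y then y `^ (- alpha) else 1)%:E.
  rewrite muE; case: ifPn => [/integral_pdf_itv//|]; rewrite -ltNge => y1.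
  transitivity (\int[lebesgue_measure]_(x in `[1%R, +oo[) (pdf x)%:E)%E; last first.
    rewrite -integral_itv_obnd_cbnd; last exact/measurable_EFinP/measurable_funTS.
    by rewrite integral_pdf_itv// powR1.
  rewrite [LHS]integral_mkcond [RHS]integral_mkcond; apply: eq_integral => x _.
  rewrite !patchE !mem_setE !in_itv/= !andbT /pdf.
  case: ifPn => yx; case: ifPn => // x1.
  by rewrite (lt_le_trans y1 x1) in yx.
have muT : mu setT = 1%E.
  transitivity (mu `]0, +oo[%classic); last by rewrite mu_ray leNgt ltr01.
  rewrite !muE [RHS]integral_mkcond; apply: eq_integral => x _.
  rewrite patchE mem_setE in_itv/= andbT /pdf.
  case: ifPn => // x0; case: ifPn => // x1.
  by rewrite (lt_le_trans ltr01 x0) in x1.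
have [rho rhoE] := measure_probability muT.
exists rho; split => [g mg g0|z g z0 mg g0]; first by rewrite rhoE mu_int// integral_pdfE.
rewrite rhoE.
pose phi (x : R) : R := if 0 < x < z then (x / z) `^ (- alpha^-1) else 0.
have mphi : measurable_fun (setT : set (measurableTypeR R)) phi.
  apply: measurable_fun_ifT => //.
    by apply: measurable_and; exact: measurable_fun_ltr.
  by apply: (measurableT_comp (measurable_powR _)); exact: measurable_funM.
have m1 : measurable_fun setT (\1_(`]0, z[%classic : set R) : R -> R) by [].
have p1 x : 0 <= (\1_(`]0, z[%classic : set R) : R -> R) x by [].
have [nu nuE nu_int] := density_measure lebesgue_measure m1 p1.
transitivity (\int[nu]_x g (phi x))%E.
  rewrite nu_int//; last by exact: measurableT_comp.
  rewrite [LHS]integral_mkcond; apply: eq_integral => x _.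
  rewrite patchE indicE; case: ifPn => xz; rewrite ?mul1e ?mul0e//.
  by move: xz; rewrite inE/= in_itv/= /phi => ->.
transitivity (\int[pushforward nu phi]_y g y)%E.
  by rewrite (ge0_integral_pushforward mphi).
pose z' := NngNum (ltW z0).
have mid : measurable_fun (setT : set (measurableTypeR R)) (@id R) by [].
transitivity (z%:E * \int[pushforward mu (@id R)]_x g x)%E; last first.
  by rewrite (ge0_integral_pushforward mid).
rewrite -(ge0_integral_mscale _ _ z')//.
apply: eq_measure_integral => A mA _.
have phi_pos x : 0 < x < z -> 1 < phi x.
  move=> /[dup] xz /andP[x0 xz']; rewrite /phi xz powR_lt_inv ?divr_gt0//.
  by rewrite powR1 ltr_pdivrMr// mul1r.
have nuA (B : set R) : measurable B -> nu B = lebesgue_measure (`]0, z[%classic `&` B).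
  by move=> mB; rewrite nuE integral_indic.
have m2E y : mscale z' (pushforward mu (@id R)) `]y, +oo[%classic =
    (z * (if 1 <= y then y `^ (- alpha) else 1))%:E.
  by rewrite EFinM -mu_ray.
have m1E y : pushforward nu phi `]y, +oo[%classic =
    (z * (if 1 <= y then y `^ (- alpha) else 1))%:E.
  rewrite /pushforward nuA; last first.
    by rewrite -[_ @^-1` _]setTI; apply: mphi => //; exact: measurable_itv.
  case: ifPn => [y1|]; last first.
    rewrite -ltNge => y1; rewrite setIidl.
      by rewrite lebesgue_measure_itv/= lte_fin z0 mulr1 -EFinB subr0.
    move=> x; rewrite /= !in_itv/= andbT => /phi_pos; exact: lt_trans.
  have y0 : 0 < y by exact: lt_le_trans ltr01 y1.
  have py0 : 0 < y `^ (- alpha) by exact: powR_gt0.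
  rewrite [X in lebesgue_measure X](_ : _ = `]0, z * y `^ (- alpha)[%classic).
    by rewrite lebesgue_measure_itv/= lte_fin mulr_gt0// -EFinB subr0.
  have ya1 : y `^ (- alpha) <= 1.
    rewrite powRN invf_le1 ?powR_gt0//.
    have : 1 `^ alpha <= y `^ alpha.
      by apply: ge0_ler_powR; rewrite ?nnegrE ?(ltW alpha_gt0) ?(ltW y0).
    by rewrite powR1.
  apply/seteqP; split => x; rewrite /= !in_itv/= andbT /phi.
    move=> [/[dup] xz /andP[x0 xz']]; rewrite xz powR_lt_inv ?divr_gt0//.
    by rewrite ltr_pdivrMr// mulrC x0 => ->.
  move=> /andP[x0 xzy]; have xz : 0 < x < z.
    by rewrite x0/= (lt_le_trans xzy)// ler_piMr// ltW.
  by split=> //; rewrite xz powR_lt_inv ?divr_gt0// ltr_pdivrMr// mulrC.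
apply: rays_measure_unique => // y.
  by rewrite [LHS]m1E [RHS]m2E.
by rewrite [X in (X < _)%E]m1E ltry.
Qed.

End pareto_law.

Lemma product_probability d1 d2 (T1 : measurableType d1) (T2 : measurableType d2)
    (R : realType) (P1 : probability T1 R) (P2 : probability T2 R) :
  exists P : probability (T1 * T2)%type R, forall f : T1 * T2 -> \bar R,
    measurable_fun setT f -> (forall z, (0 <= f z)%E) ->
    (\int[P]_z f z = \int[P1]_x \int[P2]_y f (x, y))%E.
Proof.
have P12 : (P1 \x P2)%E setT = 1%E.
  rewrite -setXTT product_measure1E//.
  by transitivity (1 * 1 : \bar R)%E; [congr (_ * _)%E; exact: probability_setT|rewrite mule1].
have [P PE] := measure_probability P12.
by exists P => f mf f0; rewrite PE fubini_tonelli1.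
Qed.

Lemma iid_nonneg_sum (R : realType) d0 (T0 : measurableType d0)
    (rho : probability T0 R) (h : T0 -> R) (s : nat) :
  measurable_fun setT h -> (forall x, 0 <= h x) ->
  exists d (T : measurableType d) (P : probability T R) (S : T -> R),
    [/\ measurable_fun setT S, forall x, 0 <= S x &
        forall r : R, (\int[P]_x (expR (r * S x))%:E =
           (\int[rho]_x (expR (r * h x))%:E) ^+ s)%E].
Proof.
move=> mh h0; elim: s => [|s [d [T [P [S [mS S0 SE]]]]]].
  (* The empty sum is 0 on any probability space; the space of one summand is at hand. *)
  exists d0, T0, rho, (fun=> 0); split => // r.
  under eq_integral do rewrite mulr0 expR0.
  by rewrite (integral_cst rho measurableT 1%E) mul1e expe0; exact: probability_setT.
have [P' P'E] := product_probability rho P.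
have mexp r : measurable_fun setT (fun x => (expR (r * S x))%:E).
  apply/measurable_EFinP; apply: (measurableT_comp (@measurable_expR R)).
  exact: measurable_funM.
have mexph r : measurable_fun setT (fun x => (expR (r * h x))%:E).
  apply/measurable_EFinP; apply: (measurableT_comp (@measurable_expR R)).
  exact: measurable_funM.
exists _, (T0 * T)%type, P', (fun z => h z.1 + S z.2); split.
- by apply: measurable_funD; exact: measurableT_comp.
- by move=> z; rewrite addr_ge0.
- move=> r; rewrite P'E; last 2 first.
  + apply/measurable_EFinP; apply: (measurableT_comp (@measurable_expR R)).
    by apply: measurable_funM => //; apply: measurable_funD; exact: measurableT_comp.
  + by move=> z; rewrite lee_fin expR_ge0.
  under eq_integral => x _.
    under eq_integral do rewrite /= mulrDr expRD EFinM.
    rewrite ge0_integralZl//; [|by move=> y _; rewrite lee_fin expR_ge0..].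
    rewrite SE; over.
  have Is0 : (0 <= (\int[rho]_x (expR (r * h x))%:E) ^+ s)%E.
    by apply: expe_ge0; apply: integral_ge0 => x _; rewrite lee_fin expR_ge0.
  by rewrite ge0_integralZr ?expeS// => x _; rewrite lee_fin expR_ge0.
Qed.

Section limit_law.
Context (R : realType) (alpha : R) (s : nat).
Hypothesis alpha_gt0 : 0 < alpha.
Local Notation gamma := (alpha^-1).

Let measurable_expRM (c : R) : measurable_fun setT (fun x : R => (expR (c * x))%:E).
Proof.
apply/measurable_EFinP; apply: (measurableT_comp (@measurable_expR R)).
exact: measurable_funM.
Qed.

Lemma integral_pareto_le1 (rho : probability (measurableTypeR R) R) (c : R) :
  0 <= c -> (forall g : R -> \bar R, measurable_fun setT g -> (forall x, 0 <= g x)%E ->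
    \int[rho]_x g x =
    \int[lebesgue_measure]_(x in `[1%R, +oo[) ((alpha * x `^ (- (1 + alpha)))%:E * g x))%E ->
  (\int[rho]_x (expR (- c * x))%:E <= 1)%E.
Proof.
move=> c0 rhoE; rewrite rhoE//.
apply: (@le_trans _ _ (\int[rho]_x (cst 1%E x))%E); last first.
  by rewrite (integral_cst rho measurableT 1%E) mul1e probability_le1.
rewrite rhoE//; apply: ge0_le_integral => //.
- by move=> x _; rewrite mule_ge0 ?lee_fin ?expR_ge0// mulr_ge0 ?powR_ge0// ltW.
- apply: emeasurable_funM; last by apply: measurable_funTS; exact: measurable_expRM.
  apply/measurable_EFinP; apply: measurable_funM => //.
  by apply: measurable_funTS; exact: measurable_powR.
- apply: emeasurable_funM => //.
  apply/measurable_EFinP; apply: measurable_funM => //.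
  by apply: measurable_funTS; exact: measurable_powR.
- move=> x; rewrite /= in_itv/= andbT => x1.
  apply: lee_wpmul2l; first by rewrite lee_fin mulr_ge0 ?powR_ge0// ltW.
  by rewrite lee_fin expR_le1 mulNr oppr_le0 mulr_ge0// (le_trans ler01).
Qed.

(** The first form feeds the construction of the limit law, the second is the one in which limits of
    upper transforms appear. [Num.max x 1] equals [x] almost surely under [rho] and makes the
    variable nonnegative everywhere. *)
Lemma pareto_factorE : exists rho : probability (measurableTypeR R) R,
  forall u z : R, 0 <= u -> 0 < z ->
  [/\ (pareto_factor gamma u z)%:E =
       (z%:E * \int[rho]_x (expR (- (u * z `^ (- gamma)) * Num.max x 1))%:E)%E,
      (pareto_factor gamma u z)%:E =
       (\int[lebesgue_measure]_(x in `]0%R, z[) (expR (- u * x `^ (- gamma)))%:E)%E &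
      0 <= pareto_factor gamma u z <= z].
Proof.
have [rho [rhoE unifE]] := pareto_law alpha_gt0; exists rho => u z u0 z0.
pose c := u * z `^ (- gamma).
have c0 : 0 <= c by rewrite mulr_ge0// powR_ge0.
have aV0 : 0 < alpha^-1 by rewrite invr_gt0.
pose I := (\int[rho]_x (expR (- c * x))%:E)%E.
have I0 : (0 <= I)%E by apply: integral_ge0 => x _; rewrite lee_fin expR_ge0.
have I1 : (I <= 1)%E by exact: integral_pareto_le1.
have fI : I \is a fin_num by rewrite ge0_fin_numE// (le_lt_trans I1)// ltry.
have mpdf : measurable_fun (`[1, +oo[%classic : set (measurableTypeR R))
    (fun x : R => (expR (- u * z `^ (- gamma) * x) / x `^ (1 + gamma^-1))%:E).
  apply/measurable_EFinP; apply: measurable_funM.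
    apply/measurable_EFinP; apply: measurable_funTS; exact: measurable_expRM.
  rewrite (_ : (fun x => _) = (fun x : R => x `^ (- (1 + gamma^-1)))); last first.
    by apply/funext => x; rewrite powRN.
  by apply: measurable_funTS; exact: measurable_powR.
have IE : I = (alpha%:E * \int[lebesgue_measure]_(x in `[1%R, +oo[)
    (expR (- u * z `^ (- gamma) * x) / x `^ (1 + gamma^-1))%:E)%E.
  rewrite /I rhoE//.
  rewrite -ge0_integralZl//; last 2 first.
  - by move=> x _; rewrite lee_fin divr_ge0 ?expR_ge0 ?powR_ge0.
  - by rewrite lee_fin ltW.
  apply: eq_integral => x _; rewrite -!EFinM invrK powRN /c !mulNr.
  by congr _%:E; rewrite mulrAC mulrA.
have pE : (pareto_factor gamma u z)%:E = (z%:E * I)%E.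
  rewrite /pareto_factor /Rintegral; move: fI; rewrite IE; set J := (\int[_]_(_ in _) _)%E.
  have J0 : (0 <= J)%E.
    by apply: integral_ge0 => x _; rewrite lee_fin divr_ge0 ?expR_ge0 ?powR_ge0.
  (* [pareto_factor] is a real integral, so an infinite [J] must be ruled out: [alpha * J] would
     then be infinite, against the finiteness of [I]. *)
  case: (J) J0 => [r||]//=; first by move=> _ _; rewrite invrK -mulrA.
  by rewrite mulry gtr0_sg// mul1e.
have zI : (0 <= z%:E * I <= z%:E)%E.
  by rewrite mule_ge0 ?lee_fin ?(ltW z0)//= -[leRHS]mule1 lee_pmul2l.
split.
- rewrite pE; congr (_ * _)%E; rewrite /I rhoE//.
  rewrite rhoE//; last first.
    apply/measurable_EFinP; apply: (measurableT_comp (@measurable_expR R)).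
    by apply: measurable_funM => //; exact: measurable_maxr.
  apply: eq_integral => x; rewrite inE/= in_itv/= andbT => x1.
  by rewrite max_l.
- rewrite pE; transitivity (\int[lebesgue_measure]_(x in `]0%R, z[)
      (expR (- c * (x / z) `^ (- gamma)))%:E)%E.
    by rewrite (unifE z (fun x => (expR (- c * x))%:E)).
  apply: eq_integral => x; rewrite inE/= in_itv/= => /andP[x0 xz].
  have -> : - c * (x / z) `^ (- gamma) = - u * x `^ (- gamma); last by [].
  rewrite /c !mulNr -mulrA -powRM ?(ltW z0) ?divr_ge0 ?(ltW x0) ?(ltW z0)//.
  by rewrite mulrCA mulfV ?mulr1// lt0r_neq0.
- by rewrite -!lee_fin pE.
Qed.

End limit_law.

(** One term of the exponential series at [a * x]. It makes [mixing_transform] finite at positive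
    arguments without any moment of [Theta]. *)
Lemma exprn_expRN_le (R : realType) (a x : R) n : 0 < a -> 0 <= x ->
  x ^+ n.+1 * expR (- a * x) <= n.+1`!%:R / a ^+ n.+1.
Proof.
move=> a0 x0; have n0 : 0 < n.+1`!%:R :> R by rewrite ltr0n fact_gt0.
rewrite ler_pdivlMr ?exprn_gt0// mulrAC -exprMn mulNr expRN ler_pdivrMr ?expR_gt0//.
rewrite mulrC -ler_pdivrMl//.
apply: le_trans (expR_ge1Dxn n (mulr_ge0 (ltW a0) x0)).
by rewrite [leLHS]mulrC lerDr.
Qed.

(** * Probability space of the limit and its transform *)

Section limit_space.
Context (R : realType) (alpha : R) (s : nat) (mean : R).
Hypotheses (alpha_gt0 : 0 < alpha) (mean_ge0 : 0 <= mean).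
Local Notation gamma := (alpha^-1).

(** Integrand of the limit given [Theta = theta]. The positive part of [theta] keeps it nonnegative
    on the null set where [Theta] may fail to be positive. *)
Definition limit_kernel (u v w theta z : R) : R :=
  Num.max theta 0 ^+ s.+1 / s`!%:R *
  (pareto_factor gamma u z ^+ s * expR (- v * z `^ (- gamma)) *
   expR (- (z + w * mean) * theta)).

Lemma pareto_factor_bounds (u z : R) : 0 <= u -> 0 < z -> 0 <= pareto_factor gamma u z <= z.
Proof. by move=> u0 z0; have [rho /(_ u z u0 z0)[]] := pareto_factorE alpha_gt0. Qed.

Lemma measurable_pareto_factor (u : R) : 0 <= u ->
  measurable_fun setT (fun z : R => if 0 < z then pareto_factor gamma u z else 0).
Proof.
move=> u0; have [rho rhoE] := pareto_factorE alpha_gt0.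
pose f (p : R * measurableTypeR R) : \bar R :=
  (expR (- (u * p.1 `^ (- gamma)) * Num.max p.2 1))%:E.
have mf : measurable_fun setT f.
  apply/measurable_EFinP; apply: (measurableT_comp (@measurable_expR R)).
  apply: measurable_funM.
    apply: measurableT_comp => //; apply: measurable_funM => //.
    by apply: (measurableT_comp (measurable_powR _)); exact: measurable_fst.
  by apply: measurable_maxr => //; exact: measurable_snd.
rewrite (_ : (fun z => _) = (fun z => if 0 < z then fine (z%:E * fubini_F rho f z) else 0)).
  apply: measurable_fun_ifT => //; first exact: measurable_fun_ltr.
  apply: (measurableT_comp (fine_measurable measurableT)).
  apply: emeasurable_funM; first exact/measurable_EFinP.
  by apply: measurable_fun_fubini_tonelli_F => // p; rewrite lee_fin expR_ge0.
apply/funext => z; case: ifPn => // z0.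
by have [<- _ _] := rhoE _ _ u0 z0.
Qed.

Lemma measurable_limit_kernel (u v w theta : R) : 0 <= u ->
  measurable_fun (`]0, +oo[%classic : set R) (limit_kernel u v w theta).
Proof.
move=> u0; pose h (z : R) : R := Num.max theta 0 ^+ s.+1 / s`!%:R *
    ((if 0 < z then pareto_factor gamma u z else 0) ^+ s *
     expR (- v * z `^ (- gamma)) * expR (- (z + w * mean) * theta)).
apply: (eq_measurable_fun h).
  by move=> z; rewrite inE/= in_itv/= andbT => z0; rewrite /h /limit_kernel z0.
apply: measurable_funTS; apply: measurable_funM => //; apply: measurable_funM.
  apply: measurable_funM.
    by apply: measurable_funX; exact: measurable_pareto_factor.
  by apply: (measurableT_comp (@measurable_expR R)); exact: measurable_funM.
apply: (measurableT_comp (@measurable_expR R)); apply: measurable_funM => //.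
by apply: measurableT_comp => //; exact: measurable_funD.
Qed.

Context dQ (TQ : measurableType dQ) (Q : probability TQ R) (Theta : {RV Q >-> R}).
Hypothesis Theta_gt0 : {ae Q, forall x, 0 < Theta x}.

Definition limit_transform (u v w theta : R) : \bar R :=
  (\int[lebesgue_measure]_(z in `]0%R, +oo[) (limit_kernel u v w theta z)%:E)%E.

Lemma limit_kernel_ge0 (u v w theta z : R) : 0 <= u -> 0 < z ->
  0 <= limit_kernel u v w theta z.
Proof.
move=> u0 z0; have /andP[p0 _] := pareto_factor_bounds u0 z0.
by rewrite !mulr_ge0 ?expR_ge0 ?exprn_ge0 ?invr_ge0// le_max lexx orbT.
Qed.

(** Given [Theta], [z] is distributed as the arrival time of rank [s + 1] of a Poisson process of
    rate [Theta]; this is the joint density with respect to the product of [Q] and the Lebesgue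
    measure. *)
Let density (p : TQ * measurableTypeR R) : R :=
  if (0 < Theta p.1) && (0 < p.2) then
    Theta p.1 * expR (- (Theta p.1 * p.2)) * (Theta p.1 * p.2) ^+ s / s`!%:R
  else 0.

Let measurable_Theta1 : measurable_fun setT (fun p : TQ * measurableTypeR R => Theta p.1).
Proof. by apply: measurableT_comp => //; exact: measurable_fst. Qed.

Let measurable_snd2 : measurable_fun setT (fun p : TQ * measurableTypeR R => p.2 : R).
Proof. exact: measurable_snd. Qed.

Let measurable_density : measurable_fun setT density.
Proof.
apply: measurable_fun_ifT => //.
  by apply: measurable_and; exact: measurable_fun_ltr.
apply: measurable_funM => //; apply: measurable_funM; last first.
  by apply: measurable_funX; exact: measurable_funM.
apply: measurable_funM => //.
apply: (measurableT_comp (@measurable_expR R)); apply: measurableT_comp => //.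
exact: measurable_funM.
Qed.

Let density_ge0 p : 0 <= density p.
Proof.
rewrite /density; case: ifP => // /andP[t0 z0].
by rewrite !mulr_ge0 ?expR_ge0 ?exprn_ge0 ?invr_ge0 ?mulr_ge0// ltW.
Qed.

Let kernel (u v w : R) (p : TQ * measurableTypeR R) : R :=
  if 0 < p.2 then limit_kernel u v w (Theta p.1) p.2 else 0.

Let kernel_ge0 u v w p : 0 <= u -> 0 <= kernel u v w p.
Proof. by move=> u0; rewrite /kernel; case: ifP => // ?; exact: limit_kernel_ge0. Qed.

Let measurable_kernel u v w : 0 <= u -> measurable_fun setT (kernel u v w).
Proof.
move=> u0; rewrite (_ : kernel u v w = (fun p => if 0 < p.2 then
    Num.max (Theta p.1) 0 ^+ s.+1 / s`!%:R *
    ((if 0 < p.2 then pareto_factor gamma u p.2 else 0) ^+ s *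
     expR (- v * p.2 `^ (- gamma)) *
     expR (- (p.2 + w * mean) * Theta p.1)) else 0)); last first.
  by apply/funext => p; rewrite /kernel; case: ifP.
apply: measurable_fun_ifT => //; first exact: measurable_fun_ltr.
apply: measurable_funM.
  by apply: measurable_funM => //; apply: measurable_funX; exact: measurable_maxr.
apply: measurable_funM; last first.
  apply: (measurableT_comp (@measurable_expR R)); apply: measurable_funM => //.
  by apply: measurableT_comp => //; exact: measurable_funD.
apply: measurable_funM; last first.
  apply: (measurableT_comp (@measurable_expR R)); apply: measurable_funM => //.
  exact: (measurableT_comp (measurable_powR _) measurable_snd2).
apply: measurable_funX.
exact: (measurableT_comp (measurable_pareto_factor u0) measurable_snd2).
Qed.

Let limit_transformE u v w x : limit_transform u v w (Theta x) =
  (\int[lebesgue_measure]_z (kernel u v w (x, z))%:E)%E.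
Proof.
rewrite /limit_transform integral_mkcond; apply: eq_integral => z _.
by rewrite patchE mem_setE in_itv/= andbT /kernel/=; case: ifP.
Qed.

Lemma measurable_limit_transform (u v w : R) : 0 <= u ->
  measurable_fun setT (fun x => limit_transform u v w (Theta x)).
Proof.
move=> u0; under eq_fun do rewrite limit_transformE.
apply: (measurable_fun_fubini_tonelli_F (m2 := lebesgue_measure) (EFin \o kernel u v w)).
  by apply/measurable_EFinP; exact: measurable_kernel.
by move=> p /=; rewrite lee_fin kernel_ge0.
Qed.

Let integral_density : (\int[Q]_x \int[lebesgue_measure]_z (density (x, z))%:E = 1)%E.
Proof.
transitivity (\int[Q]_x (cst 1%E x))%E; last first.
  by rewrite (integral_cst Q measurableT 1%E) mul1e; exact: probability_setT.
apply: ae_eq_integral => //.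
- apply: (measurable_fun_fubini_tonelli_F (m2 := lebesgue_measure)
    (EFin \o density)).
    exact/measurable_EFinP.
  by move=> p /=; rewrite lee_fin.
- apply: filterS Theta_gt0 => x t0 _.
  rewrite -(integral_gamma t0 s) [RHS]integral_mkcond; apply: eq_integral => z _.
  by rewrite patchE mem_setE in_itv/= andbT /density/= t0/=; case: ifP.
Qed.

(** Given [z], the sum of [s] Pareto variables scaled by [z ^ (- gamma)] has transform
    [(pareto_factor / z) ^ s], and the factor [z ^ s] of the Gamma density cancels the
    denominator. *)
Lemma limit_space : exists (d' : measure_display) (T' : measurableType d')
    (P' : probability T' R) (Lambda Xi Sigma : {RV P' >-> R}),
  [/\ forall x, 0 <= Lambda x, forall x, 0 <= Xi x, forall x, 0 <= Sigma x &
   forall u v w : R, 0 <= u -> 0 <= v -> 0 <= w ->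
     joint_laplace Lambda Xi Sigma u v w = (\int[Q]_x limit_transform u v w (Theta x))%E].
Proof.
have [rho rhoE] := pareto_factorE alpha_gt0.
have mmax : measurable_fun (setT : set (measurableTypeR R)) (fun x : R => Num.max x 1).
  exact: measurable_maxr.
have max0 (x : measurableTypeR R) : 0 <= Num.max (x : R) 1 by rewrite le_max ler01 orbT.
have [dS [TS [PS [S [mS S0 SE]]]]] := iid_nonneg_sum rho s mmax max0.
have [mu muE mu_int] := density_measure (Q \x lebesgue_measure)%E measurable_density density_ge0.
have muT : mu setT = 1%E.
  rewrite muE -integral_density fubini_tonelli1//; exact/measurable_EFinP.
have [P1 P1E] := measure_probability muT.
have [P' P'E] := product_probability P1 PS.
pose L (p : (TQ * measurableTypeR R) * TS) : R := p.1.2 `^ (- gamma) * S p.2.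
pose X (p : (TQ * measurableTypeR R) * TS) : R := p.1.2 `^ (- gamma).
pose M (p : (TQ * measurableTypeR R) * TS) : R := mean * Num.max (Theta p.1.1) 0.
have mX : measurable_fun setT X.
  apply: (measurableT_comp (measurable_powR _)).
  by apply: (measurableT_comp measurable_snd2); exact: measurable_fst.
have mL : measurable_fun setT L by apply: measurable_funM => //; exact: measurableT_comp.
have mM : measurable_fun setT M.
  apply: measurable_funM => //; apply: measurable_maxr => //.
  by apply: (measurableT_comp measurable_Theta1); exact: measurable_fst.
pose Lambda : {RV P' >-> R} := HB.pack L (isMeasurableFun.Build _ _ _ _ L mL).
pose Xi : {RV P' >-> R} := HB.pack X (isMeasurableFun.Build _ _ _ _ X mX).
pose Sigma : {RV P' >-> R} := HB.pack M (isMeasurableFun.Build _ _ _ _ M mM).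
exists _, _, P', Lambda, Xi, Sigma; split.
- by move=> p; rewrite mulr_ge0 ?powR_ge0.
- by move=> p; rewrite powR_ge0.
- by move=> p; rewrite mulr_ge0// le_max lexx orbT.
move=> u v w u0 v0 w0.
(* What remains after integrating out the Pareto sum for fixed [Theta] and [z]. *)
pose g (p : TQ * measurableTypeR R) : \bar R :=
  ((expR (- v * p.2 `^ (- gamma) - w * (mean * Num.max (Theta p.1) 0)))%:E *
   (\int[rho]_x (expR (- (u * p.2 `^ (- gamma)) * Num.max (x : R) 1))%:E) ^+ s)%E.
transitivity (\int[P1]_p g p)%E.
  rewrite /joint_laplace unlock P'E//; last first.
    apply/measurable_EFinP; apply: (measurableT_comp (@measurable_expR R)).
    by apply: measurable_funB; first apply: measurable_funB; exact: measurable_funM.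
  apply: eq_integral => -[x z] _; rewrite /g -SE.
  rewrite -ge0_integralZl//; last first.
    apply/measurable_EFinP; apply: (measurableT_comp (@measurable_expR R)).
    exact: measurable_funM.
  apply: eq_integral => y _; rewrite -EFinM -expRD; congr (expR _)%:E.
  by rewrite /= /L /X /M /=; ring.
have mg : measurable_fun setT g.
  apply: emeasurable_funM.
    apply/measurable_EFinP; apply: (measurableT_comp (@measurable_expR R)).
    apply: measurable_funB; apply: measurable_funM => //.
      exact: (measurableT_comp (measurable_powR _) measurable_snd2).
    by apply: measurable_funM => //; exact: measurable_maxr.
  under eq_fun do rewrite -SE.
  apply: (measurable_fun_fubini_tonelli_F (m2 := PS)
    (fun q : (TQ * measurableTypeR R) * TS =>
       (expR (- (u * q.1.2 `^ (- gamma)) * S q.2))%:E)).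
    apply/measurable_EFinP; apply: (measurableT_comp (@measurable_expR R)).
    apply: measurable_funM; last exact: measurableT_comp.
    apply: measurableT_comp => //; apply: measurable_funM => //.
  by move=> q; rewrite lee_fin expR_ge0.
have g0 p : (0 <= g p)%E.
  rewrite mule_ge0 ?lee_fin ?expR_ge0//; apply: expe_ge0.
  by apply: integral_ge0 => x _; rewrite lee_fin expR_ge0.
rewrite P1E mu_int//.
rewrite fubini_tonelli1//; last 2 first.
- by apply: emeasurable_funM => //; exact/measurable_EFinP.
- by move=> p; rewrite mule_ge0// lee_fin.
apply: ae_eq_integral => //.
- apply: measurable_fun_fubini_tonelli_F.
    by apply: emeasurable_funM => //; exact/measurable_EFinP.
  by move=> p; rewrite mule_ge0// lee_fin.
- exact: measurable_limit_transform.
apply: filterS Theta_gt0 => x t0 _.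
rewrite /fubini_F limit_transformE; apply: eq_integral => z _.
rewrite /density/kernel/= t0/=; case: ifPn => [z0|_]; last by rewrite mul0e.
have [pfE _ _] := rhoE u z u0 z0.
rewrite /g/= /limit_kernel max_l ?(ltW t0)//.
(* The powers of [z] come from the Gamma density, those of the integral from the Pareto sum. *)
have {}pfE : ((pareto_factor gamma u z ^+ s)%:E = (z ^+ s)%:E *
    (\int[rho]_x0 (expR (- (u * z `^ (- gamma)) * Num.max (x0 : R) 1))%:E) ^+ s)%E.
  rewrite !EFin_expe pfE; set J := (\int[rho]_ _ _)%E.
  elim: (s) => [|n IH]; first by rewrite mul1e.
  by rewrite !expeS IH muleACA.
move: (_ ^+ s)%E pfE => K pfE.
set A := - v * z `^ (- gamma); set th := Theta x; set p := pareto_factor gamma u z ^+ s.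
have eE : expR (- (th * z)) * expR (A - w * (mean * th)) =
    expR A * expR (- (z + w * mean) * th).
  by rewrite -!expRD; congr expR; ring.
rewrite (_ : th ^+ s.+1 / s`!%:R * (p * expR A * expR (- (z + w * mean) * th)) =
  th ^+ s.+1 / s`!%:R * (expR A * expR (- (z + w * mean) * th)) * p); last by ring.
rewrite [in RHS]EFinM pfE !muleA -!EFinM -eE exprMn exprS; congr (_%:E * _)%E.
by move: (s`!%:R^-1 : R) => i; ring.
Qed.

(** Tonelli: integrating over [Theta] first turns the powers and the exponential in [theta] into
    [mixing_transform]. *)
Lemma limit_transform_mixing u v w : 0 <= u -> 0 <= w ->
  (\int[Q]_x limit_transform u v w (Theta x) =
   (s`!%:R^-1)%:E * \int[lebesgue_measure]_(z in `]0%R, +oo[)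
     (pareto_factor gamma u z ^+ s * expR (- v * z `^ (- gamma)) *
      mixing_transform Theta s.+1 (z + w * mean))%:E)%E.
Proof.
move=> u0 w0.
under eq_integral do rewrite limit_transformE.
rewrite -(fubini_tonelli1 (EFin \o kernel u v w))//; last 2 first.
- by apply/measurable_EFinP; exact: measurable_kernel.
- by move=> p /=; rewrite lee_fin kernel_ge0.
rewrite (fubini_tonelli2 (EFin \o kernel u v w))//; last 2 first.
- by apply/measurable_EFinP; exact: measurable_kernel.
- by move=> p /=; rewrite lee_fin kernel_ge0.
have mG : measurable_fun setT (fubini_G Q (EFin \o kernel u v w)).
  apply: measurable_fun_fubini_tonelli_G.
    by apply/measurable_EFinP; exact: measurable_kernel.
  by move=> p /=; rewrite lee_fin kernel_ge0.
pose C z := pareto_factor gamma u z ^+ s * expR (- v * z `^ (- gamma)).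
have C0 z : 0 < z -> 0 <= C z.
  move=> z0; have /andP[p0 _] := pareto_factor_bounds u0 z0.
  by rewrite mulr_ge0 ?expR_ge0 ?exprn_ge0.
have f0 : 0 < s`!%:R :> R by rewrite ltr0n fact_gt0.
have GE (z : R) : 0 < z -> fubini_G Q (EFin \o kernel u v w) z =
    (s`!%:R^-1 * (C z * mixing_transform Theta s.+1 (z + w * mean)))%:E.
  move=> z0; pose a := z + w * mean.
  (* Positivity of [a] makes the expectation finite, so that [fine] in [mixing_transform] loses
     nothing. *)
  have a0 : 0 < a by rewrite ltr_pwDl// mulr_ge0.
  pose k x := Num.max (Theta x) 0 ^+ s.+1 * expR (- a * Theta x).
  have k0 x : 0 <= k x by rewrite mulr_ge0 ?expR_ge0 ?exprn_ge0// le_max lexx orbT.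
  have mk : measurable_fun setT (EFin \o k).
    apply/measurable_EFinP; apply: measurable_funM.
      by apply: measurable_funX; exact: measurable_maxr.
    by apply: (measurableT_comp (@measurable_expR R)); exact: measurable_funM.
  have IE : ('E_Q[(fun x => expR (- a * Theta x) * Theta x ^+ s.+1)%R] =
      \int[Q]_x (k x)%:E)%E.
    rewrite unlock; apply: ae_eq_integral => //.
      apply/measurable_EFinP; apply: measurable_funM; last exact: measurable_funX.
      by apply: (measurableT_comp (@measurable_expR R)); exact: measurable_funM.
    apply: filterS Theta_gt0 => x t0 _.
    by rewrite /k max_l ?(ltW t0)// mulrC.
  have fI : (\int[Q]_x (k x)%:E)%E \is a fin_num.
    rewrite ge0_fin_numE; last by apply: integral_ge0 => x _; rewrite lee_fin.
    apply: (@le_lt_trans _ _ (\int[Q]_x (cst (s.+1`!%:R / a ^+ s.+1)%:E x))%E).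
      apply: ge0_le_integral => // [x _|x _]; first by rewrite lee_fin.
      rewrite lee_fin /k; have [t0|t0] := leP 0 (Theta x).
        by rewrite exprn_expRN_le.
      by rewrite expr0n/= mul0r divr_ge0 ?exprn_ge0 ?(ltW a0).
    rewrite (integral_cst Q measurableT) [X in (_ * X)%E](_ : _ = 1%E).
      by rewrite mule1 ltry.
    exact: probability_setT.
  transitivity (\int[Q]_x ((s`!%:R^-1 * C z)%:E * (k x)%:E))%E.
    apply: eq_integral => x _; rewrite /= /kernel/= z0 /limit_kernel -EFinM.
    congr _%:E; rewrite /C -/a /k; move: (s`!%:R^-1 : R) => i; ring.
  rewrite ge0_integralZl//; last 2 first.
  - by move=> x _; rewrite lee_fin.
  - by rewrite lee_fin mulr_ge0 ?invr_ge0 ?C0.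
  have mE : (mixing_transform Theta s.+1 a)%:E = (\int[Q]_x (k x)%:E)%E.
    by rewrite /mixing_transform IE fineK.
  by rewrite -/a [in RHS]mulrA -mE -EFinM.
transitivity (\int[lebesgue_measure]_(z in `]0%R, +oo[)
    fubini_G Q (EFin \o kernel u v w) z)%E.
  rewrite [RHS]integral_mkcond; apply: eq_integral => z _.
  rewrite patchE mem_setE in_itv/= andbT; case: ifPn => // z0.
  by apply: integral0_eq => x _; rewrite /= /kernel/= (negbTE z0).
transitivity (\int[lebesgue_measure]_(z in `]0%R, +oo[)
   ((s`!%:R^-1)%:E * (C z * mixing_transform Theta s.+1 (z + w * mean))%:E))%E.
  apply: eq_integral => z; rewrite inE/= in_itv/= andbT => z0.
  by rewrite GE.
rewrite ge0_integralZl//.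
- apply: (eq_measurable_fun (fun z => (s`!%:R)%:E * fubini_G Q (EFin \o kernel u v w) z)%E).
    move=> z; rewrite inE/= in_itv/= andbT => z0.
    by rewrite GE// -EFinM mulVKf ?gt_eqF.
  by apply: emeasurable_funM => //; exact: measurable_funTS.
- move=> z; rewrite /= in_itv/= andbT => z0.
  rewrite -(mulVKf (lt0r_neq0 f0) (C z * _)) EFinM -GE//.
  apply: mule_ge0; first by rewrite lee_fin.
  by apply: integral_ge0 => x _; rewrite lee_fin kernel_ge0.
Qed.

End limit_space.

(** * Convergence along a deterministic number of claims *)

(** The domination is required only from some rank on, uniformly in the point; shifting the sequence
    reduces this to the usual theorem. *)
Lemma dominated_cvg_near d (T : measurableType d) (R : realType)
    (mu : {measure set T -> \bar R}) (D : set T) (f_ : nat -> T -> R) (f g : T -> R) :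
  measurable D -> (forall n, measurable_fun D (f_ n)) -> measurable_fun D f ->
  {ae mu, forall x, D x -> f_ n x @[n --> \oo] --> f x} ->
  mu.-integrable D (EFin \o g) ->
  (\forall n \near \oo, forall x, D x -> `|f_ n x| <= g x) ->
  (\int[mu]_(x in D) (f_ n x)%:E)%E @[n --> \oo] --> (\int[mu]_(x in D) (f x)%:E)%E.
Proof.
move=> mD mf_ mf f_f ig [M _ Mg]; rewrite -(cvg_shiftn M).
have mf_' n : measurable_fun D (EFin \o f_ (n + M)%N) by exact/measurable_EFinP.
have mf' : measurable_fun D (EFin \o f) by exact/measurable_EFinP.
have f_f' : {ae mu, forall x, D x -> (EFin \o f_ (n + M)%N) x @[n --> \oo] --> (EFin \o f) x}.
  apply: filterS f_f => x + Dx => /(_ Dx) fx.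
  apply: cvg_EFin; first exact: nearW.
  by rewrite -(cvg_shiftn M) in fx.
have f_g : {ae mu, forall x n, D x -> (`|(EFin \o f_ (n + M)%N) x| <= (EFin \o g) x)%E}.
  by apply: aeW => x n Dx /=; rewrite lee_fin; apply: Mg => //=; exact: leq_addl.
by have [] := dominated_convergence mD mf_' mf' f_f' ig f_g.
Qed.

Lemma expR_bound_1B (R : realType) (x : R) : 0 <= x < 1 ->
  expR (- (x / (1 - x))) <= 1 - x <= expR (- x).
Proof.
move=> /andP[x0 x1]; have y0 : 0 < 1 - x by rewrite subr_gt0.
rewrite (expR_ge1Dx (- x)) andbT expRN -[leRHS]invrK lef_pV2 ?posrE ?expR_gt0 ?invr_gt0//.
rewrite [leLHS](_ : _ = 1 + x / (1 - x)); first exact: expR_ge1Dx.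
by field; rewrite gt_eqF.
Qed.

Section sequences_at_infinity.
Context (R : realType) (t : nat -> R) (n : nat -> nat) (theta : R).
Hypothesis t_cvg : t k @[k --> \oo] --> +oo.
Hypothesis n_cvg : (n k)%:R / t k @[k --> \oo] --> theta.


Lemma near_gt_seq A : \forall k \near \oo, A < t k.
Proof. exact: (cvgryPgt _).1 t_cvg A. Qed.

Lemma inv_seq_cvg0 : (t k)^-1 @[k --> \oo] --> (0 : R).
Proof. by apply: (gtr0_cvgV0 _).2 t_cvg; exact: near_gt_seq. Qed.

(** The expression lies between [a / (1 + a / t k)] and [a], both from [1 + x <= expR x]. *)
Lemma cvg_mul_1BexpR (a : R) : 0 <= a -> t k * (1 - expR (- (a / t k))) @[k --> \oo] --> a.
Proof.
move=> a0.
apply: (@squeeze_cvgr _ _ _ _ (fun k => a / (1 + a / t k)) (fun=> a)).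
- near=> k.
  have t0 : 0 < t k by near: k; exact: near_gt_seq.
  have x0 : 0 <= a / t k by rewrite divr_ge0// ltW.
  have x1 : 0 < 1 + a / t k by rewrite ltr_pwDl.
  apply/andP; split; last first.
    rewrite -ler_pdivlMl// mulrC lerBlDr -lerBlDl; exact: expR_ge1Dx.
  rewrite -ler_pdivrMl// mulrC mulrAC lerBrDl -lerBrDr expRN.
  apply: (@le_trans _ _ (1 + a / t k)^-1).
    by rewrite lef_pV2 ?posrE ?expR_gt0// expR_ge1Dx.
  move: (a / t k) x1 => y y1.
  by rewrite (_ : 1 - _ = (1 + y)^-1)//; field; rewrite gt_eqF.
- rewrite -[X in _ --> X]divr1; apply: cvgM; first exact: cvg_cst.
  apply: cvgV; first exact: oner_neq0.
  rewrite -[X in _ --> X]addr0; apply: cvgD; first exact: cvg_cst.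
  rewrite -(mulr0 a); apply: cvgM; first exact: cvg_cst.
  exact: inv_seq_cvg0.
- exact: cvg_cst.
Unshelve. all: by end_near. Qed.

(** The defect [1 - c k] tends to 0, and [expR_bound_1B] raised to the power [m k] squeezes between
    two exponentials with the same limiting exponent. *)
Lemma cvg_exprn_1B (c : nat -> R) (m : nat -> nat) (kappa : R) :
  (forall k, 0 <= c k <= 1) -> (m k)%:R / t k @[k --> \oo] --> theta ->
  t k * (1 - c k) @[k --> \oo] --> kappa ->
  c k ^+ m k @[k --> \oo] --> expR (- (theta * kappa)).
Proof.
move=> c01 m_cvg c_cvg.
have d_cvg : 1 - c k @[k --> \oo] --> (0 : R).
  rewrite -(mulr0 kappa); apply: cvg_trans (cvgM c_cvg inv_seq_cvg0).
  apply: near_eq_cvg; near=> k.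
  have t0 : 0 < t k by near: k; exact: near_gt_seq.
  by rewrite /= mulrAC divff ?mul1r// gt_eqF.
have expc (u : nat -> R) a : u k @[k --> \oo] --> a -> expR (- u k) @[k --> \oo] --> expR (- a).
  by move=> ua; apply: continuous_cvg; [exact: continuous_expR|exact: cvgN].
apply: (@squeeze_cvgr _ _ _ _
  (fun k => expR (- ((m k)%:R / t k * (t k * (1 - c k)) / (1 - (1 - c k)))))
  (fun k => expR (- ((m k)%:R / t k * (t k * (1 - c k)))))); first last.
- by apply: expc; exact: cvgM.
- apply: expc; rewrite -[X in _ --> X]divr1; apply: cvgM; first exact: cvgM.
  apply: cvgV; first exact: oner_neq0.
  by rewrite -[X in _ --> X]subr0; apply: cvgB => //; exact: cvg_cst.
near=> k.
have t0 : 0 < t k by near: k; exact: near_gt_seq.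
have /andP[c0 c1] := c01 k.
have d01 : 0 <= 1 - c k < 1.
  by rewrite subr_ge0 c1/=; near: k; apply: (cvgr_lt _ d_cvg).
have /andP[l1 l2] := expR_bound_1B d01.
rewrite subKr in l1 l2 *.
rewrite (_ : (m k)%:R / t k * (t k * _) = (m k)%:R * (1 - c k)); last by field; rewrite gt_eqF.
have expX y : expR (- ((m k)%:R * y)) = expR (- y) ^+ m k by rewrite -mulrN expRM_natl.
by rewrite -mulrA !expX; apply/andP; split; apply: lerXn2r;
  rewrite ?nnegrE ?expR_ge0 ?c0.
Unshelve. all: by end_near. Qed.

Hypothesis theta_gt0 : 0 < theta.

Lemma near_gt_index m : \forall k \near \oo, (m < n k)%N.
Proof.
have th2 : theta / 2 < theta by rewrite ltr_pdivrMr// ltr_pMr// ltr1n.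
near=> k.
have t0 : 0 < t k by near: k; exact: near_gt_seq.
have tm : m%:R / (theta / 2) < t k by near: k; exact: near_gt_seq.
have h : theta / 2 < (n k)%:R / t k by near: k; exact: (cvgr_gt _ n_cvg).
rewrite -(ltr_nat R); apply: (lt_trans (y := theta / 2 * t k)).
  by rewrite mulrC -ltr_pdivrMr// divr_gt0.
by rewrite -ltr_pdivlMr.
Unshelve. all: by end_near. Qed.

Lemma cvg_natrB_div m : (n k - m)%:R / t k @[k --> \oo] --> theta.
Proof.
have h : (n k)%:R / t k - m%:R / t k @[k --> \oo] --> theta.
  rewrite -[X in _ --> X]subr0 -(mulr0 m%:R); apply: cvgB => //.
  by apply: cvgM; [exact: cvg_cst|exact: inv_seq_cvg0].
apply: cvg_trans h; apply: near_eq_cvg; near=> k.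
rewrite natrB ?mulrBl//; apply: ltnW; near: k; exact: near_gt_index.
Unshelve. all: by end_near. Qed.

Lemma cvg_ffact_div m : (n k ^_ m)%:R / t k ^+ m @[k --> \oo] --> theta ^+ m.
Proof.
elim: m => [|m IH].
  under eq_fun do rewrite ffactn0 expr0 divr1; exact: cvg_cst.
rewrite exprSr; apply: cvg_trans (cvgM IH (cvg_natrB_div m)).
apply: near_eq_cvg; near=> k.
have t0 : t k != 0 by rewrite gt_eqF//; near: k; exact: near_gt_seq.
by rewrite /= ffactnSr natrM exprSr; field; rewrite t0 expf_neq0.
Unshelve. all: by end_near. Qed.

(** [n * 'C(n.-1, s)] is the falling factorial of [n] with [s + 1] factors divided by [s!], and each
    factor divided by [t k] tends to [theta]. *)
Lemma cvg_top_coefficient s :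
  (n k * 'C((n k).-1, s))%:R / t k ^+ s.+1 @[k --> \oo] --> theta ^+ s.+1 / s`!%:R.
Proof.
rewrite (_ : (fun k => _) = (fun k => (n k ^_ s.+1)%:R / t k ^+ s.+1 * (s`!%:R)^-1)).
  by apply: cvgM; [exact: cvg_ffact_div|exact: cvg_cst].
apply/funext => k; rewrite ffactnS -bin_ffact mulnA [in RHS]natrM -mulrA -invfM.
by rewrite [_ ^+ _ * _]mulrC invfM mulrA mulfK// pnatr_eq0 -lt0n fact_gt0.
Qed.

End sequences_at_infinity.

(** * Limits of the upper and lower transforms of one claim *)

Section claim_transforms.
Context (R : realType) d (T : measurableType d) (P : probability T R)
  (X : nat -> {RV P >-> R}) (F : R -> R) (alpha : R) (l : R -> R).
Hypothesis X_ge0 : forall i x, 0 <= X i x.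
Hypothesis X_cdf : forall i (y : R), cdf (X i) y = (F y)%:E.
Hypothesis F_tail : forall y : R, 0 < y -> 1 - F y = y `^ (- alpha) * l y.
Hypothesis l_slow : slowly_varying l.
Hypothesis alpha_gt0 : 0 < alpha.
Local Notation U := (tail_quantile F).
Local Notation gamma := (alpha^-1).

Let Y := X 0%N.
Let Y_ge0 x : 0 <= Y x := X_ge0 0%N x.
Let Y_cdf y : cdf Y y = (F y)%:E := X_cdf 0%N y.

Section quantile_change.
Variables (t : R) (g : R -> R).
Hypotheses (t_gt0 : 0 < t) (mg : measurable_fun setT g) (g0 : forall y, 0 <= g y).

(** Extension by 0 beyond [t], so that the domain of integration no longer depends on [t] and
    dominated convergence applies. *)
Definition at_quantile (z : R) : R := if (0 < z) && (z < t) then g (U (t / z)) else 0.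

Lemma at_quantile_ge0 z : 0 <= at_quantile z.
Proof. by rewrite /at_quantile; case: ifP. Qed.

Lemma measurable_at_quantile : measurable_fun setT at_quantile.
Proof.
have DE : setT `&` (fun z : R => (0 < z) && (z < t)) @^-1` [set true] = `]0, t[%classic.
  by apply/seteqP; split => z /=; rewrite in_itv/=; [case|split].
apply: measurable_fun_if => //.
  by apply: measurable_and; exact: measurable_fun_ltr.
by rewrite DE; apply: measurableT_comp => //; exact: (measurable_quantile_div Y_ge0 Y_cdf t_gt0).
Qed.

Lemma integral_at_quantile :
  (\int[lebesgue_measure]_(z in `]0%R, +oo[) (at_quantile z)%:E =
   t%:E * \int[P]_x (g (Y x))%:E)%E.
Proof.
rewrite -(integral_quantile_div Y_ge0 Y_cdf t_gt0 (g := EFin \o g))//; last exact/measurable_EFinP.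
rewrite integral_mkcond [RHS]integral_mkcond; apply: eq_integral => z _.
rewrite !patchE !mem_setE !in_itv/= andbT /at_quantile.
by case: (0 < z)%R => //; case: (z < t)%R.
Qed.

End quantile_change.

Section along_sequence.
Variable t : nat -> R.
Hypothesis t_cvg : t k @[k --> \oo] --> +oo.
Hypothesis t_gt1 : forall k, 1 < t k.

Let t_gt0 k : 0 < t k.
Proof. exact: lt_trans ltr01 (t_gt1 k). Qed.

Lemma cvg_quantile_seq z : 0 < z -> U (t k / z) / U (t k) @[k --> \oo] --> z `^ (- gamma).
Proof.
move=> z0; exact: cvg_comp t_cvg (cvg_quantile_ratio Y_ge0 Y_cdf F_tail l_slow alpha_gt0 z0).
Qed.

Lemma near_quantile_gt A : \forall k \near \oo, A < U (t k).
Proof.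
have h : U (t k) @[k --> \oo] --> +oo.
  exact: cvg_comp t_cvg (tail_quantile_cvgy Y_ge0 Y_cdf F_tail l_slow).
exact: near_gt_seq h A.
Qed.

Lemma cvg_div_seq z : 0 < z -> t k / z @[k --> \oo] --> +oo.
Proof.
move=> z0; apply/cvgryPgt => A.
near=> k; rewrite ltr_pdivlMr//; near: k; exact: near_gt_seq.
Unshelve. all: by end_near. Qed.

(** [U] may have flat stretches, so strictness is not automatic; it is inherited from the limits of
    the two ratios to [U (t k)], which are distinct. It decides the indicators in the next proof. *)
Lemma near_quantile_lt x z : 0 < x -> x < z ->
  \forall k \near \oo, U (t k / z) < U (t k / x).
Proof.
move=> x0 xz; have z0 := lt_trans x0 xz.
have lt_pow : z `^ (- gamma) < x `^ (- gamma).
  rewrite !powRN ltf_pV2 ?posrE ?powR_gt0// gt0_ltr_powR ?nnegrE ?invr_gt0 ?ltW//.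
pose m := (z `^ (- gamma) + x `^ (- gamma)) / 2.
have zm : z `^ (- gamma) < m by rewrite /m; lra.
have mx : m < x `^ (- gamma) by rewrite /m; lra.
near=> k.
have Uk : 0 < U (t k) by near: k; exact: near_quantile_gt.
rewrite -(ltr_pM2r (_ : 0 < (U (t k))^-1)) ?invr_gt0//.
apply: (@lt_trans _ _ m); near: k.
  exact: (cvgr_lt _ (cvg_quantile_seq z0)).
exact: (cvgr_gt _ (cvg_quantile_seq x0)).
Unshelve. all: by end_near. Qed.

(** After the quantile change of variable, the restriction to claims above [U (t / z)] becomes in
    the limit the restriction to [x < z], and the limit integral is the second form of
    [pareto_factorE]. *)
Lemma cvg_upper_laplace u z : 0 <= u -> 0 < z ->
  t k * upper_laplace X (u / U (t k)) (U (t k / z)) @[k --> \oo] -->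
    pareto_factor gamma u z.
Proof.
move=> u0 z0.
pose g k y := expR (- (u / U (t k)) * y) * (U (t k / z) <= y)%R%:R.
have mg k : measurable_fun setT (g k).
  apply: measurable_funM.
    by apply: (measurableT_comp (@measurable_expR R)); exact: measurable_funM.
  by apply: measurable_natr_bool; exact: measurable_fun_ler.
have g0 k y : 0 <= g k y by rewrite mulr_ge0 ?expR_ge0.
have uU0 k : 0 <= u / U (t k) by rewrite divr_ge0// (tail_quantile_ge0 Y_ge0 Y_cdf).
pose f x := expR (- u * x `^ (- gamma)) * (x < z)%R%:R.
have mf : measurable_fun setT f.
  apply: measurable_funM.
    by apply: (measurableT_comp (@measurable_expR R)); exact: measurable_funM.
  by apply: measurable_natr_bool; exact: measurable_fun_ltr.
have mz : measurable_fun setT (fun x : R => (x <= 2 * z)%R%:R : R).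
  by apply: measurable_natr_bool; exact: measurable_fun_ler.
have limE : (\int[lebesgue_measure]_(x in `]0%R, +oo[) (f x)%:E)%E =
    (pareto_factor gamma u z)%:E.
  have [rho /(_ u z u0 z0)[_ -> _]] := pareto_factorE alpha_gt0.
  rewrite integral_mkcond [RHS]integral_mkcond; apply: eq_integral => x _.
  rewrite !patchE !mem_setE !in_itv/= andbT /f.
  by case: (0 < x)%R => //=; case: (x < z)%R => /=; rewrite ?mulr1 ?mulr0.
have intE k : (\int[lebesgue_measure]_(x in `]0%R, +oo[) (at_quantile (t k) (g k) x)%:E)%E =
    (t k * upper_laplace X (u / U (t k)) (U (t k / z)))%:E.
  by rewrite integral_at_quantile// upper_laplaceE// -EFinM.
suff : (\int[lebesgue_measure]_(x in `]0%R, +oo[) (at_quantile (t k) (g k) x)%:E)%E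
    @[k --> \oo] --> (\int[lebesgue_measure]_(x in `]0%R, +oo[) (f x)%:E)%E.
  rewrite limE => /fine_cvg; rewrite (_ : _ \o _ = fun k =>
    t k * upper_laplace X (u / U (t k)) (U (t k / z)))//.
  by apply/funext => k /=; rewrite intE.
apply: (@dominated_cvg_near _ _ R lebesgue_measure _
  (fun k => at_quantile (t k) (g k)) f (fun x => (x <= 2 * z)%R%:R)) => //.
- by move=> k; apply: measurable_funTS; exact: measurable_at_quantile.
- by apply: measurable_funTS; exact: mf.
(* At [x = z] the indicator keeps the value 1 along the sequence whereas [f] vanishes; this point is
   the only exception. *)
- exists [set z]; split => //; first exact: lebesgue_measure_set1.
  move=> x /=; apply: contra_notP => /eqP xz; rewrite in_itv/= andbT => x0.
  have near_lt : \forall k \near \oo, x < t k by exact: near_gt_seq.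
  have [xltz|zltx|/eqP] := ltgtP x z; last by rewrite (negbTE xz).
    rewrite /f xltz mulr1.
    have : expR (- u * (U (t k / x) / U (t k))) @[k --> \oo] --> expR (- u * x `^ (- gamma)).
      apply: continuous_cvg; first exact: continuous_expR.
      by apply: cvgM; [exact: cvg_cst|exact: cvg_quantile_seq].
    apply: cvg_trans; apply: near_eq_cvg; near=> k.
    rewrite /at_quantile x0/= (_ : x < t k); last by near: k.
    rewrite /g (_ : U (t k / z) <= U (t k / x)); last first.
      by apply: ltW; near: k; exact: near_quantile_lt.
    by rewrite mulr1; congr expR; ring.
  rewrite /f ltNge (ltW zltx)/= mulr0.
  apply: (@cvg_trans _ (0 @[_ --> \oo])); last exact: cvg_cst.
  apply: near_eq_cvg; near=> k.
  rewrite /at_quantile x0/= (_ : x < t k); last by near: k.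
  rewrite /g leNgt (_ : U (t k / x) < U (t k / z)) ?mulr0//.
  by near: k; exact: near_quantile_lt.
- have z2 : 0 <= 2 * z by rewrite mulr_ge0// ltW.
  apply/integrableP; split.
    by apply/measurable_EFinP/measurable_funTS; exact: mz.
  rewrite (_ : integral _ _ _ = \int[lebesgue_measure]_(x in `]0%R, (2 * z)%R]) (cst 1 x))%E.
    rewrite (integral_cst lebesgue_measure _ 1%E)// mul1e.
    rewrite [X in (X < _)%E](lebesgue_measure_itv `]0, (2 * z)])/=.
    by case: ifP; rewrite -?EFinB ltry.
  rewrite integral_mkcond [RHS]integral_mkcond; apply: eq_integral => x _.
  rewrite !patchE !mem_setE !in_itv/= andbT.
  by case: (0 < x)%R => //=; case: (x <= 2 * z)%R => /=; rewrite ?normr1 ?normr0.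
- have z2 : z < 2 * z by lra.
  (* Domination must hold for all [x] at once: comparing [z] with [2 * z] gives one rank, and
     monotonicity of [U] extends the strict inequality to every [x > 2 * z]. *)
  near=> k => x /=; rewrite in_itv/= andbT => x0.
  rewrite ger0_norm ?at_quantile_ge0// /at_quantile x0/=.
  case: ifP => [xt|_]; last by rewrite ler0n.
  have [xz|xz] := leP x (2 * z).
    rewrite /g; apply: mulr_ile1; rewrite ?expR_ge0 ?ler0n ?lern1 ?leq_b1//.
    rewrite expR_le1 mulNr oppr_le0 mulr_ge0//.
    by rewrite (tail_quantile_ge0 Y_ge0 Y_cdf)// ltr_pdivlMr// mul1r.
  rewrite /g [U (t k / z) <= _]leNgt.
  suff -> : U (t k / x) < U (t k / z) by rewrite mulr0.
  apply: (@le_lt_trans _ _ (U (t k / (2 * z)))).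
    apply: (tail_quantile_mono Y_ge0 Y_cdf); first by rewrite ltr_pdivlMr// mul1r.
    by rewrite ler_pM2l// lef_pV2 ?posrE ?ltW// mulr_gt0.
  by near: k; exact: near_quantile_lt.
Unshelve. all: by end_near. Qed.

Hypothesis alpha_gt1 : 1 < alpha.

Lemma claim_mean_integrable : P.-integrable setT (EFin \o Y).
Proof.
apply/integrableP; split; first exact/measurable_EFinP.
rewrite (_ : integral _ _ _ = \int[P]_x (Y x)%:E)%E.
  exact: (claim_mean_lty Y_ge0 Y_cdf F_tail l_slow alpha_gt1).
by apply: eq_integral => x _ /=; rewrite ger0_norm.
Qed.

Lemma claim_meanE : (\int[P]_x (Y x)%:E)%E = (fine ('E_P[X 0%N])%E)%:E.
Proof.
rewrite unlock fineK//; exact: (integrable_fin_num measurableT claim_mean_integrable).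
Qed.

Let lower_defect c y : 0 <= c ->
  measurable_fun setT (fun x => (1 - expR (- c * Y x)) * (Y x <= y)%R%:R) /\
  forall x, 0 <= (1 - expR (- c * Y x)) * (Y x <= y)%R%:R <= 1.
Proof.
move=> c0; split.
  apply: measurable_funM.
    apply: measurable_funB => //; apply: (measurableT_comp (@measurable_expR R)).
    exact: measurable_funM.
  by apply: measurable_natr_bool; exact: measurable_fun_ler.
move=> x; have /andP[e0 e1] := expR_claim_bounds X_ge0 x c0.
by apply: mul_natr_bool_le1; rewrite subr_ge0 lerBlDr lerDl e0 e1.
Qed.

(** The constant 1 splits into the kept exponential, its defect on claims at most [y], and the
    indicator of claims above [y]. *)
Lemma one_minus_lower_laplace c y : 0 <= c -> 1 - lower_laplace X c y =
  \int[P]_x ((1 - expR (- c * Y x)) * (Y x <= y)%R%:R) + (1 - F y).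
Proof.
move=> c0.
have e01 x : 0 <= expR (- c * Y x) <= 1 := expR_claim_bounds X_ge0 x c0.
pose a x := (1 - expR (- c * Y x)) * (Y x <= y)%R%:R.
have mb : measurable_fun setT (fun x => (Y x <= y)%R%:R : R).
  by apply: measurable_natr_bool; exact: measurable_fun_ler.
have me : measurable_fun setT (fun x => expR (- c * Y x)).
  by apply: (measurableT_comp (@measurable_expR R)); exact: measurable_funM.
have [ma a01] := lower_defect y c0; rewrite -/a in ma a01.
have [aE _] := bounded_integral P ma a01.
pose b x : R := \1_(Y @^-1` `]y, +oo[) x.
have mY : measurable (Y @^-1` `]y, +oo[) by exact: measurable_funPTI.
have bE : (\int[P]_x (b x)%:E)%E = (1 - F y)%:E.
  by rewrite -(claim_gtE Y_cdf) integral_indic// setIT.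
have : (\int[P]_x (expR (- c * Y x) * (Y x <= y)%R%:R + (a x + b x))%:E = 1)%E.
  transitivity (\int[P]_x (cst 1%E x))%E; last first.
    by rewrite (integral_cst P measurableT 1%E) mul1e; exact: probability_setT.
  apply: eq_integral => x _; rewrite /a /b indicE /=; congr _%:E.
  have -> : (x \in Y @^-1` `]y, +oo[) = (y < Y x).
    by apply/idP/idP; rewrite inE/= in_itv/= andbT.
  by rewrite ltNge; case: (Y x <= y) => /=; ring.
have a0 x : (0 <= (a x)%:E)%E by rewrite lee_fin; case/andP: (a01 x).
have b0 x : (0 <= (b x)%:E)%E by rewrite lee_fin.
have ma' : measurable_fun setT (EFin \o a) by exact/measurable_EFinP.
have mb' : measurable_fun setT (EFin \o b).
  by apply/measurable_EFinP; exact: measurable_indic.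
have me' : measurable_fun setT (fun x => (expR (- c * Y x) * (Y x <= y)%R%:R)%:E).
  by apply/measurable_EFinP; exact: measurable_funM.
under eq_integral do rewrite EFinD EFinD.
rewrite ge0_integralD//; last 2 first.
- by move=> x _; exact: adde_ge0.
- exact: emeasurable_funD.
rewrite ge0_integralD//.
rewrite (lower_laplaceE X_ge0 _ c0) aE bE => -[h].
by rewrite -/a; lra.
Qed.

(** Exceedances contribute [z], the exponential defect contributes [w] times the mean. The defect
    multiplied by [t k] is at most [w * Y], integrable since [1 < alpha]. *)
Lemma cvg_lower_laplace w z : 0 <= w -> 0 < z ->
  t k * (1 - lower_laplace X (w / t k) (U (t k / z))) @[k --> \oo] -->
    z + w * fine ('E_P[X 0%N])%E.
Proof.
move=> w0 z0.
have c0 k : 0 <= w / t k by rewrite divr_ge0// ltW.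
(* [t k] is written as [z] times [t k / z] to use the tail at a quantile along the sequence
   [t k / z]. *)
rewrite (_ : (fun k => _) = (fun k => z * (t k / z * (1 - F (U (t k / z)))) +
    t k * \int[P]_x ((1 - expR (- (w / t k) * Y x)) * (Y x <= U (t k / z))%R%:R))); last first.
  apply/funext => k; rewrite one_minus_lower_laplace// mulrDr addrC; congr (_ + _).
  by field; rewrite gt_eqF.
apply: cvgD.
  rewrite -[X in _ --> X]mulr1; apply: cvgM; first exact: cvg_cst.
  exact: cvg_comp (cvg_div_seq z0)
    (cvg_tail_tail_quantile Y_ge0 Y_cdf F_tail l_slow alpha_gt0).
pose f k x := t k * ((1 - expR (- (w / t k) * Y x)) * (Y x <= U (t k / z))%R%:R).
have mf k : measurable_fun setT (f k).
  by apply: measurable_funM => //; exact: (lower_defect _ (c0 k)).1.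
have fE k : (\int[P]_x (f k x)%:E)%E = (t k *
    \int[P]_x ((1 - expR (- (w / t k) * Y x)) * (Y x <= U (t k / z))%R%:R))%:E.
  have [ma a01] := lower_defect (U (t k / z)) (c0 k).
  rewrite [RHS]EFinM; have [<- _] := bounded_integral P ma a01.
  rewrite -ge0_integralZl//.
  - exact/measurable_EFinP.
  - by move=> x _; rewrite lee_fin; case/andP: (a01 x).
  - by rewrite lee_fin ltW.
have limE : (\int[P]_x (w * Y x)%:E = (w * fine ('E_P[X 0%N])%E)%:E)%E.
  have mY : measurable_fun setT (EFin \o Y) by exact/measurable_EFinP.
  rewrite [RHS]EFinM -claim_meanE -ge0_integralZl//.
  by move=> x _; rewrite lee_fin.
suff : (\int[P]_x (f k x)%:E)%E @[k --> \oo] --> (\int[P]_x (w * Y x)%:E)%E.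
  rewrite limE => /fine_cvg; rewrite (_ : _ \o _ = fun k => t k *
    \int[P]_x ((1 - expR (- (w / t k) * Y x)) * (Y x <= U (t k / z))%R%:R))//.
  by apply/funext => k /=; rewrite fE.
apply: (@dominated_cvg_near _ _ R P _ f (fun x => w * Y x) (fun x => w * Y x)) => //.
- exact: measurable_funM.
- apply: aeW => x _.
  have wY : 0 <= w * Y x by rewrite mulr_ge0.
  have : t k * (1 - expR (- (w * Y x / t k))) @[k --> \oo] --> w * Y x.
    exact: cvg_mul_1BexpR.
  apply: cvg_trans; apply: near_eq_cvg; near=> k.
  rewrite /f (_ : Y x <= _) ?mulr1; last first.
    apply: ltW; near: k.
    have h : U (t k / z) @[k --> \oo] --> +oo.
      exact: cvg_comp (cvg_div_seq z0) (tail_quantile_cvgy Y_ge0 Y_cdf F_tail l_slow).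
    exact: near_gt_seq h (Y x).
  by rewrite mulNr mulrAC.
- have := integrableZl measurableT w claim_mean_integrable.
  by apply: eq_integrable.
- near=> k => x _.
  have wY : 0 <= w / t k * Y x by rewrite mulr_ge0.
  have e1 : expR (- (w / t k) * Y x) <= 1 by rewrite expR_le1 mulNr oppr_le0.
  rewrite ger0_norm; last by rewrite !mulr_ge0 ?(ltW (t_gt0 _))// subr_ge0.
  rewrite /f; apply: (@le_trans _ _ (t k * (1 - expR (- (w / t k) * Y x)))).
    rewrite ler_pM2l// ler_piMr ?subr_ge0//.
    by rewrite lern1 leq_b1.
  rewrite -ler_pdivlMl// mulrA [_^-1 * _]mulrC lerBlDr -lerBlDl mulNr.
  exact: expR_ge1Dx.
Unshelve. all: by end_near. Qed.

End along_sequence.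
End claim_transforms.

(** * Dominated convergence for the weighted transform *)

Section core_limit.
Context (R : realType) d (T : measurableType d) (P : probability T R)
  (X : nat -> {RV P >-> R}) (F : R -> R) (alpha : R) (l : R -> R) (s : nat).
Hypothesis X_ge0 : forall i x, 0 <= X i x.
Hypothesis X_cdf : forall i (y : R), cdf (X i) y = (F y)%:E.
Hypothesis F_tail : forall y : R, 0 < y -> 1 - F y = y `^ (- alpha) * l y.
Hypothesis l_slow : slowly_varying l.
Hypothesis alpha_gt1 : 1 < alpha.
Local Notation U := (tail_quantile F).
Local Notation gamma := (alpha^-1).
Local Notation mean := (fine ('E_P[X 0%N])%E).

Let Y := X 0%N.
Let Y_ge0 x : 0 <= Y x := X_ge0 0%N x.
Let Y_cdf y : cdf Y y = (F y)%:E := X_cdf 0%N y.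
Let alpha_gt0 : 0 < alpha := lt_trans ltr01 alpha_gt1.

Lemma upper_laplace_le a y : 0 <= a ->
  ((upper_laplace X a y)%:E <= P (Y @^-1` `[y, +oo[))%E.
Proof.
move=> a0; rewrite -upper_laplaceE//.
have mY : measurable (Y @^-1` `[y, +oo[) by exact: measurable_funPTI.
rewrite -[leRHS](_ : (\int[P]_x (\1_(Y @^-1` `[y, +oo[) x)%:E)%E = _); last first.
  by rewrite integral_indic// setIT.
apply: ge0_le_integral => //.
- apply/measurable_EFinP; apply: measurable_funM.
    by apply: (measurableT_comp (@measurable_expR R)); exact: measurable_funM.
  by apply: measurable_natr_bool; exact: measurable_fun_ler.
- by apply/measurable_EFinP; exact: measurable_indic.
move=> x _; rewrite lee_fin indicE.
have -> : (x \in Y @^-1` `[y, +oo[) = (y <= Y x).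
  by apply/idP/idP; rewrite inE/= in_itv/= andbT.
rewrite -[leRHS]mul1r ler_wpM2r//.
by case/andP: (expR_claim_bounds X_ge0 x a0).
Qed.

Lemma lower_laplace_le c y : 0 <= c -> lower_laplace X c y <= expR (- (1 - F y)).
Proof.
move=> c0; have h := one_minus_lower_laplace X_ge0 X_cdf y c0.
have A0 : 0 <= \int[P]_x ((1 - expR (- c * X 0%N x)) * (X 0%N x <= y)%R%:R).
  apply: Rintegral_ge0 => x _; rewrite mulr_ge0// subr_ge0.
  by case/andP: (expR_claim_bounds X_ge0 x c0).
apply: le_trans (expR_ge1Dx _); move: h; lra.
Qed.

Section along_sequence.
Variables (t : nat -> R) (n : nat -> nat) (theta : R).
Hypothesis t_cvg : t k @[k --> \oo] --> +oo.
Hypothesis t_gt1 : forall k, 1 < t k.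
Hypothesis n_cvg : (n k)%:R / t k @[k --> \oo] --> theta.
Hypothesis theta_gt0 : 0 < theta.
Variables u v w : R.
Hypotheses (u0 : 0 <= u) (v0 : 0 <= v) (w0 : 0 <= w).

Let t_gt0 k : 0 < t k.
Proof. exact: lt_trans ltr01 (t_gt1 k). Qed.

Let g k y := expR (- (v / U (t k)) * y) * upper_laplace X (u / U (t k)) y ^+ s *
  lower_laplace X (w / t k) y ^+ ((n k).-1 - s).

Let U_ge0 k : 0 <= U (t k).
Proof. exact: (tail_quantile_ge0 Y_ge0 Y_cdf). Qed.

Let upper_ge0 k y : 0 <= upper_laplace X (u / U (t k)) y.
Proof.
have /andP[] := upper_laplace_bounds X_ge0 y (divr_ge0 u0 (U_ge0 k)) => //.
Qed.

Let lower_bounds k y : 0 <= lower_laplace X (w / t k) y <= 1.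
Proof. exact: (lower_laplace_bounds X_ge0 y (divr_ge0 w0 (ltW (t_gt0 k)))). Qed.

Let g_ge0 k y : 0 <= g k y.
Proof.
have /andP[c0 _] := lower_bounds k y.
by rewrite !mulr_ge0 ?expR_ge0 ?exprn_ge0.
Qed.

Let measurable_g k : measurable_fun setT (g k).
Proof.
apply: measurable_funM; first apply: measurable_funM.
- by apply: (measurableT_comp (@measurable_expR R)); exact: measurable_funM.
- apply: measurable_funX; apply: measurable_upper_laplace => //.
  by rewrite divr_ge0.
- apply: measurable_funX; apply: measurable_lower_laplace => //.
  by rewrite divr_ge0// ltW.
Qed.

Let f k z := (n k * 'C((n k).-1, s))%:R / t k * at_quantile F (t k) (g k) z.

Let f_ge0 k z : 0 <= f k z.
Proof. by rewrite mulr_ge0 ?at_quantile_ge0// divr_ge0// ltW. Qed.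

Let measurable_f k : measurable_fun setT (f k).
Proof. by apply: measurable_funM => //; exact: (measurable_at_quantile X_ge0 X_cdf). Qed.

Let integral_f k : (\int[lebesgue_measure]_(z in `]0%R, +oo[) (f k z)%:E =
  (n k * 'C((n k).-1, s))%:R%:E *  \int[P]_x (g k (X 0%N x))%:E)%E.
Proof.
rewrite /f; under eq_integral do rewrite EFinM.
rewrite ge0_integralZl//; last 3 first.
- apply/measurable_EFinP; apply: measurable_funTS.
  exact: (measurable_at_quantile X_ge0 X_cdf).
- by move=> z _; rewrite lee_fin at_quantile_ge0.
- by rewrite lee_fin divr_ge0// ltW.
rewrite (integral_at_quantile X_ge0 X_cdf)// muleA -EFinM.
by rewrite divfK// gt_eqF.
Qed.

(** The power [t k ^ (s + 1)] that normalizes the coefficient is shared out: one factor comes from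
    the change of variable, the other [s] are absorbed by the upper transforms. *)
Let f_scaled k z : 0 < z < t k -> f k z = (n k * 'C((n k).-1, s))%:R / t k ^+ s.+1 *
  ((t k * upper_laplace X (u / U (t k)) (U (t k / z))) ^+ s *
   expR (- v * (U (t k / z) / U (t k))) *
   lower_laplace X (w / t k) (U (t k / z)) ^+ (n k - s.+1)).
Proof.
move=> zt; rewrite /f /at_quantile zt /g exprMn subnS predn_sub exprS invfM.
have -> : - (v / U (t k)) * U (t k / z) = - v * (U (t k / z) / U (t k)) by ring.
have ts0 : t k ^+ s != 0 by rewrite expf_neq0// gt_eqF.
by move: (expR _) (_ ^+ (_ - _)) => e c; field; rewrite ts0 gt_eqF.
Qed.

Let cvg_f z : 0 < z -> f k z @[k --> \oo] --> limit_kernel alpha s mean u v w theta z.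
Proof.
move=> z0.
have : (n k * 'C((n k).-1, s))%:R / t k ^+ s.+1 *
    ((t k * upper_laplace X (u / U (t k)) (U (t k / z))) ^+ s *
     expR (- v * (U (t k / z) / U (t k))) *
     lower_laplace X (w / t k) (U (t k / z)) ^+ (n k - s.+1)) @[k --> \oo] -->
    theta ^+ s.+1 / s`!%:R * (pareto_factor gamma u z ^+ s * expR (- v * z `^ (- gamma)) *
      expR (- (z + w * mean) * theta)).
  rewrite [- (z + _) * theta]mulNr [(z + _) * theta]mulrC.
  apply: cvgM; first exact: cvg_top_coefficient.
  apply: cvgM; first apply: cvgM.
  - have up_cvg : t k * upper_laplace X (u / U (t k)) (U (t k / z)) @[k --> \oo] -->
        pareto_factor gamma u z.
      exact: (cvg_upper_laplace X_ge0 X_cdf F_tail l_slow).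
    exact: (cvg_comp _ _ up_cvg (@exprn_continuous R s _)).
  - apply: continuous_cvg; first exact: continuous_expR.
    apply: cvgM; first exact: cvg_cst.
    exact: (cvg_quantile_seq X_ge0 X_cdf F_tail l_slow).
  - apply: (cvg_exprn_1B t_cvg) => //; first exact: cvg_natrB_div.
    exact: (cvg_lower_laplace X_ge0 X_cdf F_tail l_slow).
rewrite /limit_kernel max_l ?(ltW theta_gt0)//.
apply: cvg_trans; apply: near_eq_cvg; near=> k.
by rewrite f_scaled// z0/=; near: k; exact: near_gt_seq.
Unshelve. all: by end_near. Qed.

Let gamma_density (b z : R) : R := b * expR (- (b * z)) * (b * z) ^+ s / s`!%:R.

(** Eventually [n - s - 1 >= theta * t / 2], and the tail at [U (t / z)] is at least [c0 * z / t],
    so the lower power is at most [expR (- b z)] with [b = theta / 2 * c0]. The upper power is at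
    most [(C0 z) ^ s] and the coefficient at most [A]. [K] rescales the Gamma density of rate [b] to
    the product of these bounds. They hold for all [z < t] because [quantile_tail_bounds] covers
    every [t / z > 1]. *)
Let dominated_f : exists b K : R, 0 < b /\
  \forall k \near \oo, forall z, 0 < z -> f k z <= K * gamma_density b z.
Proof.
have [c0 c00 [C0 C00 bounds]] := quantile_tail_bounds Y_ge0 Y_cdf F_tail l_slow alpha_gt0.
pose b := theta / 2 * c0; have b0 : 0 < b by rewrite mulr_gt0// divr_gt0.
pose A := theta ^+ s.+1 / s`!%:R + 1.
exists b, (A * C0 ^+ s * s`!%:R / b ^+ s.+1); split => //.
have A_lt : \forall k \near \oo, (n k * 'C((n k).-1, s))%:R / t k ^+ s.+1 < A.
  have A_cvg : (n k * 'C((n k).-1, s))%:R / t k ^+ s.+1 @[k --> \oo] -->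
      theta ^+ s.+1 / s`!%:R by exact: cvg_top_coefficient.
  by apply: (cvgr_lt _ A_cvg); rewrite /A ltrDl.
have m_gt : \forall k \near \oo, theta / 2 < (n k - s.+1)%:R / t k.
  have m_cvg : (n k - s.+1)%:R / t k @[k --> \oo] --> theta by exact: cvg_natrB_div.
  by apply: (cvgr_gt _ m_cvg); rewrite ltr_pdivrMr// ltr_pMr// ltr1n.
near=> k => z z0.
have f0 : 0 < s`!%:R :> R by rewrite ltr0n fact_gt0.
have densityE a (c e : R) : 0 < c -> a * C0 ^+ s * s`!%:R / c ^+ s.+1 *
    (c * e * (c * z) ^+ s / s`!%:R) = a * ((C0 * z) ^+ s * 1 * e).
  move=> c_gt0; rewrite !exprMn exprS; field.
  by rewrite !gt_eqF ?exprn_gt0.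
rewrite /gamma_density densityE//.
have rhs0 : 0 <= A * ((C0 * z) ^+ s * 1 * expR (- (b * z))).
  by rewrite !mulr_ge0 ?expR_ge0 ?exprn_ge0 ?mulr_ge0 ?ltW// /A addr_gt0// divr_gt0// exprn_gt0.
have [zt|zt] := ltP z (t k); last first.
  by rewrite /f /at_quantile z0 ltNge zt/= mulr0.
rewrite f_scaled ?z0//.
have tz1 : 1 < t k / z by rewrite ltr_pdivlMr// mul1r.
have [tail_ge up_le] := bounds _ tz1.
have /andP[l0 l1] := lower_bounds k (U (t k / z)).
have up : t k * upper_laplace X (u / U (t k)) (U (t k / z)) <= C0 * z.
  rewrite -ler_pdivrMr// mulrAC -lee_fin; apply: le_trans up_le.
  rewrite EFinM lee_wpmul2l//; first by rewrite lee_fin divr_ge0// ltW.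
  by apply: upper_laplace_le; rewrite divr_ge0.
apply: ler_pM.
- by rewrite divr_ge0// exprn_ge0// ltW.
- by rewrite !mulr_ge0 ?expR_ge0 ?exprn_ge0// mulr_ge0// ltW.
- by apply: ltW; near: k.
apply: ler_pM.
- by rewrite mulr_ge0 ?expR_ge0 ?exprn_ge0// mulr_ge0// ltW.
- exact: exprn_ge0.
- apply: ler_pM; rewrite ?expR_ge0 ?exprn_ge0//.
  + by rewrite mulr_ge0// ltW.
  + by apply: lerXn2r; rewrite ?nnegrE// mulr_ge0// ltW.
  + rewrite expR_le1 mulNr oppr_le0 mulr_ge0// divr_ge0//.
    exact: (tail_quantile_ge0 Y_ge0 Y_cdf).
have lexp : lower_laplace X (w / t k) (U (t k / z)) <= expR (- (1 - F (U (t k / z)))).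
  by apply: lower_laplace_le; rewrite divr_ge0// ltW.
apply: (@le_trans _ _ (expR (- (1 - F (U (t k / z)))) ^+ (n k - s.+1))).
  by apply: lerXn2r; rewrite ?nnegrE ?expR_ge0.
rewrite -expRM_natl ler_expR mulrN lerN2.
have m_ge : theta / 2 * t k <= (n k - s.+1)%:R.
  by rewrite -ler_pdivlMr//; apply: ltW; near: k.
have tail_ge' : c0 * z / t k <= 1 - F (U (t k / z)).
  rewrite ler_pdivrMr// -ler_pdivlMr//; apply: le_trans tail_ge _.
  by rewrite le_eqVlt; apply/orP; left; apply/eqP; ring.
apply: (@le_trans _ _ (theta / 2 * t k * (c0 * z / t k))).
  by rewrite /b le_eqVlt; apply/orP; left; apply/eqP; field; rewrite gt_eqF.
apply: ler_pM => //.
- by rewrite mulr_ge0 ?divr_ge0// ltW.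
- by rewrite divr_ge0 ?mulr_ge0// ltW.
Unshelve. all: by end_near. Qed.

Lemma cvg_weighted_laplace :
  ((n k * 'C((n k).-1, s))%:R%:E * \int[P]_x (g k (X 0%N x))%:E)%E @[k --> \oo] -->
  limit_transform alpha s mean u v w theta.
Proof.
have [b [K [b0 dom]]] := dominated_f.
have mdens : measurable_fun setT (gamma_density b).
  apply: measurable_funM => //; apply: measurable_funM; last first.
    by apply: measurable_funX; exact: measurable_funM.
  apply: measurable_funM => //; apply: (measurableT_comp (@measurable_expR R)).
  by apply: measurableT_comp => //; exact: measurable_funM.
have dens0 z : 0 < z -> 0 <= gamma_density b z.
  move=> z0; rewrite /gamma_density.
  by rewrite !mulr_ge0 ?expR_ge0 ?exprn_ge0 ?invr_ge0 ?mulr_ge0// ltW.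
have idens : lebesgue_measure.-integrable `]0%R, +oo[ (EFin \o gamma_density b).
  apply/integrableP; split.
    by apply/measurable_EFinP/measurable_funTS; exact: mdens.
  rewrite (_ : integral _ _ _ = 1%E) ?ltry// -(integral_gamma b0 s).
  apply: eq_integral => z; rewrite inE/= in_itv/= andbT => z0.
  by rewrite ger0_norm// dens0.
have mker : measurable_fun (`]0, +oo[%classic : set R)
    (limit_kernel alpha s mean u v w theta) by exact: measurable_limit_kernel.
rewrite (_ : (fun k => _) = fun k =>
    (\int[lebesgue_measure]_(z in `]0%R, +oo[) (f k z)%:E)%E); last first.
  by apply/funext => k; rewrite integral_f.
apply: (@dominated_cvg_near _ _ R lebesgue_measure _ f
  (limit_kernel alpha s mean u v w theta) (fun z => K * gamma_density b z)) => //.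
- by move=> k; apply: measurable_funTS; exact: measurable_f.
- by apply: aeW => z; rewrite /= in_itv/= andbT; exact: cvg_f.
- have := integrableZl _ K idens; apply => //.
- apply: filterS dom => k fk z /=; rewrite in_itv/= andbT => z0.
  by rewrite ger0_norm ?f_ge0//; exact: fk.
Qed.

End along_sequence.
End core_limit.

(** * Mass of the limit and removal of the weight due to ties *)

Section limit_transform_bounds.
Context (R : realType) (alpha mean theta : R) (s : nat).
Hypotheses (alpha_gt0 : 0 < alpha) (mean_ge0 : 0 <= mean) (theta_gt0 : 0 < theta).

Let gamma_density (z : R) : R := theta * expR (- (theta * z)) * (theta * z) ^+ s / s`!%:R.

Lemma pareto_factor0 z : 0 < z -> pareto_factor alpha^-1 0 z = z.
Proof.
move=> z0; have [rho /(_ 0 z (lexx _) z0)[E _ _]] := pareto_factorE alpha_gt0.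
apply: EFin_inj; rewrite E -[RHS]mule1; congr (_ * _)%E.
transitivity (\int[rho]_x (cst 1%E x))%E; last first.
  by rewrite (integral_cst rho measurableT 1%E) mul1e; exact: probability_setT.
by apply: eq_integral => x _; rewrite !(mul0r, oppr0) expR0.
Qed.

(** With zero arguments the kernel is a Gamma density. This is what shows that ties are negligible:
    it gives the limit of the expected number of choices. *)
Lemma limit_transform0 : limit_transform alpha s mean 0 0 0 theta = 1%E.
Proof.
rewrite -(integral_gamma theta_gt0 s); apply: eq_integral => z.
rewrite inE/= in_itv/= andbT => z0; congr _%:E.
rewrite /limit_kernel pareto_factor0// max_l ?(ltW theta_gt0)//.
rewrite oppr0 !mul0r addr0 expR0 mulr1 exprMn exprS mulNr [z * theta]mulrC.
by move: (s`!%:R^-1 : R) => i; ring.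
Qed.

Lemma limit_transform_bounds u v w : 0 <= u -> 0 <= v -> 0 <= w ->
  (0 <= limit_transform alpha s mean u v w theta <= 1)%E.
Proof.
move=> u0 v0 w0; apply/andP; split.
  apply: integral_ge0 => z; rewrite /= in_itv/= andbT => z0.
  by rewrite lee_fin limit_kernel_ge0.
rewrite -limit_transform0; apply: ge0_le_integral => //.
- by move=> z; rewrite /= in_itv/= andbT => z0; rewrite lee_fin limit_kernel_ge0.
- by apply/measurable_EFinP; exact: measurable_limit_kernel.
- by apply/measurable_EFinP; exact: measurable_limit_kernel.
move=> z; rewrite /= in_itv/= andbT => z0; rewrite lee_fin /limit_kernel.
have /andP[p0 pz] := pareto_factor_bounds alpha_gt0 u0 z0.
rewrite ler_wpM2l//.
  by rewrite divr_ge0// exprn_ge0// le_max lexx orbT.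
apply: ler_pM; rewrite ?mulr_ge0 ?expR_ge0 ?exprn_ge0//.
  apply: ler_pM; rewrite ?expR_ge0 ?exprn_ge0//.
    by apply: lerXn2r; rewrite ?nnegrE ?pareto_factor0// ltW.
  by rewrite ler_expR !mulNr lerN2 mul0r mulr_ge0// powR_ge0.
rewrite ler_expR ler_wpM2r ?(ltW theta_gt0)// lerN2 mul0r addr0 lerDl.
exact: mulr_ge0.
Qed.

End limit_transform_bounds.

(** [S k] lies between [V k - (V0 k - 1)] and [V k], and the excess mass [V0 k - 1] vanishes. *)
Lemma cvg_defect_squeeze (R : realType) (V V0 : nat -> \bar R) (S : nat -> R) (h : R) :
  V k @[k --> \oo] --> h%:E -> V0 k @[k --> \oo] --> 1%E ->
  (\forall k \near \oo, (S k)%:E <= V k /\ V k + 1 <= (S k)%:E + V0 k)%E ->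
  S k @[k --> \oo] --> h.
Proof.
move=> /fine_cvgP[Vfin V_lim] /fine_cvgP[V0fin V0_lim] VS.
apply: (@squeeze_cvgr _ _ _ _ (fun k => fine (V k) + 1 - fine (V0 k)) (fun k => fine (V k))).
- near=> k.
  have : V k \is a fin_num by near: k.
  have : V0 k \is a fin_num by near: k.
  have : ((S k)%:E <= V k /\ V k + 1 <= (S k)%:E + V0 k)%E by near: k.
  case: (V k) (V0 k) => [a||]// [b||]//; rewrite -!EFinD !lee_fin /= => -[h1 h2] _ _.
  by rewrite h1 andbT lerBlDr.
- rewrite -[X in _ --> X](addrK 1); apply: cvgB => //.
  by apply: cvgD => //; exact: cvg_cst.
- exact: V_lim.
Unshelve. all: by end_near. Qed.

Section statistics_laplace.
Context (R : realType) d (T : measurableType d) (P : probability T R)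
  (X : nat -> {RV P >-> R}) (F : R -> R) (s : nat).
Hypothesis X_indep : mutually_independent X.
Hypothesis X_ge0 : forall i x, 0 <= X i x.
Hypothesis X_cdf : forall i (y : R), cdf (X i) y = (F y)%:E.

Definition stat_kernel (n : nat) (a b c : R) (x : T) : R :=
  expR (- a * (\sum_((n - s).+1 <= k < n.+1) order_stat X n k x) -
        b * order_stat X n (n - s) x -
        c * \sum_(1 <= k < n - s) order_stat X n k x).

Definition stat_laplace n a b c : R := \int[P]_x stat_kernel n a b c x.

Lemma order_stat_ge0 n k x : 0 <= order_stat X n k x.
Proof.
case: k => [//|k] /=; set l := sort _ _.
have [kl|kl] := ltnP k (size l); last by rewrite nth_default.
have : nth 0 l k \in l by exact: mem_nth.
by rewrite mem_sort => /mapP[i _ ->].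
Qed.

Lemma measurable_stat_kernel n a b c : measurable_fun setT (stat_kernel n a b c).
Proof.
pose g (x y z : R) := expR (- a * x - b * y - c * z).
apply: (@measurable_order_stat_functional R d T (fun i => X i) s _ n g) => //.
move=> f1 f2 f3 m1 m2 m3; apply: (measurableT_comp (@measurable_expR R)).
by apply: measurable_funB; first apply: measurable_funB; exact: measurable_funM.
Qed.

Lemma stat_kernel_bounds n a b c x : 0 <= a -> 0 <= b -> 0 <= c ->
  0 <= stat_kernel n a b c x <= 1.
Proof.
move=> a0 b0 c0; rewrite expR_ge0/= expR_le1 mulNr -!opprD oppr_le0.
by rewrite !addr_ge0 ?mulr_ge0 ?order_stat_ge0//; apply: sumr_ge0 => i _; exact: order_stat_ge0.
Qed.

Lemma stat_laplaceE n a b c : 0 <= a -> 0 <= b -> 0 <= c ->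
  (\int[P]_x (stat_kernel n a b c x)%:E)%E = (stat_laplace n a b c)%:E /\
  0 <= stat_laplace n a b c <= 1.
Proof.
move=> a0 b0 c0; have [] := bounded_integral P (measurable_stat_kernel n a b c) => //.
by move=> x; exact: stat_kernel_bounds.
Qed.

Definition weighted_laplace n a b c : \bar R :=
  ((n * 'C(n.-1, s))%:R%:E *
  \int[P]_x (expR (- b * X 0%N x) * upper_laplace X a (X 0%N x) ^+ s *
     lower_laplace X c (X 0%N x) ^+ (n.-1 - s))%:E)%E.

Let weighted_laplaceE n a b c : 0 <= a -> 0 <= b -> 0 <= c ->
  weighted_laplace n a b c = (\int[P]_x (top_count X s n x * stat_kernel n a b c x)%:E)%E.
Proof. by move=> a0 b0 c0; rewrite (integral_top_count X_indep X_ge0 X_cdf). Qed.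

(* [top_count] counts the ways to choose the large claims and the threshold;
   it is 1 unless there are ties, so the weighted and the plain transforms
   differ by at most the expected number of superfluous choices. *)
Lemma stat_laplace_squeeze n a b c : (s < n)%N -> 0 <= a -> 0 <= b -> 0 <= c ->
  ((stat_laplace n a b c)%:E <= weighted_laplace n a b c /\
   weighted_laplace n a b c + 1 <=
     (stat_laplace n a b c)%:E + weighted_laplace n 0 0 0)%E.
Proof.
move=> sn a0 b0 c0; rewrite !weighted_laplaceE//.
have [<- _] := stat_laplaceE n a0 b0 c0.
have mk a' b' c' : measurable_fun setT (fun x => (stat_kernel n a' b' c' x)%:E).
  by apply/measurable_EFinP; exact: measurable_stat_kernel.
have mtk a' b' c' : measurable_fun setT (fun x =>
    (top_count X s n x * stat_kernel n a' b' c' x)%:E).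
  apply/measurable_EFinP; apply: measurable_funM; last exact: measurable_stat_kernel.
  exact: measurable_top_count.
have k01 x := stat_kernel_bounds n x a0 b0 c0.
have k0E x : stat_kernel n 0 0 0 x = 1.
  by rewrite /stat_kernel oppr0 !mul0r !subr0 expR0.
have tc1 x : 1 <= top_count X s n x by exact: top_count_ge1.
have tk0 x : (0 <= (top_count X s n x * stat_kernel n a b c x)%:E)%E.
  by rewrite lee_fin mulr_ge0// ?(le_trans ler01 (tc1 x))//; case/andP: (k01 x).
split.
  apply: ge0_le_integral => // x _; rewrite lee_fin.
    by case/andP: (k01 x).
  by rewrite ler_peMl//; case/andP: (k01 x).
have P1 : (\int[P]_x 1 = 1)%E.
  by rewrite (integral_cst P measurableT 1%E) mul1e; exact: probability_setT.
have k0 x : (0 <= (stat_kernel n a b c x)%:E)%E by rewrite lee_fin; case/andP: (k01 x).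
have t0 x : (0 <= (top_count X s n x * stat_kernel n 0 0 0 x)%:E)%E.
  by rewrite k0E mulr1 lee_fin (le_trans ler01).
rewrite -[X in (_ + X <= _)%E]P1 -!ge0_integralD//.
apply: ge0_le_integral => //.
- by move=> x _; rewrite adde_ge0.
- exact: emeasurable_funD.
- exact: emeasurable_funD.
- move=> x _; rewrite k0E mulr1 -!EFinD lee_fin.
  (* Rearranged, this is [(top_count - 1) * (1 - kernel) >= 0]. *)
  have /andP[? ?] := k01 x; have := tc1 x; nra.
Qed.

Section limit.
Context (alpha : R) (l : R -> R).
Hypothesis F_tail : forall y : R, 0 < y -> 1 - F y = y `^ (- alpha) * l y.
Hypothesis l_slow : slowly_varying l.
Hypothesis alpha_gt1 : 1 < alpha.
Local Notation U := (tail_quantile F).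
Local Notation mean := (fine ('E_P[X 0%N])%E).

Lemma claim_mean_ge0 : 0 <= mean.
Proof. by rewrite unlock; apply: fine_ge0; apply: integral_ge0 => x _; rewrite lee_fin. Qed.

Lemma cvg_stat_laplace (t : nat -> R) (n : nat -> nat) (theta u v w : R) :
  t k @[k --> \oo] --> +oo -> (n k)%:R / t k @[k --> \oo] --> theta -> 0 < theta ->
  0 <= u -> 0 <= v -> 0 <= w ->
  stat_laplace (n k) (u / U (t k)) (v / U (t k)) (w / t k) @[k --> \oo] -->
    fine (limit_transform alpha s mean u v w theta).
Proof.
move=> t_cvg n_cvg theta0 u0 v0 w0.
have alpha_gt0 : 0 < alpha := lt_trans ltr01 alpha_gt1.
(* Dropping the first [M] terms makes [t' k > 1] for all [k], the range where [U] is controlled. *)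
have [M _ tM] := near_gt_seq t_cvg 1.
pose t' k := t (k + M)%N; pose n' k := n (k + M)%N.
have t_cvg' : t' k @[k --> \oo] --> +oo by rewrite (cvg_shiftn M).
have n_cvg' : (n' k)%:R / t' k @[k --> \oo] --> theta.
  by move: n_cvg; rewrite -(cvg_shiftn M).
have t_gt1 k : 1 < t' k by apply: tM => /=; exact: leq_addl.
have t_gt0 k : 0 < t' k by exact: lt_trans ltr01 (t_gt1 k).
have U_ge0 k : 0 <= U (t' k) by exact: (tail_quantile_ge0 (X_ge0 0%N) (X_cdf 0%N)).
have V_cvg u' v' w' : 0 <= u' -> 0 <= v' -> 0 <= w' ->
    weighted_laplace (n' k) (u' / U (t' k)) (v' / U (t' k)) (w' / t' k) @[k --> \oo] -->
    limit_transform alpha s mean u' v' w' theta.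
  move=> u'0 v'0 w'0.
  exact: (cvg_weighted_laplace X_ge0 X_cdf F_tail l_slow).
have finH : limit_transform alpha s mean u v w theta \is a fin_num.
  have /andP[h0 h1] := limit_transform_bounds s alpha_gt0 claim_mean_ge0 theta0 u0 v0 w0.
  by rewrite ge0_fin_numE// (le_lt_trans h1)// ltry.
pose S k := stat_laplace (n' k) (u / U (t' k)) (v / U (t' k)) (w / t' k).
pose V k := weighted_laplace (n' k) (u / U (t' k)) (v / U (t' k)) (w / t' k).
pose V0 k := weighted_laplace (n' k) 0 0 0.
have V_lim : V k @[k --> \oo] --> limit_transform alpha s mean u v w theta by exact: V_cvg.
have V0_lim : V0 k @[k --> \oo] --> 1%E.
  rewrite -(limit_transform0 mean s alpha_gt0 theta0).
  have div0 (x : R) : 0 / x = 0 by exact: mul0r.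
  have V0E : (fun k => weighted_laplace (n' k) (0 / U (t' k)) (0 / U (t' k)) (0 / t' k)) = V0.
    by apply/funext => k; rewrite (div0 (U (t' k))) (div0 (t' k)).
  by rewrite -V0E; exact: V_cvg.
rewrite -[X in _ --> X](fineK finH) in V_lim.
have S_lim : S k @[k --> \oo] --> fine (limit_transform alpha s mean u v w theta).
  apply: (cvg_defect_squeeze V_lim V0_lim).
  have n_gt := near_gt_index t_cvg' n_cvg' theta0 s.
  apply: filterS n_gt => k sn.
  have a0 : 0 <= u / U (t' k) by exact: divr_ge0.
  have b0 : 0 <= v / U (t' k) by exact: divr_ge0.
  have c0 : 0 <= w / t' k by rewrite divr_ge0// ltW.
  have h := stat_laplace_squeeze sn a0 b0 c0.
  exact h.
have E := cvg_shiftn M (fun k => stat_laplace (n k) (u / U (t k)) (v / U (t k)) (w / t k))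
  (nbhs (fine (limit_transform alpha s mean u v w theta))).
exact: (eq_ind _ (fun Q : Prop => Q) S_lim _ E).
Unshelve. all: by end_near. Qed.

End limit.

End statistics_laplace.

(** * Bernstein polynomials and the continuity theorem *)

Section bernstein.
Context (R : realType).

(* The expectation of [g] at a binomial variable of parameters [n] and [p],
   i.e. the Bernstein polynomial of degree [n]. *)
Fixpoint binomial_mean (n : nat) (p : R) (g : nat -> R) : R :=
  if n is n'.+1 then
    p * binomial_mean n' p (fun i => g i.+1) + (1 - p) * binomial_mean n' p g
  else g 0%N.

Lemma binomial_mean_le n p g h : 0 <= p <= 1 ->
  (forall i, (i <= n)%N -> g i <= h i) -> binomial_mean n p g <= binomial_mean n p h.
Proof.
move=> /andP[p0 p1]; elim: n g h => [|n IH] g h gh /=; first exact: gh.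
apply: lerD; apply: ler_wpM2l; rewrite ?subr_ge0//; apply: IH => i ni; apply: gh => //.
exact: leqW.
Qed.

Lemma binomial_meanN n p g : binomial_mean n p (fun i => - g i) = - binomial_mean n p g.
Proof. by elim: n g => [|n IH] g //=; rewrite !IH; ring. Qed.

(** Second moment of the binomial law about [c], as variance plus squared bias. The centre must be
    free since each step of the induction shifts it by 1. *)
Lemma binomial_mean_quad n p (a b c : R) :
  binomial_mean n p (fun i => a + b * (i%:R - c) ^+ 2) =
  a + b * (n%:R * p * (1 - p) + (n%:R * p - c) ^+ 2).
Proof.
elim: n c => [|n IH] c /=; first by ring.
rewrite (_ : (fun i : nat => a + b * (i.+1%:R - c) ^+ 2) =
  (fun i : nat => a + b * (i%:R - (c - 1)) ^+ 2)); last first.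
  by apply/funext => i; rewrite -natr1; ring.
by rewrite !IH -natr1; ring.
Qed.

Lemma binomial_mean_quad_le n p (a b : R) (g : nat -> R) : 0 <= p <= 1 -> 0 <= b ->
  (forall i, (i <= n)%N -> g i <= a + b * (i%:R - n%:R * p) ^+ 2) ->
  binomial_mean n p g <= a + b * n%:R.
Proof.
move=> p01 b0 gb; apply: le_trans (binomial_mean_le p01 gb) _.
rewrite binomial_mean_quad subrr expr0n/= addr0 lerD2l ler_wpM2l//.
rewrite -mulrA ler_piMr//; case/andP: p01 => p0 p1; nra.
Qed.

Definition in_cube (q : R * R * R) : Prop :=
  [/\ 0 <= q.1.1 <= 1, 0 <= q.1.2 <= 1 & 0 <= q.2 <= 1].

Definition dist2 (p q : R * R * R) : R :=
  (q.1.1 - p.1.1) ^+ 2 + (q.1.2 - p.1.2) ^+ 2 + (q.2 - p.2) ^+ 2.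

Definition bernstein3 n (g : R * R * R -> R) (p : R * R * R) : R :=
  binomial_mean n p.1.1 (fun i => binomial_mean n p.1.2 (fun j =>
    binomial_mean n p.2 (fun k => g (i%:R / n%:R, j%:R / n%:R, k%:R / n%:R)))).

Let bernstein3_le n g p (e K : R) : (0 < n)%N -> 0 <= K -> in_cube p ->
  (forall q, in_cube q -> g q <= g p + e + K * dist2 p q) ->
  bernstein3 n g p <= g p + e + 3 * K / n%:R.
Proof.
move=> n0 K0 [p1 p2 p3] gp; have nR : 0 < n%:R :> R by rewrite ltr0n.
(* Squared distances of the nodes [i / n] become squared deviations of [i] after division by
   [n ^ 2]; each coordinate then costs at most [b * n = K / n]. *)
pose b := K / n%:R ^+ 2; have b0 : 0 <= b by rewrite divr_ge0// exprn_ge0.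
have node i : (i <= n)%N -> 0 <= (i%:R / n%:R : R) <= 1.
  by move=> ni; rewrite divr_ge0//= ler_pdivrMr// mul1r ler_nat.
have -> : g p + e + 3 * K / n%:R = g p + e + b * n%:R + b * n%:R + b * n%:R.
  by rewrite /b; field; rewrite gt_eqF.
apply: binomial_mean_quad_le => // i ni.
set di := b * (i%:R - n%:R * p.1.1) ^+ 2.
apply: (@le_trans _ _ ((g p + e + di + b * n%:R) + b * n%:R)); last first.
  by rewrite le_eqVlt; apply/orP; left; apply/eqP; ring.
apply: binomial_mean_quad_le => // j nj.
set dj := b * (j%:R - n%:R * p.1.2) ^+ 2.
apply: (@le_trans _ _ ((g p + e + di + dj) + b * n%:R)); last first.
  by rewrite le_eqVlt; apply/orP; left; apply/eqP; ring.
apply: binomial_mean_quad_le => // k nk.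
apply: le_trans (gp _ _) _; first by split; exact: node.
rewrite le_eqVlt; apply/orP; left; apply/eqP.
by rewrite /dist2 /di /dj /b /=; field; rewrite gt_eqF.
Qed.

Lemma bernstein3_dist n g p (e K : R) : (0 < n)%N -> 0 <= K -> in_cube p ->
  (forall q, in_cube q -> `|g q - g p| <= e + K * dist2 p q) ->
  `|bernstein3 n g p - g p| <= e + 3 * K / n%:R.
Proof.
move=> n0 K0 cp gp.
have up : bernstein3 n g p <= g p + e + 3 * K / n%:R.
  apply: bernstein3_le => // q cq; have := gp q cq; rewrite ler_norml => /andP[_].
  by rewrite lerBlDl addrA.
have lo : bernstein3 n (fun q => - g q) p <= - g p + e + 3 * K / n%:R.
  apply: (bernstein3_le (g := fun q => - g q)) => // q cq.
  have := gp q cq; rewrite ler_norml => /andP[+ _]; lra.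
have loE : bernstein3 n (fun q => - g q) p = - bernstein3 n g p.
  rewrite /bernstein3 -binomial_meanN; congr binomial_mean; apply/funext => i.
  rewrite -binomial_meanN; congr binomial_mean; apply/funext => j.
  by rewrite -binomial_meanN.
by rewrite ler_norml; move: up lo; rewrite loE => up lo; apply/andP; split; lra.
Qed.

(** The form of uniform continuity suited to second moments. Compactness of the cube gives a radius
    [r] within which [g] varies by at most [e]; farther points satisfy
    [2 * M <= 2 * M / r ^ 2 * dist2]. *)
Lemma continuous_cube_quad (g : R * R * R -> R) (M : R) : continuous g ->
  (forall q, `|g q| <= M) -> forall e, 0 < e -> exists2 K, 0 <= K &
  forall p q, in_cube p -> in_cube q -> `|g q - g p| <= e + K * dist2 p q.
Proof.
move=> cg gM e e0; have M0 : 0 <= M by apply: le_trans (gM (0, 0, 0)).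
pose cube := (`[0%R, 1%R]%classic `*` `[0%R, 1%R]%classic) `*` `[0%R, 1%R]%classic : set (R * R * R).
have ccube : compact cube.
  by apply: compact_setX; first apply: compact_setX; exact: segment_compact.
have cubeP p : in_cube p -> cube p by case=> *; rewrite /cube /= !in_itv.
pose close (r : R) (p : R * R * R) := forall q, ball p r q -> `|g q - g p| <= e.
have : \forall r \near 0^'+, cube `<=` close r.
  apply: ((compact_near_coveringP _).1 ccube _ _ close _) => p _.
  have e2 : 0 < e / 2 by rewrite divr_gt0.
  have := cg p; move/cvgrPdist_lt => /(_ _ e2) /nbhs_ballP[r /= r0 rP].
  have r2 : 0 < r / 2 by rewrite divr_gt0.
  exists (ball p (r / 2), [set x | x < r / 2]) => /=.
    split; first by exact: nbhsx_ballx.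
    by exact: nbhs_right_lt.
  move=> [p' r'] /= [pp' r'2] q p'q.
  have h1 : `|g p - g p'| < e / 2.
    by apply: rP; apply: le_ball pp'; rewrite [leRHS]splitr lerDl ltW.
  have h2 : `|g p - g q| < e / 2.
    apply: rP; rewrite [r]splitr; apply: ball_triangle pp' _.
    by apply: le_ball p'q; exact: ltW.
  rewrite (_ : g q - g p' = (g p - g p') - (g p - g q)); last by ring.
  by apply: (le_trans (ler_normB _ _)); apply: ltW; rewrite [e]splitr ltrD.
move=> near0.
have [r [r0 rP]] : exists r : R, 0 < r /\ cube `<=` close r.
  near (0 : R)^'+ => r; exists r; split; first by near: r; exact: nbhs_right_gt.
  by near: r.
exists (2 * M / r ^+ 2); first by rewrite divr_ge0 ?exprn_ge0 ?mulr_ge0// ltW.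
move=> p q cp cq; have d0 : 0 <= dist2 p q by rewrite /dist2 !addr_ge0 ?sqr_ge0.
have K0 : 0 <= 2 * M / r ^+ 2 by rewrite divr_ge0 ?exprn_ge0 ?mulr_ge0// ltW.
have [dr|dr] := ltP (dist2 p q) (r ^+ 2).
  apply: (@le_trans _ _ e); last by rewrite lerDl mulr_ge0.
  apply: (rP p (cubeP _ cp)).
  have coord x : x ^+ 2 <= dist2 p q -> `|x| < r.
    move=> xd; rewrite -(ltr_pXn2r (n := 2))// ?nnegrE ?(ltW r0)//.
    by rewrite real_normK ?num_real// (le_lt_trans xd).
  have s1 := sqr_ge0 (q.1.1 - p.1.1); have s2 := sqr_ge0 (q.1.2 - p.1.2).
  have s3 := sqr_ge0 (q.2 - p.2).
  by split; first split; rewrite /ball /= distrC; apply: coord; rewrite /dist2; lra.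
apply: (@le_trans _ _ (2 * M)).
  by apply: (le_trans (ler_normB _ _)); rewrite mulr_natl mulr2n lerD.
apply: (@le_trans _ _ (2 * M / r ^+ 2 * dist2 p q)); last by rewrite lerDr ltW.
by rewrite mulrAC ler_pdivlMr ?exprn_gt0// ler_wpM2l// mulr_ge0.
Unshelve. all: by end_near. Qed.

End bernstein.

Section bounded_expectation.
Context (R : realType) d (T : measurableType d) (P : probability T R).

Lemma bounded_integrable_prob (f : T -> R) (M : R) : measurable_fun setT f ->
  (forall x, `|f x| <= M) -> P.-integrable setT (EFin \o f).
Proof.
move=> mf fM; apply: measurable_bounded_integrable => //.
  by rewrite (le_lt_trans (probability_le1 P measurableT))// ltry.
exists M; split; rewrite ?num_real// => y My x _ /=.
by rewrite (le_trans (fM x))// ltW.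
Qed.

Lemma Rintegral_cst_prob (r : R) : \int[P]_x r = r.
Proof.
rewrite /Rintegral (_ : integral _ _ _ = (\int[P]_x (cst r%:E x))%E)//.
by rewrite (integral_cst P measurableT) [X in (_ * X)%E](@probability_setT _ _ _ P) mule1.
Qed.

Lemma Rintegral_dist (f g : T -> R) (M e : R) : measurable_fun setT f ->
  measurable_fun setT g -> (forall x, `|f x| <= M) -> (forall x, `|f x - g x| <= e) ->
  `|\int[P]_x f x - \int[P]_x g x| <= e.
Proof.
move=> mf mg fM fg.
have gM x : `|g x| <= M + e.
  rewrite (_ : g x = f x - (f x - g x)); last by ring.
  by apply: le_trans (ler_normB _ _) _; exact: lerD.
have i1 := bounded_integrable_prob mf fM; have i2 := bounded_integrable_prob mg gM.
have mfg : measurable_fun setT (fun x => f x - g x) by exact: measurable_funB.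
have i3 := bounded_integrable_prob mfg fg.
rewrite -RintegralB//; apply: le_trans (le_normr_Rintegral measurableT i3) _.
rewrite -[leRHS]Rintegral_cst_prob; apply: le_Rintegral => //.
  apply: (@bounded_integrable_prob _ e); first exact: measurableT_comp.
  by move=> x; rewrite normr_id.
apply: (@bounded_integrable_prob _ `|e|) => //.
Qed.

End bounded_expectation.

Section laplace_continuity.
Context (R : realType) d1 (T1 : measurableType d1) (P1 : probability T1 R)
  d2 (T2 : measurableType d2) (P2 : probability T2 R).
Variables (p : R -> T1 -> R * R * R) (p0 : T2 -> R * R * R).
Hypothesis p_cube : forall t x, in_cube (p t x).
Hypothesis p0_cube : forall x, in_cube (p0 x).

(** Test functions for which convergence is already known, with the measurability and the bound
    needed to combine them linearly and to pass to uniform limits on the cube. *)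
Definition good (phi : R * R * R -> R) : Prop :=
  [/\ forall t, measurable_fun setT (phi \o p t), measurable_fun setT (phi \o p0),
      exists M, forall q, in_cube q -> `|phi q| <= M &
      \int[P1]_x phi (p t x) @[t --> +oo] --> \int[P2]_x phi (p0 x)].

Let good_integrable phi : good phi ->
  (forall t, P1.-integrable setT (EFin \o (fun x => phi (p t x)))) /\
  P2.-integrable setT (EFin \o (fun x => phi (p0 x))).
Proof.
move=> [m m0 [M Mp] _]; split => [t|].
- by apply: (@bounded_integrable_prob _ _ _ P1 _ M (m t)) => x; exact: Mp.
- by apply: (@bounded_integrable_prob _ _ _ P2 _ M m0) => x; exact: Mp.
Qed.

Lemma goodD phi psi : good phi -> good psi -> good (fun q => phi q + psi q).
Proof.
move=> /[dup] /good_integrable[i1 i10] [m1 m10 [M Mp] c1].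
move=> /[dup] /good_integrable[i2 i20] [m2 m20 [N Np] c2]; split.
- by move=> t; exact: (measurable_funD (m1 t) (m2 t)).
- exact: (measurable_funD m10 m20).
- by exists (M + N) => q cq; rewrite (le_trans (ler_normD _ _))// lerD ?Mp ?Np.
rewrite RintegralD//.
apply: cvg_trans (cvgD c1 c2); apply: near_eq_cvg; apply: nearW => t.
by rewrite [RHS](RintegralD measurableT (i1 t) (i2 t)).
Qed.

Lemma goodZ r phi : good phi -> good (fun q => r * phi q).
Proof.
move=> /[dup] /good_integrable[i1 i10] [m1 m10 [M Mp] c1]; split.
- by move=> t; exact: (measurable_funM (measurable_cst r) (m1 t)).
- exact: (measurable_funM (measurable_cst r) m10).
- by exists (`|r| * M) => q cq; rewrite normrM ler_wpM2l// Mp.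
rewrite RintegralZl//.
apply: cvg_trans (cvgM (cvg_cst r) c1); apply: near_eq_cvg; apply: nearW => t.
by rewrite [RHS](RintegralZl r measurableT (i1 t)).
Qed.

(** Measurability of [g] along [p] comes from a pointwise limit of good functions, the convergence
    from splitting the error into three parts. *)
Lemma good_approx g : (forall e, 0 < e ->
  exists2 phi, good phi & forall q, in_cube q -> `|phi q - g q| <= e) -> good g.
Proof.
move=> approx.
have approx' (k : nat) : exists phi, good phi /\
    forall q, in_cube q -> `|phi q - g q| <= k.+1%:R^-1.
  by have [|phi gphi h] := approx k.+1%:R^-1; [rewrite invr_gt0|exists phi].
have [psi psiP] := choice approx'.
have psi_cvg q : in_cube q -> psi k q @[k --> \oo] --> g q.
  move=> cq; apply/cvgrPdist_le => e e0; near=> k.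
  rewrite distrC; apply: le_trans ((psiP k).2 q cq) _; apply: ltW.
  near: k; exact: (near_infty_natSinv_lt (PosNum e0)).
have mg t : measurable_fun setT (g \o p t).
  apply: (@measurable_fun_cvg _ _ _ _ (fun k => psi k \o p t)).
    by move=> k; have [[]] := psiP k.
  by move=> x _; exact: psi_cvg.
have mg0 : measurable_fun setT (g \o p0).
  apply: (@measurable_fun_cvg _ _ _ _ (fun k => psi k \o p0)).
    by move=> k; have [[]] := psiP k.
  by move=> x _; exact: psi_cvg.
split => //.
  have [[_ _ [M Mp] _] h] := psiP 0%N; exists (M + 1) => q cq.
  rewrite (_ : g q = psi 0%N q - (psi 0%N q - g q)); last by ring.
  apply: le_trans (ler_normB _ _) _; apply: lerD; first exact: Mp.
  by have := h q cq; rewrite invr1.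
apply/cvgrPdist_le => e e0; have e3 : 0 < e / 3 by rewrite divr_gt0.
have [phi [m m0 [M Mp] c] close] := approx _ e3.
have d0 : `|\int[P2]_x phi (p0 x) - \int[P2]_x g (p0 x)| <= e / 3.
  by apply: (@Rintegral_dist _ _ _ P2 _ _ M) => // x; [exact: Mp|exact: close].
near=> t.
have dt : `|\int[P1]_x phi (p t x) - \int[P1]_x g (p t x)| <= e / 3.
  apply: (@Rintegral_dist _ _ _ P1 _ _ M) => //; first exact: m.
  - exact: mg.
  - by move=> x; exact: Mp.
  - by move=> x; exact: close.
have ct : `|\int[P2]_x phi (p0 x) - \int[P1]_x phi (p t x)| <= e / 3.
  by near: t; apply: (cvgrPdist_le _ _).1 c _ e3.
move: d0 dt ct; rewrite !ler_norml => /andP[? ?] /andP[? ?] /andP[? ?].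
by apply/andP; split; lra.
Unshelve. all: by end_near. Qed.

Hypothesis mp : forall t, measurable_fun setT (p t).
Hypothesis mp0 : measurable_fun setT p0.

Definition monomial (a b c : nat) (q : R * R * R) : R :=
  q.1.1 ^+ a * q.1.2 ^+ b * q.2 ^+ c.

Hypothesis monomial_cvg : forall a b c,
  \int[P1]_x monomial a b c (p t x) @[t --> +oo] --> \int[P2]_x monomial a b c (p0 x).

Let measurable_monomial a b c : measurable_fun setT (monomial a b c).
Proof.
apply: measurable_funM; first apply: measurable_funM; apply: measurable_funX.
- by apply: (measurableT_comp measurable_fst); exact: measurable_fst.
- by apply: (measurableT_comp measurable_snd); exact: measurable_fst.
- exact: measurable_snd.
Qed.

Lemma good_monomial a b c : good (monomial a b c).
Proof.
split => //.
- by move=> t; exact: measurableT_comp.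
- exact: measurableT_comp.
exists 1 => q [/andP[x0 x1] /andP[y0 y1] /andP[z0 z1]].
rewrite /monomial ger0_norm ?mulr_ge0 ?exprn_ge0//.
by rewrite !mulr_ile1 ?mulr_ge0 ?exprn_ge0 ?exprn_ile1.
Qed.

(** [good] is not stable under products. Requiring it after multiplication by every monomial makes
    it stable under multiplication by a coordinate, the only product in the recursion of
    [binomial_mean]. *)
Let vgood (phi : R * R * R -> R) := forall a b c, good (fun q => monomial a b c q * phi q).

Let vgood_cst r : vgood (fun=> r).
Proof.
move=> a b c; have := goodZ r (good_monomial a b c).
by under eq_fun do rewrite mulrC.
Qed.

Let vgoodD phi psi : vgood phi -> vgood psi -> vgood (fun q => phi q + psi q).
Proof.
move=> v1 v2 a b c; have := goodD (v1 a b c) (v2 a b c).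
by under eq_fun do rewrite -mulrDr.
Qed.

Let vgoodN phi : vgood phi -> vgood (fun q => - phi q).
Proof.
move=> v1 a b c; have := goodZ (-1) (v1 a b c).
by under eq_fun do rewrite mulN1r -mulrN.
Qed.

Let vgood_binomial_mean (pi : R * R * R -> R) n (G : nat -> R * R * R -> R) :
  (forall phi, vgood phi -> vgood (fun q => pi q * phi q)) ->
  (forall i, vgood (G i)) -> vgood (fun q => binomial_mean n (pi q) (fun i => G i q)).
Proof.
move=> vpi; elim: n G => [|n IH] G vG /=; first exact: vG.
have A := IH (fun i => G i.+1) (fun i => vG i.+1).
have B := IH G vG.
rewrite (_ : (fun q => _) = (fun q =>
   pi q * binomial_mean n (pi q) (fun i => G i.+1 q) +
   (binomial_mean n (pi q) (fun i => G i q) +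
   - (pi q * binomial_mean n (pi q) (fun i => G i q))))).
  by apply: vgoodD; [exact: vpi|apply: vgoodD => //; apply: vgoodN; exact: vpi].
by apply/funext => q; ring.
Qed.

Lemma good_bernstein3 n g : good (bernstein3 n g).
Proof.
have vM1 phi : vgood phi -> vgood (fun q => q.1.1 * phi q).
  move=> v a b c; have := v a.+1 b c.
  rewrite (_ : (fun q => _) = (fun q => monomial a b c q * (q.1.1 * phi q)))//.
  by apply/funext => q; rewrite /monomial exprS; ring.
have vM2 phi : vgood phi -> vgood (fun q => q.1.2 * phi q).
  move=> v a b c; have := v a b.+1 c.
  rewrite (_ : (fun q => _) = (fun q => monomial a b c q * (q.1.2 * phi q)))//.
  by apply/funext => q; rewrite /monomial exprS; ring.
have vM3 phi : vgood phi -> vgood (fun q => q.2 * phi q).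
  move=> v a b c; have := v a b c.+1.
  rewrite (_ : (fun q => _) = (fun q => monomial a b c q * (q.2 * phi q)))//.
  by apply/funext => q; rewrite /monomial exprS; ring.
have : vgood (bernstein3 n g).
  apply: (@vgood_binomial_mean (fun q => q.1.1) n (fun i q => binomial_mean n q.1.2 (fun j =>
    binomial_mean n q.2 (fun k => g (i%:R / n%:R, j%:R / n%:R, k%:R / n%:R))))) => // i.
  apply: (@vgood_binomial_mean (fun q => q.1.2) n (fun j q => binomial_mean n q.2 (fun k =>
    g (i%:R / n%:R, j%:R / n%:R, k%:R / n%:R)))) => // j.
  apply: (@vgood_binomial_mean (fun q => q.2) n (fun k _ =>
    g (i%:R / n%:R, j%:R / n%:R, k%:R / n%:R))) => //.
move=> /(_ 0%N 0%N 0%N); rewrite (_ : (fun q => _) = bernstein3 n g)//.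
by apply/funext => q; rewrite /monomial !expr0 !mul1r.
Qed.

Lemma good_continuous (g : R * R * R -> R) : continuous g ->
  (exists M, forall q, `|g q| <= M) -> good g.
Proof.
move=> cg [M gM]; apply: good_approx => e e0.
have e2 : 0 < e / 2 by rewrite divr_gt0.
have [K K0 gK] := continuous_cube_quad cg gM e2.
have [n [n0 nK]] : exists n : nat, (0 < n)%N /\ 3 * K / n%:R <= e / 2.
  exists (Num.trunc (3 * K / (e / 2))).+1; split => //.
  rewrite ler_pdivrMr ?ltr0n// -ler_pdivrMl// mulrC.
  by apply: ltW; exact: truncnS_gt.
exists (bernstein3 n g); first exact: good_bernstein3.
move=> q cq; rewrite [e]splitr; apply: (le_trans (bernstein3_dist n0 K0 cq _)).
  by move=> q' cq'; exact: gK.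
by rewrite lerD2l.
Qed.

End laplace_continuity.

(** * From the cube to unbounded statistics: truncation and tightness *)

Section cutoff.
Context (R : realType).

Definition cutoff (k x : R) : R := Num.max 0 (Num.min 1 (k + 1 - x)).

Lemma cutoff_bounds k x : 0 <= cutoff k x <= 1.
Proof. by rewrite /cutoff le_max lexx ge_max ler01 ge_min lexx. Qed.

Lemma cutoff1 k x : x <= k -> cutoff k x = 1.
Proof.
move=> xk; rewrite /cutoff min_l; last by lra.
by rewrite max_r.
Qed.

Lemma cutoff0 k x : k + 1 <= x -> cutoff k x = 0.
Proof. by move=> kx; rewrite /cutoff max_l// ge_min orbC subr_le0 kx. Qed.

Lemma cutoff_continuous k : continuous (cutoff k).
Proof.
move=> x; apply: (@continuous_max _ _ (cst 0) (fun x => Num.min 1 (k + 1 - x))).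
  exact: cst_continuous.
apply: (@continuous_min _ _ (cst 1) (fun x => k + 1 - x)); first exact: cst_continuous.
by apply: cvgB; [exact: cvg_cst|exact: cvg_id].
Qed.

(** Recovers [x] from [expR (- x)] up to the level [k], yet is continuous on the whole line,
    nonpositive [y] included. *)
Definition minus_log (k y : R) : R := - ln (Num.max y (expR (- k))).

Lemma minus_log_expRN k x : minus_log k (expR (- x)) = Num.min x k.
Proof.
rewrite /minus_log; have [xk|kx] := leP x k.
  by rewrite max_l ?expRK ?opprK// ler_expR lerN2.
by rewrite max_r ?expRK ?opprK// ler_expR lerN2 ltW.
Qed.

Lemma minus_log_continuous k : continuous (minus_log k).
Proof.
move=> x; apply: cvgN; apply: continuous_cvg.
  by apply: continuous_ln; rewrite lt_max expR_gt0 orbT.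
apply: (@continuous_max _ _ id (cst (expR (- k)))); first exact: cvg_id.
exact: cst_continuous.
Qed.

Definition cutoff3 k (z : R * R * R) : R := cutoff k z.1.1 * cutoff k z.1.2 * cutoff k z.2.

Lemma cutoff3_bounds k z : 0 <= cutoff3 k z <= 1.
Proof.
have /andP[? ?] := cutoff_bounds k z.1.1; have /andP[? ?] := cutoff_bounds k z.1.2.
have /andP[? ?] := cutoff_bounds k z.2.
by rewrite /cutoff3 !mulr_ge0// !mulr_ile1// mulr_ge0.
Qed.

(** A continuous function on the whole of [R * R * R] that represents [f] times the cutoff through
    [expR (- x)], [expR (- y)], [expR (- z)]. The level [k + 1] of [minus_log] is where the cutoff
    has become 0, so that the clipping is invisible. *)
Definition truncated (k : R) (f : R * R * R -> R) (q : R * R * R) : R :=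
  let z := (minus_log (k + 1) q.1.1, minus_log (k + 1) q.1.2, minus_log (k + 1) q.2) in
  f z * cutoff3 k z.

Lemma truncated_expRN k f x y z :
  truncated k f (expR (- x), expR (- y), expR (- z)) = f (x, y, z) * cutoff3 k (x, y, z).
Proof.
rewrite /truncated /cutoff3 /= !minus_log_expRN.
have [?|/ltW ?] := leP x (k + 1); last first.
  by rewrite (cutoff0 (lexx _)) [cutoff k x]cutoff0// !(mul0r, mulr0).
have [?|/ltW ?] := leP y (k + 1); last first.
  by rewrite (cutoff0 (lexx _)) [cutoff k y]cutoff0// !(mul0r, mulr0).
have [//|/ltW ?] := leP z (k + 1).
by rewrite (cutoff0 (lexx _)) [cutoff k z]cutoff0// !(mul0r, mulr0).
Qed.

Lemma cvg_triple (T : Type) (G : set_system T) (FG : Filter G) (a b c : T -> R) (x y z : R) :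
  a @ G --> x -> b @ G --> y -> c @ G --> z ->
  (a t, b t, c t) @[t --> G] --> ((x, y, z) : R * R * R).
Proof.
move=> ax b_y cz A [[B C] /= [[[B1 B2] /= [nB1 nB2] sB] nC] sA].
have n1 := ax _ nB1; have n2 := b_y _ nB2; have n3 := cz _ nC.
have : G (a @^-1` B1 `&` (b @^-1` B2 `&` c @^-1` C)).
  by apply: filterI => //; exact: filterI.
apply: (@filterS _ G) => t [t1 [t2 t3]].
by apply: sA; split => //; apply: sB.
Qed.

Lemma truncated_continuous k f : continuous f -> continuous (truncated k f).
Proof.
move=> cf q.
have c1 : minus_log (k + 1) x.1.1 @[x --> q] --> minus_log (k + 1) q.1.1.
  apply: continuous_cvg; first exact: minus_log_continuous.
  exact: (cvg_comp _ _ cvg_fst cvg_fst).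
have c2 : minus_log (k + 1) x.1.2 @[x --> q] --> minus_log (k + 1) q.1.2.
  apply: continuous_cvg; first exact: minus_log_continuous.
  exact: (cvg_comp _ _ cvg_fst cvg_snd).
have c3 : minus_log (k + 1) x.2 @[x --> q] --> minus_log (k + 1) q.2.
  apply: continuous_cvg; first exact: minus_log_continuous.
  exact: cvg_snd.
have cz := cvg_triple (nbhs_filter _) c1 c2 c3.
apply: cvgM; first exact: (cvg_comp _ _ cz (cf _)).
apply: cvgM; first apply: cvgM.
- exact: (cvg_comp _ _ c1 (@cutoff_continuous k _)).
- exact: (cvg_comp _ _ c2 (@cutoff_continuous k _)).
- exact: (cvg_comp _ _ c3 (@cutoff_continuous k _)).
Qed.

Lemma truncated_bound k f M : (forall z, `|f z| <= M) -> forall q, `|truncated k f q| <= M.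
Proof.
move=> fM q; rewrite /truncated normrM; set z := (_, _, _).
have /andP[c0 c1] := cutoff3_bounds k z; rewrite (ger0_norm c0).
by apply: le_trans (fM z); rewrite ler_piMr.
Qed.

Lemma cvg_cutoff3 z : cutoff3 k%:R z @[k --> \oo] --> (1 : R).
Proof.
apply: (@cvg_trans _ ((1 : R) @[_ --> \oo])); last exact: cvg_cst.
apply: near_eq_cvg; near=> k.
rewrite /cutoff3 !cutoff1 ?mulr1//; near: k; exact: nbhs_infty_ger.
Unshelve. all: by end_near. Qed.

End cutoff.

(** Truncation costs at most [M] times the mass lost. It serves to cut off large statistics and,
    later, extreme values of [N t / t]. *)
Lemma Rintegral_defect (R : realType) d (T : measurableType d) (Q : probability T R)
    (M : R) (g c : T -> R) : 0 <= M -> measurable_fun setT g -> measurable_fun setT c ->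
  (forall x, `|g x| <= M) -> (forall x, 0 <= c x <= 1) ->
  `|\int[Q]_x g x - \int[Q]_x (g x * c x)| <= M * (1 - \int[Q]_x c x).
Proof.
move=> M0 mg mc gM c01.
have gcM x : `|g x * c x| <= M.
  have /andP[? ?] := c01 x; rewrite normrM (ger0_norm (_ : 0 <= c x))//.
  by apply: le_trans (gM x); rewrite ler_piMr.
have cM x : `|M * (1 - c x)| <= M.
  have /andP[? ?] := c01 x; rewrite ger0_norm ?mulr_ge0 ?subr_ge0//.
  by rewrite ler_piMr// lerBlDr lerDl.
have c1M x : `|1 - c x| <= 1.
  by have /andP[? ?] := c01 x; rewrite ger0_norm ?subr_ge0// lerBlDr lerDl.
have mgc : measurable_fun setT (fun x => g x * c x) by exact: measurable_funM.
have m1c : measurable_fun setT (fun x => 1 - c x) by exact: measurable_funB.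
have ig := @bounded_integrable_prob _ _ _ Q _ M mg gM.
have igc := @bounded_integrable_prob _ _ _ Q _ M mgc gcM.
have cM1 x : `|c x| <= 1 by have /andP[? ?] := c01 x; rewrite ger0_norm.
have ic := @bounded_integrable_prob _ _ _ Q _ 1 mc cM1.
have i1c := @bounded_integrable_prob _ _ _ Q _ 1 m1c c1M.
have i1 : Q.-integrable setT (EFin \o (fun=> 1 : R)).
  by apply: (@bounded_integrable_prob _ _ _ Q _ 1) => // x; rewrite normr1.
have igB : Q.-integrable setT (EFin \o (fun x => g x - g x * c x)).
  by have := integrableB measurableT ig igc; apply: eq_integrable.
rewrite -RintegralB//; apply: le_trans (le_normr_Rintegral measurableT igB) _.
rewrite -[in leRHS](Rintegral_cst_prob Q 1) -RintegralB// -RintegralZl//.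
apply: le_Rintegral => //.
- have mB : measurable_fun setT (fun x => g x - g x * c x) by exact: measurable_funB.
  apply: (@bounded_integrable_prob _ _ _ Q _ (M + M)); first exact: measurableT_comp.
  by move=> x; rewrite normr_id; apply: le_trans (ler_normB _ _) _; exact: lerD.
- by apply: (@bounded_integrable_prob _ _ _ Q _ M) => //; exact: measurable_funM.
move=> x _; rewrite -[X in `|X - _|]mulr1 -mulrBr normrM.
have /andP[? ?] := c01 x; rewrite [`|1 - _|]ger0_norm ?subr_ge0//.
by rewrite ler_wpM2r ?subr_ge0.
Qed.

Section continuity_theorem.
Context (R : realType) d1 (T1 : measurableType d1) (P1 : probability T1 R)
  d2 (T2 : measurableType d2) (P2 : probability T2 R).
Variables (L X S : R -> T1 -> R) (L0 X0 S0 : T2 -> R).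
Hypotheses (mL : forall t, measurable_fun setT (L t))
  (mX : forall t, measurable_fun setT (X t)) (mS : forall t, measurable_fun setT (S t)).
Hypotheses (mL0 : measurable_fun setT L0) (mX0 : measurable_fun setT X0)
  (mS0 : measurable_fun setT S0).
Hypotheses (L_ge0 : forall t x, 0 <= L t x) (X_ge0 : forall t x, 0 <= X t x)
  (S_ge0 : forall t x, 0 <= S t x).
Hypotheses (L0_ge0 : forall x, 0 <= L0 x) (X0_ge0 : forall x, 0 <= X0 x)
  (S0_ge0 : forall x, 0 <= S0 x).
Hypothesis laplace_cvg : forall u v w, 0 <= u -> 0 <= v -> 0 <= w ->
  \int[P1]_x expR (- u * L t x - v * X t x - w * S t x) @[t --> +oo] -->
  \int[P2]_x expR (- u * L0 x - v * X0 x - w * S0 x).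

Let Z t x := (L t x, X t x, S t x).
Let Z0 x := (L0 x, X0 x, S0 x).
Let p t x := (expR (- L t x), expR (- X t x), expR (- S t x)).
Let p0 x := (expR (- L0 x), expR (- X0 x), expR (- S0 x)).

Let expRN_bounds (y : R) : 0 <= y -> 0 <= expR (- y) <= 1.
Proof. by move=> y0; rewrite expR_ge0 expR_le1 oppr_le0. Qed.

Let p_cube t x : in_cube (p t x).
Proof. by split; exact: expRN_bounds. Qed.

Let p0_cube x : in_cube (p0 x).
Proof. by split; exact: expRN_bounds. Qed.

Let measurable_expRN d (T : measurableType d) (h : T -> R) :
  measurable_fun setT h -> measurable_fun setT (fun x => expR (- h x)).
Proof. by move=> mh; apply: (measurableT_comp (@measurable_expR R)); exact: measurableT_comp. Qed.

Let monomial_expRN a b c (x y z : R) : monomial a b c (expR (- x), expR (- y), expR (- z)) =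
  expR (- a%:R * x - b%:R * y - c%:R * z).
Proof.
rewrite /monomial /= -!expRM_natl -!expRD; congr expR; ring.
Qed.

Let truncation_good f k : continuous f -> (exists M, forall z, `|f z| <= M) ->
  good P1 P2 p p0 (truncated k f).
Proof.
move=> cf [M fM]; apply: good_continuous => //.
- by move=> t; apply: measurable_fun_pair;
    [apply: measurable_fun_pair|]; exact: measurable_expRN.
- by apply: measurable_fun_pair; [apply: measurable_fun_pair|]; exact: measurable_expRN.
- move=> a b c; rewrite /p /p0; under eq_Rintegral do rewrite monomial_expRN.
  have h := laplace_cvg (ler0n R a) (ler0n R b) (ler0n R c).
  apply: cvg_trans h; apply: near_eq_cvg; apply: nearW => t.
  by apply: eq_Rintegral => x _; rewrite monomial_expRN.
- exact: truncated_continuous.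
- by exists M; exact: truncated_bound.
Qed.

Let truncatedE f k t x : truncated k f (p t x) = f (Z t x) * cutoff3 k (Z t x).
Proof. exact: truncated_expRN. Qed.

Let truncated0E f k x : truncated k f (p0 x) = f (Z0 x) * cutoff3 k (Z0 x).
Proof. exact: truncated_expRN. Qed.

Let truncated_cvg f (z : R * R * R) : f z * cutoff3 k%:R z @[k --> \oo] --> f z.
Proof.
by rewrite -[X in _ --> X]mulr1; apply: cvgM; [exact: cvg_cst|exact: cvg_cutoff3].
Qed.

(** Tightness is obtained by applying the convergence of truncated functions to the constant 1: the
    mass kept by the cutoff converges to that of the limit, which is close to 1 for large [k]. *)
Lemma cvg_in_distribution_of_laplace : cvg_in_distribution P1 P2 Z Z0.
Proof.
move=> f cf [M fM]; have M0 : 0 <= M by apply: le_trans (fM (0, 0, 0)).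
have goodf k := truncation_good k cf (ex_intro _ M fM).
have c1 : continuous (fun _ : R * R * R => 1 : R) by move=> x; exact: cvg_cst.
have good1 k : good P1 P2 p p0 (truncated k (fun=> 1)).
  by apply: truncation_good => //; exists 1 => z; rewrite normr1.
have mf t : measurable_fun setT (f \o Z t).
  apply: (@measurable_fun_cvg _ _ _ _ (fun k => truncated k%:R f \o p t)).
    by move=> k; have [] := goodf k%:R.
  by move=> x _; under eq_fun do rewrite /= truncatedE; exact: truncated_cvg.
have mf0 : measurable_fun setT (f \o Z0).
  apply: (@measurable_fun_cvg _ _ _ _ (fun k => truncated k%:R f \o p0)).
    by move=> k; have [] := goodf k%:R.
  by move=> x _; under eq_fun do rewrite /= truncated0E; exact: truncated_cvg.
have fin1 t : ('E_P1[f \o Z t])%E = (\int[P1]_x f (Z t x))%:E.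
  rewrite unlock fineK//; apply: integrable_fin_num => //.
  exact: (@bounded_integrable_prob _ _ _ P1 _ M (mf t) (fun x => fM _)).
have fin2 : ('E_P2[f \o Z0])%E = (\int[P2]_x f (Z0 x))%:E.
  rewrite unlock fineK//; apply: integrable_fin_num => //.
  exact: (@bounded_integrable_prob _ _ _ P2 _ M mf0 (fun x => fM _)).
rewrite fin2 (_ : (fun t => _) = (fun t => (\int[P1]_x f (Z t x))%:E)); last first.
  by apply/funext => t; exact: fin1.
apply: cvg_EFin; first exact: nearW.
(* Of the four quarters of [e], one pays for the truncation of the limit, one for the truncated
   convergence and two for the truncation at time [t]. [M + 1] avoids a division by 0. *)
apply/cvgrPdist_le => e e0; have e4 : 0 < e / (4 * (M + 1)).
  by rewrite divr_gt0// mulr_gt0// ltr_pwDr.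
pose chi k t x := cutoff3 k (Z t x); pose chi0 k x := cutoff3 k (Z0 x).
have chi1E k t x : truncated k (fun=> 1) (p t x) = chi k t x by rewrite truncatedE mul1r.
have chi10E k x : truncated k (fun=> 1) (p0 x) = chi0 k x by rewrite truncated0E mul1r.
have mchi k t : measurable_fun setT (chi k t).
  have [m _ _ _] := good1 k; have := m t; apply: eq_measurable_fun => x _; exact: chi1E.
have mchi0 k : measurable_fun setT (chi0 k).
  have [_ m _ _] := good1 k; have := m; apply: eq_measurable_fun => x _; exact: chi10E.
have norm_chi (c : R) : 0 <= c <= 1 -> `|c| <= 1.
  by case/andP => c0 c1'; rewrite ger0_norm.
have chi0_cvg : \int[P2]_x chi0 k%:R x @[k --> \oo] --> (1 : R).
  have : (\int[P2]_x (chi0 k%:R x)%:E)%E @[k --> \oo] --> (\int[P2]_x (1 : R)%:E)%E.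
    apply: (@dominated_cvg_near _ _ R P2 _ (fun k => chi0 k%:R) (fun=> 1) (fun=> 1)) => //.
    - by apply: aeW => x _; exact: cvg_cutoff3.
    - by apply: (@bounded_integrable_prob _ _ _ P2 _ 1) => // x; rewrite normr1.
    - by apply: nearW => k x _; apply: norm_chi; exact: cutoff3_bounds.
  have -> : (\int[P2]_x (1 : R)%:E)%E = 1%:E.
    by rewrite (integral_cst P2 measurableT 1%E) mul1e; exact: probability_setT.
  exact: fine_cvg.
have [k hk] : exists k : nat, 1 - \int[P2]_x chi0 k%:R x <= e / (4 * (M + 1)).
  have [k _ /(_ k (leqnn k)) hk] := (cvgrPdist_le _ _).1 chi0_cvg _ e4.
  by exists k; apply: le_trans hk; exact: ler_norm.
have [m m0 _ cf_k] := goodf k%:R; have [_ _ _ c1_k] := good1 k%:R.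
have d0 := Rintegral_defect P2 M0 mf0 (mchi0 k%:R) (fun x => fM _) (fun x => cutoff3_bounds _ _).
have e4' : 0 < e / 4 by rewrite divr_gt0.
near=> t.
have dt := Rintegral_defect P1 M0 (mf t) (mchi k%:R t) (fun x => fM _) (fun x => cutoff3_bounds _ _).
have hf : `|\int[P2]_x (f (Z0 x) * chi0 k%:R x) - \int[P1]_x (f (Z t x) * chi k%:R t x)| <= e / 4.
  under eq_Rintegral do rewrite -truncated0E.
  under [X in _ - X]eq_Rintegral do rewrite -truncatedE.
  by near: t; exact: (cvgrPdist_le _ _).1 cf_k _ e4'.
have hc : `|\int[P2]_x chi0 k%:R x - \int[P1]_x chi k%:R t x| <= e / (4 * (M + 1)).
  under eq_Rintegral do rewrite -chi10E.
  under [X in _ - X]eq_Rintegral do rewrite -chi1E.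
  by near: t; exact: (cvgrPdist_le _ _).1 c1_k _ e4.
have eM : M * (e / (4 * (M + 1))) <= e / 4.
  have M1 : 0 < M + 1 by rewrite ltr_pwDr.
  rewrite invfM mulrCA [leRHS]mulrC mulrC; rewrite [leLHS](_ : _ = e / 4 * (M / (M + 1))); last by ring.
  by rewrite ler_piMr ?(ltW e4')// ler_pdivrMr// mul1r lerDl.
have hk' : M * (1 - \int[P2]_x chi0 k%:R x) <= e / 4.
  by apply: le_trans eM; rewrite ler_wpM2l.
have ht : M * (1 - \int[P1]_x chi k%:R t x) <= 2 * (e / 4).
  rewrite mulr_natl mulr2n; apply: le_trans (lerD hk' eM).
  rewrite -mulrDr ler_wpM2l//; move: hc; rewrite ler_norml => /andP[? ?]; lra.
move: d0 dt hf; rewrite !ler_norml => /andP[? ?] /andP[? ?] /andP[? ?].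
rewrite /= in ht hk' *.
by apply/andP; split; lra.
Unshelve. all: by end_near. Qed.

End continuity_theorem.

(** * Random number of claims *)

Section window.
Context (R : realType).

(** A continuous substitute for the indicator of the interval from [m^-1] to [m], to which
    convergence in distribution can be applied. *)
Definition window (m x : R) : R :=
  Num.max 0 (Num.min 1 (Num.min (m * x - 1) (m - x))).

Lemma window_bounds m x : 0 <= window m x <= 1.
Proof. by rewrite /window le_max lexx ge_max ler01 ge_min lexx. Qed.

Lemma window_neq0 m x : 0 < m -> window m x != 0 -> m^-1 <= x <= m.
Proof.
move=> m0; apply: contraNT; rewrite negb_and -!ltNge => /orP h.
apply/eqP; rewrite /window max_l// !ge_min; case: h => h.
  have : m * x < 1 by rewrite mulrC -ltr_pdivlMr// div1r.
  by move=> mx; apply/orP; right; apply/orP; left; lra.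
by apply/orP; right; apply/orP; right; lra.
Qed.

Lemma window_continuous m : continuous (window m).
Proof.
move=> x; apply: (@continuous_max _ _ (cst 0)
  (fun x => Num.min 1 (Num.min (m * x - 1) (m - x)))); first exact: cst_continuous.
apply: (@continuous_min _ _ (cst 1) (fun x => Num.min (m * x - 1) (m - x))).
  exact: cst_continuous.
apply: (@continuous_min _ _ (fun x => m * x - 1) (fun x => m - x)).
  by apply: cvgB; [apply: cvgM; [exact: cvg_cst|exact: cvg_id]|exact: cvg_cst].
by apply: cvgB; [exact: cvg_cst|exact: cvg_id].
Qed.

Lemma cvg_window x : 0 < x -> window k.+1%:R x @[k --> \oo] --> (1 : R).
Proof.
move=> x0; apply: (@cvg_trans _ ((1 : R) @[_ --> \oo])); last exact: cvg_cst.
apply: near_eq_cvg; near=> k; rewrite /window.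
have h1 : 2 / x <= k%:R by near: k; exact: nbhs_infty_ger.
have h2 : x + 1 <= k%:R by near: k; exact: nbhs_infty_ger.
have h3 : 2 <= k%:R * x by rewrite -ler_pdivrMr.
rewrite -natr1 min_l ?max_r// le_min; apply/andP; split; last by lra.
by rewrite mulrDl mul1r; lra.
Unshelve. all: by end_near. Qed.

End window.

Section mixture.
Context (R : realType) d (T : measurableType d) (P : probability T R)
  (N : R -> {RV P >-> nat})
  dQ (TQ : measurableType dQ) (Q : probability TQ R) (Theta : {RV Q >-> R}).
Hypothesis N_cvg : cvg_in_distribution P Q (fun t x => (N t x)%:R / t) Theta.
Hypothesis Theta_gt0 : {ae Q, forall x, 0 < Theta x}.
Variables (G : R -> nat -> R) (H : R -> R).
Hypothesis G_bounds : forall t n, 0 < t -> 0 <= G t n <= 1.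
Hypothesis GH_cvg : forall (t : nat -> R) (n : nat -> nat) theta,
  t k @[k --> \oo] --> +oo -> (n k)%:R / t k @[k --> \oo] --> theta -> 0 < theta ->
  G (t k) (n k) @[k --> \oo] --> H theta.

(** If no radius and rank worked, choosing a counterexample for each [k] would give sequences that
    contradict [GH_cvg]. *)
Lemma mixture_local (theta e : R) : 0 < theta -> 0 < e -> exists2 r, 0 < r & exists A,
  forall t n, A < t -> `|n%:R / t - theta| < r -> `|G t n - H theta| < e.
Proof.
move=> th0 e0; apply: contrapT => no.
have bad k : exists tn : R * nat, [/\ k%:R < tn.1, `|tn.2%:R / tn.1 - theta| < k.+1%:R^-1 &
    e <= `|G tn.1 tn.2 - H theta|].
  apply: contrapT => nb; apply: no; exists k.+1%:R^-1; first by rewrite invr_gt0.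
  exists k%:R => t n kt close; rewrite ltNge; apply/negP => ge; apply: nb.
  by exists (t, n).
have [tn tnP] := choice bad.
have t_cvg : (tn k).1 @[k --> \oo] --> +oo.
  apply/cvgryPgt => A; near=> k; have [kt _ _] := tnP k; apply: le_lt_trans kt.
  near: k; exact: nbhs_infty_ger.
have n_cvg : (tn k).2%:R / (tn k).1 @[k --> \oo] --> theta.
  apply/cvgrPdist_lt => r r0; near=> k; have [_ + _] := tnP k; rewrite distrC => h.
  apply: lt_trans h _; near: k; exact: (near_infty_natSinv_lt (PosNum r0)).
have := GH_cvg t_cvg n_cvg th0; move/cvgrPdist_lt => /(_ _ e0)[k _ /(_ k (leqnn k))].
by have [_ _] := tnP k; rewrite distrC /= => h1 h2; have := le_lt_trans h1 h2; rewrite ltxx.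
Unshelve. all: by end_near. Qed.

Lemma natr_seq_cvgy : (k.+1%:R : R) @[k --> \oo] --> +oo.
Proof.
apply/cvgryPgt => A; near=> k.
apply: (@le_lt_trans _ _ k%:R); last by rewrite ltr_nat.
near: k; exact: nbhs_infty_ger.
Unshelve. all: by end_near. Qed.

Lemma cvg_truncn_div (theta : R) : 0 < theta ->
  (Num.trunc (theta * k.+1%:R))%:R / k.+1%:R @[k --> \oo] --> theta.
Proof.
move=> th0.
apply: (@squeeze_cvgr _ _ _ _ (fun k => theta - k.+1%:R^-1) (fun=> theta)).
- apply: nearW => k; have k0 : 0 < k.+1%:R :> R by [].
  have tk0 : 0 <= theta * k.+1%:R by rewrite mulr_ge0// ltW.
  have /andP[h1 h2] := truncn_itv tk0.
  rewrite ler_pdivlMr// ler_pdivrMr// h1 andbT mulrBl mulVf ?gt_eqF// lerBlDr.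
  by rewrite natr1 ltW.
- rewrite -[X in _ --> X]subr0; apply: cvgB; first exact: cvg_cst.
  exact: (inv_seq_cvg0 natr_seq_cvgy).
- exact: cvg_cst.
Qed.

(** [H theta'] is the limit of [G] along [t = k + 1] and [n] the integer part of [theta' * t]; near
    [theta] these values are within [e] of [H theta] by [mixture_local]. *)
Lemma mixture_limit_continuous (theta e : R) : 0 < theta -> 0 < e -> exists2 r, 0 < r &
  forall theta', 0 < theta' -> `|theta' - theta| < r -> `|H theta' - H theta| <= e.
Proof.
move=> th0 e0; have [r r0 [A AP]] := mixture_local th0 e0.
exists r => // th th_gt0 close.
have n_cvg := cvg_truncn_div th_gt0.
have G_cvg := GH_cvg natr_seq_cvgy n_cvg th_gt0.
have D_cvg : `|G k.+1%:R (Num.trunc (th * k.+1%:R)) - H theta| @[k --> \oo] -->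
    `|H th - H theta|.
  by apply: cvg_norm; apply: cvgB => //; exact: cvg_cst.
apply: (cvgr_to_le D_cvg).
have gap : 0 < r - `|th - theta| by rewrite subr_gt0.
have near_n : \forall k \near \oo,
    `|th - (Num.trunc (th * k.+1%:R))%:R / k.+1%:R| < r - `|th - theta|.
  exact: (cvgrPdist_lt _ _).1 n_cvg _ gap.
near=> k.
have hk : `|th - (Num.trunc (th * k.+1%:R))%:R / k.+1%:R| < r - `|th - theta| by near: k.
apply: ltW; apply: AP; first by near: k; exact: near_gt_seq natr_seq_cvgy A.
rewrite -(subrKA th); apply: le_lt_trans (ler_normD _ _) _.
by rewrite distrC -ltrBrDr.
Unshelve. all: by end_near. Qed.

(** The local statements, valid near each [theta] for all large [t], combine over the compact
    segment from [a] to [b]. *)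
Lemma mixture_uniform (a b e : R) : 0 < a -> 0 < e ->
  \forall t \near +oo, forall n, a <= n%:R / t <= b -> `|G t n - H (n%:R / t)| <= e.
Proof.
move=> a0 e0; pose good_at (t theta : R) := 0 < theta -> forall n, n%:R / t = theta ->
  `|G t n - H theta| <= e.
have : \forall t \near +oo, `[a, b]%classic `<=` good_at t.
  apply: ((compact_near_coveringP _).1 (@segment_compact R a b) R (+oo)%R good_at _) => theta.
  rewrite /= in_itv/= => /andP[ath _]; have th0 : 0 < theta by exact: lt_le_trans ath.
  have e2 : 0 < e / 2 by rewrite divr_gt0.
  have [r r0 [A AP]] := mixture_local th0 e2.
  have [r' r'0 r'P] := mixture_limit_continuous th0 e2.
  exists (ball theta (Num.min r r'), [set t | A < t]) => /=.
    split; first by apply: nbhsx_ballx; rewrite lt_min r0 r'0.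
    exact/nbhs_pinfty_gt/num_real.
  move=> [th t] /= [+ At] th_gt0 n nE; rewrite /ball/= distrC lt_min => /andP[h h'].
  have hG : `|G t n - H theta| < e / 2 by apply: AP => //; rewrite nE.
  have hH := r'P th th_gt0 h'.
  rewrite (_ : G t n - H th = (G t n - H theta) - (H th - H theta)); last by ring.
  by apply: le_trans (ler_normB _ _) _; rewrite [e]splitr lerD// ltW.
apply: filterS => t sub n /andP[an nb].
apply: (sub (n%:R / t)) => //; first by rewrite /= in_itv/= an.
exact: lt_le_trans an.
Qed.

Hypothesis H_bounds : forall theta, 0 < theta -> 0 <= H theta <= 1.

Let Hpos (x : R) : R := if 0 < x then H x else 0.

(** [H] is controlled only at positive arguments. Clipping at [m^-1] makes the product continuous on
    the whole line, and the window vanishes wherever the clipping acts. *)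
Let Hwin (m x : R) : R := H (Num.max x m^-1) * window m x.

Let Hwin_continuous m : 0 < m -> continuous (Hwin m).
Proof.
move=> m0 x; apply: cvgM; last exact: window_continuous.
have mx0 y : 0 < Num.max y m^-1 by rewrite lt_max invr_gt0 m0 orbT.
have cmax : Num.max y m^-1 @[y --> x] --> Num.max x m^-1.
  by apply: (@continuous_max _ _ id (cst m^-1)); [exact: cvg_id|exact: cst_continuous].
apply/cvgrPdist_le => e e0.
have [r r0 rP] := mixture_limit_continuous (mx0 x) e0.
have near_r : \forall y \near x, `|Num.max x m^-1 - Num.max y m^-1| < r.
  exact: (cvgrPdist_lt _ _).1 cmax _ r0.
by apply: filterS near_r => y yr; rewrite distrC; apply: rP => //; rewrite distrC.
Qed.

Let HwinE m x : 0 < m -> Hwin m x = Hpos x * window m x.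
Proof.
move=> m0; rewrite /Hwin /Hpos.
have [->|wx] := eqVneq (window m x) 0; first by rewrite !mulr0.
have /andP[mx xm] := window_neq0 m0 wx.
by rewrite max_l// (lt_le_trans _ mx)// invr_gt0.
Qed.

Let Hpos_bounds x : 0 <= Hpos x <= 1.
Proof. by rewrite /Hpos; case: ifPn => [/H_bounds//|_]; rewrite lexx ler01. Qed.

Let norm_le1 (c : R) : 0 <= c <= 1 -> `|c| <= 1.
Proof. by case/andP => c0 c1; rewrite ger0_norm. Qed.

Let Hwin_norm m x : 0 < m -> `|Hwin m x| <= 1.
Proof.
move=> m0; rewrite HwinE// normrM mulr_ile1//; apply: norm_le1 => //.
exact: window_bounds.
Qed.

Let frac (t : R) (x : T) : R := (N t x)%:R / t.

Let cvg_frac f : continuous f -> (forall y, `|f y| <= 1) ->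
  \int[P]_x f (frac t x) @[t --> +oo] --> \int[Q]_x f (Theta x).
Proof.
move=> cf f1.
have := N_cvg cf (ex_intro _ 1 f1).
have mf : measurable_fun setT f by exact: continuous_measurable_fun.
have -> : ('E_Q[f \o Theta])%E = (\int[Q]_x f (Theta x))%:E.
  rewrite unlock fineK//; apply: integrable_fin_num => //.
  apply: (@bounded_integrable_prob _ _ _ Q (f \o Theta) 1); first exact: measurableT_comp.
  by move=> x; exact: f1.
by move/fine_cvg; rewrite unlock.
Qed.

(** Since [Theta] is positive almost surely, a wide window loses little of its mass, and by [N_cvg]
    little of that of [N t / t]. Inside the window [G t (N t)] is uniformly close to [H] at
    [N t / t], to which [N_cvg] applies. *)
Lemma cvg_mixture : \int[P]_x G t (N t x) @[t --> +oo] -->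
  \int[Q]_x (if 0 < Theta x then H (Theta x) else 0).
Proof.
have mG t : measurable_fun setT (fun x => G t (N t x)).
  exact: (@measurableT_comp _ _ _ _ _ _ (G t : nat -> R)).
have mfrac t : measurable_fun setT (frac t).
  exact: (@measurableT_comp _ _ _ _ _ _ (fun n : nat => n%:R / t : R)).
have mwin (m : R) : measurable_fun setT (window m).
  by apply: continuous_measurable_fun; exact: window_continuous.
have win_cvg : \int[Q]_x window k.+1%:R (Theta x) @[k --> \oo] --> (1 : R).
  have : (\int[Q]_x (window k.+1%:R (Theta x))%:E)%E @[k --> \oo] --> (\int[Q]_x (1 : R)%:E)%E.
    apply: (@dominated_cvg_near _ _ R Q _ (fun k x => window k.+1%:R (Theta x)) (fun=> 1) (fun=> 1)) => //.
    - by move=> k; exact: (measurableT_comp (mwin _)).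
    - by apply: filterS Theta_gt0 => x x0 _; exact: cvg_window.
    - by apply: (@bounded_integrable_prob _ _ _ Q _ 1) => // x; rewrite normr1.
    - by apply: nearW => k x _; apply: norm_le1; exact: window_bounds.
  have -> : (\int[Q]_x (1 : R)%:E)%E = 1%:E.
    by rewrite (integral_cst Q measurableT 1%E) mul1e; exact: probability_setT.
  exact: fine_cvg.
have mHpos : measurable_fun setT (fun x => Hpos (Theta x)).
  apply: (measurableT_comp (f := Hpos)) => //.
  apply: (@measurable_fun_cvg _ _ _ _ (fun k => Hwin k.+1%:R)).
    by move=> k; apply: continuous_measurable_fun; exact: Hwin_continuous.
  move=> x _.
  have -> : (fun k => Hwin k.+1%:R x) = (fun k => Hpos x * window k.+1%:R x).
    by apply/funext => k; rewrite HwinE.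
  have [x0|x0] := ltP 0 x.
    rewrite -[X in _ --> X]mulr1; apply: cvgM; first exact: cvg_cst.
    exact: cvg_window.
  have Hx0 : Hpos x = 0 by rewrite /Hpos ltNge x0.
  rewrite Hx0 (_ : (fun k => _) = fun=> 0); first exact: cvg_cst.
  by apply/funext => k; rewrite mul0r.
apply/cvgrPdist_le => e e0; have e8 : 0 < e / 8 by rewrite divr_gt0.
have e4 : 0 < e / 4 by rewrite divr_gt0.
have [m m0 hm] : exists2 m : R, 0 < m & 1 - \int[Q]_x window m (Theta x) <= e / 8.
  have [k _ /(_ k (leqnn k)) hk] := (cvgrPdist_le _ _).1 win_cvg _ e8.
  by exists k.+1%:R => //; apply: le_trans hk; exact: ler_norm.
have dQ_ : `|\int[Q]_x Hpos (Theta x) - \int[Q]_x (Hpos (Theta x) * window m (Theta x))| <=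
    1 * (1 - \int[Q]_x window m (Theta x)).
  apply: Rintegral_defect => //; first exact: measurableT_comp.
  - by move=> x; exact: norm_le1.
  - by move=> x; exact: window_bounds.
have hwin := cvg_frac (@window_continuous R m) (fun y => norm_le1 (window_bounds m y)).
have hHwin := cvg_frac (Hwin_continuous m0) (fun y => Hwin_norm y m0).
have unif := mixture_uniform m (_ : 0 < m^-1) e4.
have {}unif : \forall t \near +oo, forall n, m^-1 <= n%:R / t <= m ->
    `|G t n - H (n%:R / t)| <= e / 4 by apply: unif; rewrite invr_gt0.
near=> t.
have t0 : 0 < t by near: t; exact/nbhs_pinfty_gt/num_real.
have unift : forall n, m^-1 <= n%:R / t <= m -> `|G t n - H (n%:R / t)| <= e / 4 by near: t.
have dP_ : `|\int[P]_x G t (N t x) - \int[P]_x (G t (N t x) * window m (frac t x))| <=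
    1 * (1 - \int[P]_x window m (frac t x)).
  apply: Rintegral_defect => //; first exact: measurableT_comp.
  - by move=> x; apply: norm_le1; exact: G_bounds.
  - by move=> x; exact: window_bounds.
have h1 : `|\int[Q]_x window m (Theta x) - \int[P]_x window m (frac t x)| <= e / 8.
  by near: t; exact: (cvgrPdist_le _ _).1 hwin _ e8.
have h2 : `|\int[Q]_x Hwin m (Theta x) - \int[P]_x Hwin m (frac t x)| <= e / 4.
  by near: t; exact: (cvgrPdist_le _ _).1 hHwin _ e4.
have h3 : `|\int[P]_x (G t (N t x) * window m (frac t x)) - \int[P]_x Hwin m (frac t x)| <= e / 4.
  apply: (@Rintegral_dist _ _ _ P _ _ 1).
  - by apply: measurable_funM => //; exact: measurableT_comp.
  - apply: measurableT_comp => //; apply: continuous_measurable_fun; exact: Hwin_continuous.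
  - move=> x; rewrite normrM mulr_ile1//; apply: norm_le1; first exact: G_bounds.
    exact: window_bounds.
  - move=> x; rewrite HwinE// -mulrBl normrM.
    have [->|wx] := eqVneq (window m (frac t x)) 0; first by rewrite normr0 mulr0 ltW.
    have fx := window_neq0 m0 wx; rewrite -[leRHS]mulr1; apply: ler_pM => //.
      rewrite /Hpos (lt_le_trans _ (proj1 (andP fx))) ?invr_gt0//; exact: unift.
    by apply: norm_le1; exact: window_bounds.
have h4 : \int[Q]_x Hwin m (Theta x) = \int[Q]_x (Hpos (Theta x) * window m (Theta x)).
  by apply: eq_Rintegral => x _; rewrite HwinE.
rewrite -/Hpos; move: dQ_ dP_ h1 h2 h3; rewrite -h4 !mul1r !ler_norml.
move=> /andP[? ?] /andP[? ?] /andP[? ?] /andP[? ?] /andP[? ?].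
by apply/andP; split; lra.
Unshelve. all: by end_near. Qed.

End mixture.

(** Proved by Bernstein approximation: after rescaling a large cube to the unit one, the composition
    is a pointwise limit of polynomials in measurable functions; the cubes then exhaust the
    space. *)
Lemma measurable_continuous3 (R : realType) d (T : measurableType d) (P : probability T R)
    (f : R * R * R -> R) (a b c : T -> R) : continuous f -> (exists M, forall z, `|f z| <= M) ->
  measurable_fun setT a -> measurable_fun setT b -> measurable_fun setT c ->
  measurable_fun setT (fun x => f (a x, b x, c x)).
Proof.
move=> cf [M fM] ma mb mc.
pose to_unit (k : nat) (y : R) : R := Num.max 0 (Num.min 1 ((y + k.+1%:R) / (2 * k.+1%:R))).
pose of_unit (k : nat) (y : R) : R := 2 * k.+1%:R * y - k.+1%:R.
have unit_bounds k y : 0 <= to_unit k y <= 1.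
  by rewrite /to_unit le_max lexx ge_max ler01 ge_min lexx.
have unitK k y : `|y| <= k.+1%:R -> of_unit k (to_unit k y) = y.
  have k0 : 0 < k.+1%:R :> R by [].
  rewrite ler_norml => /andP[y1 y2]; rewrite /to_unit min_r; last first.
    by rewrite ler_pdivrMr; lra.
  rewrite max_r; last by rewrite divr_ge0//; lra.
  by rewrite /of_unit; move: (k.+1%:R : R) k0 => K K0; field; rewrite gt_eqF.
pose g (k : nat) (q : R * R * R) : R := f (of_unit k q.1.1, of_unit k q.1.2, of_unit k q.2).
pose q (k : nat) (x : T) := (to_unit k (a x), to_unit k (b x), to_unit k (c x)).
have cunit k : continuous (of_unit k).
  by move=> y; apply: cvgB; [apply: cvgM; [exact: cvg_cst|exact: cvg_id]|exact: cvg_cst].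
have cg k : continuous (g k).
  move=> z.
  have c1 : of_unit k x.1.1 @[x --> z] --> of_unit k z.1.1.
    by apply: continuous_cvg; [exact: cunit|exact: (cvg_comp _ _ cvg_fst cvg_fst)].
  have c2 : of_unit k x.1.2 @[x --> z] --> of_unit k z.1.2.
    by apply: continuous_cvg; [exact: cunit|exact: (cvg_comp _ _ cvg_fst cvg_snd)].
  have c3 : of_unit k x.2 @[x --> z] --> of_unit k z.2.
    by apply: continuous_cvg; [exact: cunit|exact: cvg_snd].
  have cz := cvg_triple (nbhs_filter _) c1 c2 c3.
  exact: (cvg_comp _ _ cz (cf _)).
have munit k h : measurable_fun setT h -> measurable_fun setT (fun x : T => to_unit k (h x)).
  move=> mh; apply: measurable_maxr => //; apply: measurable_minr => //.
  by apply: measurable_funM => //; exact: measurable_funD.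
have mq k : measurable_fun setT (q k).
  by apply: measurable_fun_pair; [apply: measurable_fun_pair|]; exact: munit.
have cubeq k x : in_cube (q k x) by split; exact: unit_bounds.
have mgq k : measurable_fun setT (g k \o q k).
  (* For a family constant in [t] the convergence of monomials is trivial, so [good_continuous]
     delivers the measurability it contains. *)
  have : good P P (fun _ : R => q k) (q k) (g k).
    apply: good_continuous => //.
    - by move=> ? ? ?; exact: cvg_cst.
    - by exists M => z; exact: fM.
  by case.
apply: (@measurable_fun_cvg _ _ _ _ (fun k => g k \o q k)) => // x _.
apply: (@cvg_trans _ (f (a x, b x, c x) @[_ --> \oo])); last exact: cvg_cst.
apply: near_eq_cvg; near=> k; rewrite /g /q /=.
have unitx y : `|y| <= k%:R -> of_unit k (to_unit k y) = y.
  by move=> yk; apply: unitK; apply: le_trans yk _; rewrite ler_nat.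
by rewrite !unitx//; near: k; exact: nbhs_infty_ger.
Unshelve. all: by end_near. Qed.

Lemma measurable_fun_nat_index d (T : measurableType d) d' (T' : measurableType d')
    (N : T -> nat) (h : nat -> T -> T') :
  measurable_fun setT N -> (forall n, measurable_fun setT (h n)) ->
  measurable_fun setT (fun x => h (N x) x).
Proof.
move=> mN mh _ B mB; rewrite setTI.
have -> : (fun x => h (N x) x) @^-1` B = \bigcup_n (N @^-1` [set n] `&` h n @^-1` B).
  apply/seteqP; split => [x Bx|x [n _ [<-]]//]; by exists (N x).
apply: bigcupT_measurable => n; apply: measurableI.
  by rewrite -[_ @^-1` _]setTI; exact: mN.
by rewrite -[_ @^-1` _]setTI; exact: mh.
Qed.

(** * Claims that are positive only almost surely *)

Section positive_part.
Context (R : realType) d (T : measurableType d) (P : probability T R).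

Let pos (y : R) : R := Num.max y 0.

Let measurable_pos : measurable_fun setT pos.
Proof. exact: measurable_maxr. Qed.

Lemma positive_part_exists (X : nat -> {RV P >-> R}) :
  exists X' : nat -> {RV P >-> R}, forall i x, X' i x = Num.max (X i x) 0.
Proof.
have m i : measurable_fun setT (fun x => Num.max (X i x) 0) by exact: measurable_maxr.
have h i : exists Y : {RV P >-> R}, forall x, Y x = Num.max (X i x) 0.
  pose f x := Num.max (X i x) 0.
  pose Y : {RV P >-> R} := HB.pack f (isMeasurableFun.Build _ _ _ _ f (m i)).
  by exists Y.
by have [X' X'P] := choice h; exists X'.
Qed.

Variables (X X' : nat -> {RV P >-> R}).
Hypothesis X'E : forall i x, X' i x = Num.max (X i x) 0.

Let preimageE i (B : set R) : X' i @^-1` B = X i @^-1` (pos @^-1` B).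
Proof. by apply/seteqP; split => x /=; rewrite X'E. Qed.

Let mpreimage (B : set R) : measurable B -> measurable (pos @^-1` B).
Proof. by move=> mB; rewrite -[_ @^-1` _]setTI; exact: measurable_pos. Qed.

Lemma positive_part_independent : mutually_independent X -> mutually_independent X'.
Proof.
move=> indep J B uJ mB; have := indep J (fun i => pos @^-1` B i) uJ (fun i => mpreimage (mB i)).
under eq_bigr do rewrite -preimageE.
by move=> <-; congr (P _); apply: eq_bigcapr => i _; rewrite preimageE.
Qed.

(** Positive parts are functions of the claims, so independence from the counting process is
    inherited. *)
Lemma positive_part_sigma : sigma_of [set: nat] X' `<=` sigma_of [set: nat] X.
Proof.
apply: sub_sigma_algebra2 => A [i _ [B mB <-]]; exists i => //.
by exists (pos @^-1` B); [exact: mpreimage|rewrite -preimageE].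
Qed.

Hypothesis X_gt0 : forall i, {ae P, forall x, 0 < X i x}.

Lemma positive_part_ae : {ae P, forall x, forall i, X' i x = X i x}.
Proof.
apply: ae_foralln => i; apply: filterS (X_gt0 i) => x x0.
by rewrite X'E max_l// ltW.
Qed.

Lemma positive_part_cdf i y : cdf (X' i) y = cdf (X i) y.
Proof.
have mB (Y : {RV P >-> R}) : measurable (Y @^-1` `]-oo, y]) by exact: measurable_funPTI.
have cdfE (Y : {RV P >-> R}) : cdf Y y = (\int[P]_x (\1_(Y @^-1` `]-oo, y]) x)%:E)%E.
  by rewrite integral_indic// setIT.
rewrite !cdfE; apply: ae_eq_integral => //.
- by apply/measurable_EFinP; exact: measurable_indic.
- by apply/measurable_EFinP; exact: measurable_indic.
apply: filterS positive_part_ae => x xE _; congr _%:E.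
by rewrite !indicE; congr (nat_of_bool _)%:R; apply/idP/idP; rewrite !inE/= xE.
Qed.

Lemma positive_part_expectation i : ('E_P[X' i])%E = ('E_P[X i])%E.
Proof.
rewrite unlock; apply: ae_eq_integral => //.
- exact/measurable_EFinP.
- exact/measurable_EFinP.
by apply: filterS positive_part_ae => x xE _; rewrite xE.
Qed.

End positive_part.

Lemma stats_ext (R : realType) (T : Type) (X X' : nat -> T -> R) (N : R -> T -> nat) s t x :
  (forall i, X' i x = X i x) ->
  [/\ large_claims X N s t x = large_claims X' N s t x,
      threshold_claim X N s t x = threshold_claim X' N s t x &
      small_claims X N s t x = small_claims X' N s t x].
Proof.
move=> XE.
have oE n r : order_stat X n r x = order_stat X' n r x.
  case: r => //= r; congr (nth _ (sort _ _) _).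
  by apply: eq_map => i; rewrite XE.
by split; [apply: eq_bigr => k _|rewrite /threshold_claim|apply: eq_bigr => k _]; rewrite ?oE.
Qed.

(** * Averaging over the number of claims and convergence for nonnegative claims *)

Section nonnegative_claims.
Context (R : realType) d (T : measurableType d) (P : probability T R)
  (X : nat -> {RV P >-> R}) (F : R -> R) (alpha : R) (l : R -> R)
  (N : R -> {RV P >-> nat})
  dQ (TQ : measurableType dQ) (Q : probability TQ R) (Theta : {RV Q >-> R}) (s : nat).
Hypothesis X_indep : mutually_independent X.
Hypothesis X_ge0 : forall i x, 0 <= X i x.
Hypothesis X_cdf : forall i (y : R), cdf (X i) y = (F y)%:E.
Hypothesis F_tail : forall y : R, 0 < y -> 1 - F y = y `^ (- alpha) * l y.
Hypothesis l_slow : slowly_varying l.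
Hypothesis alpha_gt1 : 1 < alpha.
Hypothesis NX_indep : independent_sigma P (sigma_of [set t : R | 0 <= t] N)
  (sigma_of [set: nat] X).
Hypothesis N_cvg : cvg_in_distribution P Q (fun t x => (N t x)%:R / t) Theta.
Hypothesis Theta_gt0 : {ae Q, forall x, 0 < Theta x}.
Local Notation U := (tail_quantile F).
Local Notation mean := (fine ('E_P[X 0%N])%E).
Local Notation H u v w := (limit_transform alpha s mean u v w).

Let mX i : measurable_fun setT (X i).
Proof. by []. Qed.

Lemma measurable_claims t : [/\ measurable_fun setT (large_claims X N s t),
  measurable_fun setT (threshold_claim X N s t) & measurable_fun setT (small_claims X N s t)].
Proof.
have mN : measurable_fun setT (N t) by [].
have mfun (g : R -> R -> R -> R) : (forall f1 f2 f3 : T -> R, measurable_fun setT f1 ->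
    measurable_fun setT f2 -> measurable_fun setT f3 ->
    measurable_fun setT (fun x => g (f1 x) (f2 x) (f3 x))) ->
    measurable_fun setT (fun x => g (large_claims X N s t x) (threshold_claim X N s t x)
      (small_claims X N s t x)).
  move=> mg; apply: (@measurable_fun_nat_index _ _ _ _ (N t) (fun n x =>
    g (\sum_((n - s).+1 <= k < n.+1) order_stat X n k x) (order_stat X n (n - s) x)
      (\sum_(1 <= k < n - s) order_stat X n k x))) => // n.
  exact: (@measurable_order_stat_functional R d T (fun i => X i) s _ n g).
split.
- exact: (mfun (fun a _ _ => a)).
- exact: (mfun (fun _ b _ => b)).
- exact: (mfun (fun _ _ c => c)).
Qed.

Lemma claims_ge0 t x : [/\ 0 <= large_claims X N s t x,
  0 <= threshold_claim X N s t x & 0 <= small_claims X N s t x].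
Proof.
by split; [apply: sumr_ge0 => k _| |apply: sumr_ge0 => k _]; exact: order_stat_ge0.
Qed.

Let sigmaX := sigma_of [set: nat] X.

Let sigmaX_preimage i B : measurable B -> sigmaX (X i @^-1` B).
Proof.
move=> mB; apply: sub_sigma_algebra; exists i => //.
by exists B => //; rewrite setTI.
Qed.

Let sigmaX_sigma : sigma_algebra setT sigmaX.
Proof. exact: smallest_sigma_algebra. Qed.

Let sigmaX_measurable : sigmaX `<=` measurable.
Proof.
apply: smallest_sub; first exact: sigma_algebra_measurable.
by move=> A [i _ [B mB <-]]; exact: mX.
Qed.

Let sigmaX_setI : setI_closed sigmaX.
Proof.
move=> A B sA sB; have mA : (measurable : set (set (g_sigma_algebraType sigmaX))) A.
  exact: sub_sigma_algebra.
have mB : (measurable : set (set (g_sigma_algebraType sigmaX))) B by exact: sub_sigma_algebra.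
have := measurableI _ _ mA mB.
by rewrite [X in X _ -> _](_ : _ = sigmaX)//; exact: sigma_algebra_id.
Qed.

(** The pair lemma with [N t] as first variable and the sigma-algebra of the claims as [G]: the
    number of claims is frozen at [N t x] while the claims are integrated. The independence
    hypothesis concerns the times [0 <= t]. *)
Lemma mixture_laplace t a b c : 0 <= t -> 0 <= a -> 0 <= b -> 0 <= c ->
  \int[P]_x expR (- a * large_claims X N s t x - b * threshold_claim X N s t x -
     c * small_claims X N s t x) = \int[P]_x stat_laplace X s (N t x) a b c.
Proof.
move=> t0 a0 b0 c0.
pose f (z : nat * g_sigma_algebraType sigmaX) : \bar R := (stat_kernel X s z.1 a b c z.2)%:E.
have mXG i : measurable_fun (setT : set (g_sigma_algebraType sigmaX)) (X i : T -> R).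
  by move=> _ B mB; rewrite setTI; apply: sub_sigma_algebra; exact: sigmaX_preimage.
have mf : measurable_fun setT f.
  apply/measurable_EFinP.
  apply: (@measurable_fun_nat_index _ _ _ _ fst
    (fun n (z : nat * g_sigma_algebraType sigmaX) => stat_kernel X s n a b c z.2)) => // n.
  pose g (x y z : R) := expR (- a * x - b * y - c * z).
  apply: (@measurableT_comp _ _ _ _ _ _
    (stat_kernel X s n a b c : g_sigma_algebraType sigmaX -> R)); last exact: measurable_snd.
  apply: (@measurable_order_stat_functional R _ (g_sigma_algebraType sigmaX)
    (fun i => X i : T -> R) s _ n g) => //.
  move=> f1 f2 f3 m1 m2 m3; apply: (measurableT_comp (@measurable_expR R)).
  by apply: measurable_funB; first apply: measurable_funB; exact: measurable_funM.
have f0 z : (0 <= f z)%E by rewrite lee_fin expR_ge0.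
have indep A B : measurable A -> sigmaX B -> P (N t @^-1` A `&` B) = (P (N t @^-1` A) * P B)%E.
  move=> mA sB; apply: NX_indep => //.
  apply: sub_sigma_algebra; exists t => //; exists A => //; by rewrite setTI.
have GT : sigmaX setT.
  by rewrite -(preimage_setT (X 0%N)); exact: sigmaX_preimage.
rewrite /Rintegral; congr fine.
have := integral_independent_pair sigmaX_measurable sigmaX_setI GT indep mf f0.
rewrite /f /= => ->; apply: eq_integral => x _.
by have [-> _] := stat_laplaceE s X_ge0 (N t x) a0 b0 c0.
Qed.

Let alpha_gt0 : 0 < alpha := lt_trans ltr01 alpha_gt1.
Let mean_ge0 : 0 <= mean := claim_mean_ge0 X_ge0.

Let U_ge0 t : 1 < t -> 0 <= U t.
Proof. exact: (tail_quantile_ge0 (X_ge0 0%N) (X_cdf 0%N)). Qed.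

Lemma cvg_laplace_statistics u v w : 0 <= u -> 0 <= v -> 0 <= w ->
  \int[P]_x expR (- u * (large_claims X N s t x / U t) -
    v * (threshold_claim X N s t x / U t) - w * (small_claims X N s t x / t))
    @[t --> +oo] --> \int[Q]_x (if 0 < Theta x then fine (H u v w (Theta x)) else 0).
Proof.
move=> u0 v0 w0.
(* [U t] is known to be nonnegative only for [1 < t]; the default value 0 gives bounds at all
   positive times and does not affect the limit. *)
pose G t n := if 1 < t then stat_laplace X s n (u / U t) (v / U t) (w / t) else 0.
have G_bounds (t : R) n : 0 < t -> 0 <= G t n <= 1.
  move=> t0; rewrite /G; case: ifPn => [t1|_]; last by rewrite lexx ler01.
  have a0 : 0 <= u / U t by rewrite divr_ge0// U_ge0.
  have b0 : 0 <= v / U t by rewrite divr_ge0// U_ge0.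
  have c0 : 0 <= w / t by rewrite divr_ge0// ltW.
  by have [_] := stat_laplaceE s X_ge0 n a0 b0 c0.
have GH (t : nat -> R) (n : nat -> nat) (theta : R) : t k @[k --> \oo] --> +oo ->
    (n k)%:R / t k @[k --> \oo] --> theta -> 0 < theta ->
    G (t k) (n k) @[k --> \oo] --> fine (H u v w theta).
  move=> t_cvg n_cvg th0.
  have : stat_laplace X s (n k) (u / U (t k)) (v / U (t k)) (w / t k) @[k --> \oo] -->
      fine (H u v w theta).
    exact: (cvg_stat_laplace X_indep X_ge0 X_cdf F_tail l_slow).
  apply: cvg_trans; apply: near_eq_cvg.
  by apply: filterS (near_gt_seq t_cvg 1) => k t1; rewrite /G t1.
have H_bounds (theta : R) : 0 < theta -> 0 <= fine (H u v w theta) <= 1.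
  move=> th0; have /andP[h0 h1] := limit_transform_bounds s alpha_gt0 mean_ge0 th0 u0 v0 w0.
  by rewrite fine_ge0//= -[leRHS]/(fine 1%E) fine_le// ge0_fin_numE// (le_lt_trans h1)// ltry.
have := cvg_mixture N_cvg Theta_gt0 G_bounds GH H_bounds.
apply: cvg_trans; apply: near_eq_cvg; near=> t.
have t1 : 1 < t by near: t; exact/nbhs_pinfty_gt/num_real.
have t0 : 0 <= t by rewrite ltW// (lt_trans ltr01).
rewrite /G t1 -mixture_laplace// ?divr_ge0 ?U_ge0//.
apply: eq_Rintegral => x _; congr expR.
by rewrite !mulNr !mulrA ![_ * _ / _]mulrAC.
Unshelve. all: by end_near. Qed.

Lemma limit_laplace u v w : 0 <= u -> 0 <= v -> 0 <= w ->
  (\int[Q]_x H u v w (Theta x) =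
   (\int[Q]_x (if 0 < Theta x then fine (H u v w (Theta x)) else 0))%:E)%E.
Proof.
move=> u0 v0 w0.
have mH := @measurable_limit_transform R alpha s mean alpha_gt0 _ _ Q Theta u v w u0.
have mh : measurable_fun setT (fun x => if 0 < Theta x then fine (H u v w (Theta x)) else 0).
  apply: measurable_fun_ifT => //; first exact: measurable_fun_ltr.
  exact: (measurableT_comp (fine_measurable measurableT)).
have Hfin theta : 0 < theta -> H u v w theta \is a fin_num /\ 0 <= fine (H u v w theta) <= 1.
  move=> th0; have /andP[h0 h1] := limit_transform_bounds s alpha_gt0 mean_ge0 th0 u0 v0 w0.
  have hf : H u v w theta \is a fin_num by rewrite ge0_fin_numE// (le_lt_trans h1)// ltry.
  by split => //; rewrite -!lee_fin fineK// h0 h1.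
rewrite (@ae_eq_integral _ _ _ Q setT
  (fun x => (if 0 < Theta x then fine (H u v w (Theta x)) else 0)%:E))//; last 2 first.
- exact/measurable_EFinP.
- by apply: filterS Theta_gt0 => x x0 _; rewrite x0 fineK//; exact: (Hfin _ x0).1.
have [] := bounded_integral Q mh => // x.
by case: ifPn => [/Hfin[]//|_]; rewrite lexx ler01.
Qed.

(** The continuity theorem needs nonnegative variables at every [t], so the normalized statistics
    are replaced by 0 for [t <= 1], where the sign of [U t] is not controlled. *)
Lemma statistics_cvg : exists (d' : measure_display) (T' : measurableType d')
    (P' : probability T' R) (Lambda Xi Sigma : {RV P' >-> R}),
  cvg_in_distribution P P'
    (fun t x => (large_claims X N s t x / U t, threshold_claim X N s t x / U t,
                 small_claims X N s t x / t))
    (fun x => (Lambda x, Xi x, Sigma x)) /\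
  forall u v w : R, 0 <= u -> 0 <= v -> 0 <= w ->
    joint_laplace Lambda Xi Sigma u v w = (\int[Q]_x H u v w (Theta x))%E.
Proof.
have [d' [T' [P' [Lambda [Xi [Sigma [L0 X0 S0 LE]]]]]]] :=
  limit_space s alpha_gt0 mean_ge0 Theta_gt0.
exists d', T', P', Lambda, Xi, Sigma; split => //.
pose L t x := if 1 < t then large_claims X N s t x / U t else 0.
pose Y t x := if 1 < t then threshold_claim X N s t x / U t else 0.
pose S t x := if 1 < t then small_claims X N s t x / t else 0.
have mL t : measurable_fun setT (L t).
  rewrite /L; case: (1 < t) => //; have [m _ _] := measurable_claims t.
  exact: (measurable_funM m (measurable_cst _)).
have mY t : measurable_fun setT (Y t).
  rewrite /Y; case: (1 < t) => //; have [_ m _] := measurable_claims t.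
  exact: (measurable_funM m (measurable_cst _)).
have mS t : measurable_fun setT (S t).
  rewrite /S; case: (1 < t) => //; have [_ _ m] := measurable_claims t.
  exact: (measurable_funM m (measurable_cst _)).
have L_ge0 t x : 0 <= L t x.
  by rewrite /L; case: ifPn => // /U_ge0 ?; have [? _ _] := claims_ge0 t x; exact: divr_ge0.
have Y_ge0 t x : 0 <= Y t x.
  by rewrite /Y; case: ifPn => // /U_ge0 ?; have [_ ? _] := claims_ge0 t x; exact: divr_ge0.
have S_ge0 t x : 0 <= S t x.
  rewrite /S; case: ifPn => // t1; have [_ _ ?] := claims_ge0 t x.
  by rewrite divr_ge0// ltW// (lt_trans ltr01).
have laplace_cvg u v w : 0 <= u -> 0 <= v -> 0 <= w ->
    \int[P]_x expR (- u * L t x - v * Y t x - w * S t x) @[t --> +oo] -->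
    \int[P']_x expR (- u * Lambda x - v * Xi x - w * Sigma x).
  move=> u0 v0 w0.
  have -> : \int[P']_x expR (- u * Lambda x - v * Xi x - w * Sigma x) =
      \int[Q]_x (if 0 < Theta x then fine (H u v w (Theta x)) else 0).
    apply: EFin_inj; rewrite -limit_laplace// -LE// /joint_laplace unlock.
    have mk : measurable_fun setT (fun x => expR (- u * Lambda x - v * Xi x - w * Sigma x)).
      apply: (measurableT_comp (@measurable_expR R)).
      by apply: measurable_funB; first apply: measurable_funB; exact: measurable_funM.
    have [] := bounded_integral P' mk => // x; rewrite expR_ge0/= expR_le1 mulNr -!opprD oppr_le0.
    by rewrite !addr_ge0 ?mulr_ge0.
  apply: cvg_trans (cvg_laplace_statistics u0 v0 w0); apply: near_eq_cvg; near=> t.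
  have t1 : 1 < t by near: t; exact/nbhs_pinfty_gt/num_real.
  by rewrite /L /Y /S t1.
have mV (V : {RV P' >-> R}) : measurable_fun setT V by [].
have cvgZ := cvg_in_distribution_of_laplace mL mY mS (mV Lambda) (mV Xi) (mV Sigma)
  L_ge0 Y_ge0 S_ge0 L0 X0 S0 laplace_cvg.
move=> f cf fM; apply: cvg_trans (cvgZ f cf fM); apply: near_eq_cvg; near=> t.
have t1 : 1 < t by near: t; exact/nbhs_pinfty_gt/num_real.
by rewrite /L /Y /S t1.
Unshelve. all: by end_near. Qed.

End nonnegative_claims.

Lemma mixing_transform_cst1 (R : realType) d (T : measurableType d) (Q : probability T R)
    (Theta : {RV Q >-> R}) r a : {ae Q, forall x, Theta x = 1} ->
  mixing_transform Theta r a = expR (- a).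
Proof.
move=> Theta1; rewrite /mixing_transform unlock.
have mf : measurable_fun setT (fun x => (expR (- a * Theta x) * Theta x ^+ r)%:E).
  apply/measurable_EFinP; apply: measurable_funM; last exact: measurable_funX.
  by apply: (measurableT_comp (@measurable_expR R)); exact: measurable_funM.
rewrite (@ae_eq_integral _ _ _ Q setT (cst (expR (- a))%:E))//; last first.
  by apply: filterS Theta1 => x -> _; rewrite expr1n mulr1 mulr1.
by rewrite (integral_cst Q measurableT) [X in (_ * X)%E](@probability_setT _ _ _ Q) mule1.
Qed.

Theorem proposition4p1 (R : realType)
    (d : measure_display) (T : measurableType d) (P : probability T R)
    (X : nat -> {RV P >-> R}) (F : R -> R) (alpha : R) (l : R -> R)
    (N : R -> {RV P >-> nat})
    (dQ : measure_display) (TQ : measurableType dQ) (Q : probability TQ R)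
    (Theta : {RV Q >-> R}) (s : nat)
    (X_indep : mutually_independent X)
    (X_gt0 : forall i, {ae P, forall x, 0 < X i x})
    (X_cdf : forall i (y : R), cdf (X i) y = (F y)%:E)
    (F_tail : forall y : R, 0 < y -> 1 - F y = y `^ (- alpha) * l y)
    (l_slow : slowly_varying l)
    (alpha_gt1 : 1 < alpha)
    (N_counting : forall (x : T) (t1 t2 : R), 0 <= t1 -> t1 <= t2 -> (N t1 x <= N t2 x)%N)
    (NX_indep : independent_sigma P (sigma_of [set t : R | 0 <= t] N)
                                    (sigma_of [set: nat] X))
    (N_cvg : cvg_in_distribution P Q (fun t x => (N t x)%:R / t) Theta)
    (Theta_gt0 : {ae Q, forall x, 0 < Theta x}) :
  let gamma := alpha^-1 in
  let U := tail_quantile F in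
  let mean := fine ('E_P[X 0%N])%E in
  exists (d' : measure_display) (T' : measurableType d')
         (P' : probability T' R) (Lambda Xi Sigma : {RV P' >-> R}),
    [/\ cvg_in_distribution P P'
          (fun t x => (large_claims X N s t x / U t,
                       threshold_claim X N s t x / U t,
                       small_claims X N s t x / t))
          (fun x => (Lambda x, Xi x, Sigma x)),
        forall u v w : R, 0 <= u -> 0 <= v -> 0 <= w ->
          joint_laplace Lambda Xi Sigma u v w =
          ((s`!%:R^-1)%R%:E * \int[lebesgue_measure]_(z in `]0%R, +oo[)
             (pareto_factor gamma u z ^+ s * expR (- v * z `^ (- gamma)) *
              mixing_transform Theta s.+1 (z + w * mean))%R%:E)%E &
        {ae Q, forall x, Theta x = 1} ->
        forall u v w : R, 0 <= u -> 0 <= v -> 0 <= w ->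
          joint_laplace Lambda Xi Sigma u v w =
          ((expR (- w * mean) * s`!%:R^-1)%R%:E *
           \int[lebesgue_measure]_(z in `]0%R, +oo[)
             (pareto_factor gamma u z ^+ s *
              expR (- v * z `^ (- gamma) - z))%R%:E)%E].
Proof.
move=> gamma U mean.
have alpha_gt0 : 0 < alpha := lt_trans ltr01 alpha_gt1.
(* The positive parts are nonnegative everywhere and agree with the claims almost surely, all
   indices at once. *)
have [X' X'E] := positive_part_exists X.
have X'_ge0 i x : 0 <= X' i x by rewrite X'E le_max lexx orbT.
have X'_cdf i y : cdf (X' i) y = (F y)%:E by rewrite (positive_part_cdf X'E X_gt0).
have NX'_indep : independent_sigma P (sigma_of [set t : R | 0 <= t] N)
    (sigma_of [set: nat] X').
  by move=> A B sA sB; apply: NX_indep => //; exact: (positive_part_sigma X'E).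
have meanE : fine ('E_P[X' 0%N])%E = mean.
  by rewrite /mean (positive_part_expectation X'E X_gt0).
have mean_ge0 : 0 <= mean by rewrite -meanE; exact: claim_mean_ge0.
have [d' [T' [P' [Lambda [Xi [Sigma [cvgZ LE]]]]]]] := statistics_cvg s
  (positive_part_independent X'E X_indep) X'_ge0 X'_cdf F_tail l_slow alpha_gt1
  NX'_indep N_cvg Theta_gt0.
rewrite -/mean meanE in LE.
have {}LE u v w : 0 <= u -> 0 <= v -> 0 <= w -> joint_laplace Lambda Xi Sigma u v w =
    ((s`!%:R^-1)%R%:E * \int[lebesgue_measure]_(z in `]0%R, +oo[)
      (pareto_factor gamma u z ^+ s * expR (- v * z `^ (- gamma)) *
       mixing_transform Theta s.+1 (z + w * mean))%R%:E)%E.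
  by move=> u0 v0 w0; rewrite LE// limit_transform_mixing.
exists d', T', P', Lambda, Xi, Sigma; split => //.
- move=> f cf fM; apply: cvg_trans (cvgZ f cf fM).
  have mZ (Y : nat -> {RV P >-> R}) t : measurable_fun setT (fun x =>
      f (large_claims Y N s t x / U t, threshold_claim Y N s t x / U t,
         small_claims Y N s t x / t)).
    have [m1 m2 m3] := measurable_claims Y N s t.
    by apply: (measurable_continuous3 P) => //; exact: measurable_funM.
  (* Back to the original claims: the two expectations agree at every [t] because the integrands
     agree almost everywhere. *)
  apply: near_eq_cvg; apply: nearW => t; rewrite unlock.
  apply: ae_eq_integral => //; [exact/measurable_EFinP/mZ|exact/measurable_EFinP/mZ|].
  apply: filterS (positive_part_ae X'E X_gt0) => x xE _ /=.
  by have [-> -> ->] := @stats_ext R T (fun i => X i) (fun i => X' i) (fun r => N r) s t x xE.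
move=> Theta1 u v w u0 v0 w0; rewrite LE//.
transitivity ((s`!%:R^-1)%R%:E * \int[lebesgue_measure]_(z in `]0%R, +oo[)
  ((expR (- w * mean))%:E * (pareto_factor gamma u z ^+ s * expR (- v * z `^ (- gamma) - z))%R%:E))%E.
  congr (_ * _)%E; apply: eq_integral => z _.
  rewrite mixing_transform_cst1// -EFinM; congr _%:E.
  rewrite mulrCA -mulrA; congr (_ * _); rewrite -!expRD; congr expR; ring.
rewrite ge0_integralZl//; first by rewrite muleA -EFinM mulrC.
- apply/measurable_EFinP.
  (* At [theta = 1] and [w = 0] the limit kernel is this integrand divided by [s!], so its
     measurability can be reused. *)
  apply: (eq_measurable_fun (fun z => s`!%:R * limit_kernel alpha s mean u v 0 1 z)).
    move=> z; rewrite inE/= in_itv/= andbT => z0.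
    rewrite /limit_kernel max_l// expr1n mul1r mulVKf ?pnatr_eq0 -?lt0n ?fact_gt0//.
    by rewrite -mulrA -expRD mul0r addr0 mulr1.
  by apply: measurable_funM => //; exact: measurable_limit_kernel.
- move=> z; rewrite /= in_itv/= andbT => z0.
  have /andP[p0 _] := pareto_factor_bounds alpha_gt0 u0 z0.
  by rewrite lee_fin mulr_ge0 ?expR_ge0 ?exprn_ge0.
Qed.
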